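(* Let $M$ be the Kripke model (with settling-down transition functions) defined in the context. Then $M\models$ ''the Dedekind reals do not form a set''; that is, every node $r$ of $M$ satisfies $\neg\exists z\,\forall S\,(S\in z\leftrightarrow S\text{ is a Dedekind real})$.
   Context: The models $M_n$. Let $M_0\prec M_1\prec\cdots$ be an $\omega$-sequence of models of ZF with elementary embeddings $f:M_n\to M_{n+1}$ (all embeddings of the sequence, including composites, are denoted $f$) such that for each $n$ the sequence from $M_n$ on is definable in $M_n$, and $M_n$ thinks that $M_{n+1}$ has non-standard integers (e.g. an iterated ultrapower by a non-principal ultrafilter on $\omega$). Frame. A (non-rooted) tree with $\omega$ many levels; the nodes of level $n$ are the reals of $M_n$. A real $r'$ of $M_{n+1}$ is an immediate successor of a real $r$ of $M_n$ iff $f(r)-r'$ (computed in $M_{n+1}$) is infinitesimal in the sense of $M_n$, i.e. $r$ is the standard part of $r'$. The order is generated by immediate succession. Terms. The universe at a node of level $n$ consists of the terms of $M_n$, defined inductively inside $M_n$: a term is a set of the form $\{\langle\sigma_i,J_i\rangle\mid i\in I\}\cup\{\langle\sigma_h,r_h\rangle\mid h\in H\}$, where each $\sigma_i,\sigma_h$ is a term, each $J_i$ an open set of reals, each $r_h$ a real, and $I,H$ are index sets, all in $M_n$. For a term $\sigma$ and a real $r$ of $M_n$, inductively $\sigma^r=\{\langle\sigma_i^r,\mathbb R\rangle\mid\langle\sigma_i,J_i\rangle\in\sigma\wedge r\in J_i\}\cup\{\langle\sigma_h^r,\mathbb R\rangle\mid\langle\sigma_h,r\rangle\in\sigma\}$.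 Transition functions. From a node $r$ to an immediate successor $s$ there are two transition functions: the elementary embedding $f$ applied to terms, and $g$ with $g(\sigma)=f(\sigma)^s$. Transition functions to non-immediate successors are arbitrary compositions of immediate ones. Primitive relations. For open sets $J$ of reals, by simultaneous induction (evaluated in $M_n$): $J\Vdash\sigma=_M\tau$ iff for all $\langle\sigma_i,J_i\rangle\in\sigma$, $J\cap J_i\Vdash\sigma_i\in_M\tau$, and symmetrically with $\sigma,\tau$ interchanged, and for all $r\in J$, $\sigma^r=\tau^r$. $J\Vdash\sigma\in_M\tau$ iff for all $r\in J$ there are $\langle\tau_i,J_i\rangle\in\tau$ and an open $J'\subseteq J$ with $r\in J'\cap J_i\Vdash\sigma=_M\tau_i$, and for all $r\in J$, $\langle\sigma^r,\mathbb R\rangle\in\tau^r$. At a node $r$: $r\models\sigma=_M\tau$ iff $J\Vdash\sigma=_M\tau$ for some open $J\ni r$, and likewise for $\in_M$. The model $M$ is obtained by taking the quotient by $=_M$ at each node. Satisfaction. $r\models\phi$ is Kripke satisfaction: $\wedge,\vee,\exists$ are evaluated locally at $r$; $r\models\phi\to\psi$ iff for every transition function $h$ from $r$ to a node $s$ (including the identity on $r$), $s\models h(\phi)$ implies $s\models h(\psi)$; $r\models\forall x\,\phi(x)$ iff for every such $h$ and every term $\sigma$ at $s$, $s\models h(\phi)(\sigma)$, where $h$ acts on the parameters. $\neg\phi$ is $\phi\to\bot$. $M\models\phi$ means $r\models\phi$ for all nodes $r$. A Dedekind real (left cut) is a set $S\subseteq\mathbb Q$ such that (boundedness) $\exists r\in\mathbb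 Q\,(r\in S)\wedge\exists r'\in\mathbb Q\,(r'\notin S)$; (openness) $\forall r\in S\,\exists r'\in S\,(r<r')$; (locatedness) $\forall r,s\in\mathbb Q\,[r<s\rightarrow r\in S\vee s\notin S]$. *)

(* Defs.v *)
From Stdlib Require Import Arith.

(** * First-order formulas of the language of set theory

    Variables are de Bruijn indices.  Every abbreviation below takes the
    indices of its arguments, so an argument [x] becomes [k + x] under [k]
    quantifiers; in [alls k A] and [exs k A] the [k] bound variables are
    [0, ..., k-1], in no significant order. *)

Inductive fml : Type :=
| FMem (i j : nat)
| FEq (i j : nat)
| FBot
| FAnd (A B : fml)
| FOr (A B : fml)
| FImp (A B : fml)
| All (A : fml)
| Ex (A : fml).

Declare Scope fml_scope.
Delimit Scope fml_scope with fml.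
Bind Scope fml_scope with fml.

Definition FNot (A : fml) : fml := FImp A FBot.
Definition FIff (A B : fml) : fml := FAnd (FImp A B) (FImp B A).

Notation "i ∈ j" := (FMem i j) (at level 70) : fml_scope.
Notation "i ≐ j" := (FEq i j) (at level 70) : fml_scope.
Notation "¬ A" := (FNot A) (at level 75, right associativity) : fml_scope.
Notation "A ∧ B" := (FAnd A B) (at level 80, right associativity) : fml_scope.
Notation "A ∨ B" := (FOr A B) (at level 85, right associativity) : fml_scope.
Notation "A ↔ B" := (FIff A B) (at level 95, no associativity) : fml_scope.
Notation "A → B" := (FImp A B)
  (at level 99, B at level 200, right associativity) : fml_scope.

Fixpoint alls (k : nat) (A : fml) : fml :=
  match k with O => A | S k => All (alls k A) end.
Fixpoint exs (k : nat) (A : fml) : fml :=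
  match k with O => A | S k => Ex (exs k A) end.

(** * Structures, Tarskian satisfaction, ZF *)

Record structure : Type := { carrier :> Type; mem : carrier -> carrier -> Prop }.
Arguments mem {_} _ _.

Definition scons {X : Type} (x : X) (e : nat -> X) (i : nat) : X :=
  match i with O => x | S i => e i end.
Definition cst {X : Type} (x : X) : nat -> X := fun _ => x.
Notation "x .: e" := (scons x e) (at level 55, right associativity).

Fixpoint sat {M : structure} (e : nat -> M) (A : fml) : Prop :=
  match A with
  | FMem i j => mem (e i) (e j)
  | FEq i j => e i = e j
  | FBot => False
  | FAnd A B => sat e A /\ sat e B
  | FOr A B => sat e A \/ sat e B
  | FImp A B => sat e A -> sat e B
  | All A => forall x, sat (x .: e) A
  | Ex A => exists x, sat (x .: e) A
  end.

Definition is_empty {M : structure} (x : M) : Prop := forall z, ~ mem z x.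
Definition is_succ {M : structure} (x y : M) : Prop :=
  forall z, mem z y <-> mem z x \/ z = x.

Record ZF (M : structure) : Prop := {
  zf_extensionality : forall x y : M, (forall z, mem z x <-> mem z y) -> x = y;
  zf_foundation : forall x : M, (exists y, mem y x) ->
    exists y, mem y x /\ forall z, mem z y -> ~ mem z x;
  zf_pairing : forall x y : M, exists p, forall z, mem z p <-> z = x \/ z = y;
  zf_union : forall x : M, exists u, forall z,
    mem z u <-> exists y, mem y x /\ mem z y;
  zf_power : forall x : M, exists p, forall y,
    mem y p <-> forall z, mem z y -> mem z x;
  zf_infinity : exists w : M, (exists x, is_empty x /\ mem x w) /\
    forall x, mem x w -> exists y, is_succ x y /\ mem y w;
  zf_separation : forall (A : fml) (e : nat -> M) (x : M), exists y, forall z,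
    mem z y <-> mem z x /\ sat (z .: e) A;
  zf_replacement : forall (A : fml) (e : nat -> M) (x : M),
    (forall a b c, mem a x ->
       sat (b .: a .: e) A -> sat (c .: a .: e) A -> b = c) ->
    exists y, forall b, mem b y <-> exists a, mem a x /\ sat (b .: a .: e) A }.

Definition elementary {M N : structure} (f : M -> N) : Prop :=
  forall (A : fml) (e : nat -> M), sat e A <-> sat (fun i => f (e i)) A.

(** * Formulas for basic notions *)

Local Open Scope fml_scope.

Definition Sub (x y : nat) : fml := All (0 ∈ S x → 0 ∈ S y).
Definition Inter (x y z : nat) : fml := All (0 ∈ S z ↔ 0 ∈ S x ∧ 0 ∈ S y).
Definition Empty (x : nat) : fml := All (¬ 0 ∈ S x).
Definition Succ (x y : nat) : fml := All (0 ∈ S y ↔ 0 ∈ S x ∨ 0 ≐ S x).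

(* [p = {x,y}], resp. [p = {{x},{x,y}}] *)
Definition UPair (x y p : nat) : fml := All (0 ∈ S p ↔ 0 ≐ S x ∨ 0 ≐ S y).
Definition OPair (x y p : nat) : fml :=
  exs 2 (UPair (2 + x) (2 + x) 0 ∧ UPair (2 + x) (2 + y) 1 ∧ UPair 0 1 (2 + p)).

(* [<x,y> ∈ P], resp. [<x,<y,z>> ∈ P] *)
Definition PairIn (x y P : nat) : fml := Ex (OPair (S x) (S y) 0 ∧ 0 ∈ S P).
Definition TripleIn (x y z P : nat) : fml :=
  Ex (OPair (S y) (S z) 0 ∧ PairIn (S x) 0 (S P)).

(** ** Natural numbers: members of every inductive set *)

Definition Inductive_set (I : nat) : fml :=
  All (Empty 0 → 0 ∈ S I) ∧ alls 2 (0 ∈ 2 + I → Succ 0 1 → 1 ∈ 2 + I).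
Definition Nat (x : nat) : fml := All (Inductive_set 0 → S x ∈ 0).

(* [a + b = c]: [<b,c>] is in every set that contains [<0,a>] and is closed
   under [<y,z> |-> <y+1,z+1>]. *)
Definition Plus (a b c : nat) : fml :=
  All (All (Empty 0 → PairIn 0 (2 + a) 1) →
       alls 4 (PairIn 0 1 4 → Succ 0 2 → Succ 1 3 → PairIn 2 3 4) →
       PairIn (S b) (S c) 0).

(* [a * b = c]: [<b,c>] is in every set that contains [<0,0>] and is closed
   under [<y,z> |-> <y+1,z+a>]. *)
Definition Times (a b c : nat) : fml :=
  All (All (Empty 0 → PairIn 0 0 1) →
       alls 4 (PairIn 0 1 4 → Succ 0 2 → Plus 1 (5 + a) 3 → PairIn 2 3 4) →
       PairIn (S b) (S c) 0).

Inductive aexp : Type :=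
| AVar (i : nat)
| AAdd (s t : aexp)
| AMul (s t : aexp).

Declare Scope aexp_scope.
Delimit Scope aexp_scope with aexp.
Bind Scope aexp_scope with aexp.
Notation "# i" := (AVar i) (at level 1, i at level 0) : aexp_scope.
Notation "s + t" := (AAdd s t) : aexp_scope.
Notation "s * t" := (AMul s t) : aexp_scope.

(* The value of [t], with its variables shifted by [k], is [z]. *)
Fixpoint Val (k : nat) (t : aexp) (z : nat) : fml :=
  match t with
  | AVar i => (k + i) ≐ z
  | AAdd s t => exs 2 (Val (2 + k) s 0 ∧ Val (2 + k) t 1 ∧ Plus 0 1 (2 + z))
  | AMul s t => exs 2 (Val (2 + k) s 0 ∧ Val (2 + k) t 1 ∧ Times 0 1 (2 + z))
  end.
Definition AEq (s t : aexp) : fml := Ex (Val 1 s 0 ∧ Val 1 t 0).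
Definition ALt (s t : aexp) : fml := exs 2 (Val 2 s 0 ∧ Val 2 t 1 ∧ 0 ∈ 1).

(** ** Rational numbers

    The rational [(a - b) / c] in lowest terms is coded by [<a,<b,c>>], where
    [a], [b], [c] are natural numbers, [c] is not [0], one of [a], [b] is [0],
    and [a + b] is coprime to [c]; distinct codes denote distinct rationals. *)

Definition Frac (a b c q : nat) : fml :=
  Ex (OPair (S b) (S c) 0 ∧ OPair (S a) 0 (S q)).

Definition Rat (q : nat) : fml :=
  exs 3 (let a := 0 in let b := 1 in let c := 2 in
    Nat a ∧ Nat b ∧ Nat c ∧ Frac a b c (3 + q) ∧
    ¬ Empty c ∧ (Empty a ∨ Empty b) ∧
    alls 3 (let d := 0 in let m := 1 in let n := 2 in
      Nat d → Nat m → Nat n →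
      AEq (#d * #m) (#(3 + a) + #(3 + b)) → AEq (#d * #n) (#(3 + c)) →
      Ex (Empty 0 ∧ Succ 0 (S d)))).

(* The next two formulas are used for codes [p], [q], [s] of rationals only:
   [p < q] and [p + q = s], cross-multiplied. *)
Definition RatLt (p q : nat) : fml :=
  exs 6 (let a := 0 in let b := 1 in let c := 2 in
         let a' := 3 in let b' := 4 in let c' := 5 in
    Frac a b c (6 + p) ∧ Frac a' b' c' (6 + q) ∧
    ALt (#a * #c' + #b' * #c) (#a' * #c + #b * #c')).

Definition RatAdd (p q s : nat) : fml :=
  exs 9 (let a := 0 in let b := 1 in let c := 2 in
         let a' := 3 in let b' := 4 in let c' := 5 in
         let a'' := 6 in let b'' := 7 in let c'' := 8 in
    Frac a b c (9 + p) ∧ Frac a' b' c' (9 + q) ∧ Frac a'' b'' c'' (9 + s) ∧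
    AEq ((#a * #c' + #a' * #c) * #c'' + #b'' * (#c * #c'))
        ((#b * #c' + #b' * #c) * #c'' + #a'' * (#c * #c'))).

Definition RatZero (z : nat) : fml :=
  exs 2 (Empty 0 ∧ Succ 0 1 ∧ Frac 0 0 1 (2 + z)).
Definition RatPos (q : nat) : fml := Rat q ∧ Ex (RatZero 0 ∧ RatLt 0 (S q)).

(** ** Dedekind reals (left cuts)

    The same formula [Ded] is read classically in the models [M_n], to define
    their reals, and in the Kripke model. *)

Definition Ded (x : nat) : fml :=
  All (0 ∈ S x → Rat 0) ∧
  (Ex (Rat 0 ∧ 0 ∈ S x) ∧ Ex (Rat 0 ∧ ¬ 0 ∈ S x)) ∧
  All (0 ∈ S x → Ex (0 ∈ 2 + x ∧ RatLt 1 0)) ∧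
  alls 2 (Rat 0 → Rat 1 → RatLt 0 1 → 0 ∈ 2 + x ∨ ¬ 1 ∈ 2 + x).

(* [x < q] for a real [x] and a rational [q]; note that [q < x] is [q ∈ x]. *)
Definition LtRat (x q : nat) : fml := Ex (Rat 0 ∧ RatLt 0 (S q) ∧ ¬ 0 ∈ S x).

(* [d = x - y], i.e. [d = {q | q + b ∈ x for some rational b ∉ y}] *)
Definition RealSub (x y d : nat) : fml :=
  All (0 ∈ S d ↔
    Rat 0 ∧ exs 2 (Rat 0 ∧ Rat 1 ∧ ¬ 0 ∈ 3 + y ∧ RatAdd 2 0 1 ∧ 1 ∈ 3 + x)).

(* [-q < d < q] for a real [d] and a rational [q] *)
Definition AbsLtRat (d q : nat) : fml :=
  exs 2 (Rat 0 ∧ RatZero 1 ∧ RatAdd 0 (2 + q) 1 ∧ 0 ∈ 2 + d) ∧ LtRat d q.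

Definition Reals (X : nat) : fml := All (0 ∈ S X ↔ Ded 0).

Definition Open (J : nat) : fml :=
  All (0 ∈ S J → Ded 0) ∧
  All (0 ∈ S J →
    exs 2 (let p := 0 in let q := 1 in let x := 2 in
      Rat p ∧ Rat q ∧ p ∈ x ∧ LtRat x q ∧
      All (Ded 0 → S p ∈ 0 → LtRat 0 (S q) → 0 ∈ 4 + J))).

(** * Terms

    By Foundation, [s] belongs to the inductively defined class of terms iff it
    belongs to a set [T] all of whose members consist of pairs [<t,j>] with
    [t ∈ T] and [j] an open set or a real.  No real is an open set, since no
    rational is a real, so the two kinds of pairs are never confused. *)

Definition Term (s : nat) : fml :=
  Ex (let T := 0 in S s ∈ T ∧
    All (0 ∈ S T →
      All (0 ∈ 1 →
        exs 2 (let t := 0 in let j := 1 in let x := 2 in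
          OPair t j x ∧ t ∈ (4 + T) ∧ (Open j ∨ Ded j))))).

(* The pairs [<t,j>] of a term that survive at the real [r] *)
Definition Active (r j : nat) : fml := (Open j ∧ r ∈ j) ∨ j ≐ r.

(* [t = s^r].  The recursion is witnessed by a set [F] of pairs [<u,u^r>] that
   contains [<s,t>] and is closed under passing to the active members of [u]. *)
Definition Settle (r s t : nat) : fml :=
  Ex (let F := 0 in PairIn (S s) (S t) F ∧
    alls 2 (let u := 0 in let v := 1 in PairIn u v (2 + F) →
      alls 2 (let u' := 0 in let j := 1 in
        PairIn u' j (2 + u) → Active (5 + r) j →
        Ex (PairIn (S u') 0 (5 + F)))
      ∧
      All (let z := 0 in z ∈ S v ↔
        exs 4 (let u' := 0 in let j := 1 in let v' := 2 in let X := 3 in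
          PairIn u' j (5 + u) ∧ Active (8 + r) j ∧ PairIn u' v' (7 + F) ∧
          Reals X ∧ OPair v' X (4 + z))))).

(** * Forcing of the primitive relations by open sets

    [Ae] and [Am] are sets of triples [<J,<s,t>>]; [EqStep] and [MemStep] are
    the two clauses of the simultaneous induction, with the recursive calls
    replaced by membership in [Am] and [Ae].  The recursive calls occur
    positively and go down along a well-founded relation, so [J] forces
    [s =_M t] iff [<J,<s,t>>] belongs to some [Ae] with which [Ae], [Am] satisfy
    the clauses from left to right. *)

Definition EqHalf (Am J s t : nat) : fml :=
  alls 2 (let u := 0 in let j := 1 in
    PairIn u j (2 + s) → Open j →
    Ex (Inter (3 + J) (S j) 0 ∧ TripleIn 0 (S u) (3 + t) (3 + Am))).

Definition EqStep (Am J s t : nat) : fml :=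
  EqHalf Am J s t ∧ EqHalf Am J t s ∧
  All (0 ∈ S J → Ex (Settle 1 (2 + s) 0 ∧ Settle 1 (2 + t) 0)).

Definition MemStep (Ae J s t : nat) : fml :=
  All (let r := 0 in r ∈ S J →
    exs 4 (let u := 0 in let j := 1 in let J' := 2 in let K := 3 in
      PairIn u j (5 + t) ∧ Open j ∧ Open J' ∧ Sub J' (5 + J) ∧
      Inter J' j K ∧ (4 + r) ∈ K ∧ TripleIn K (5 + s) u (5 + Ae))
    ∧
    exs 3 (let s' := 0 in let t' := 1 in let X := 2 in
      Settle (3 + r) (4 + s) s' ∧ Settle (3 + r) (4 + t) t' ∧
      Reals X ∧ PairIn s' X t')).

Definition Justified (Ae Am : nat) : fml :=
  alls 3 (TripleIn 0 1 2 (3 + Ae) → EqStep (3 + Am) 0 1 2) ∧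
  alls 3 (TripleIn 0 1 2 (3 + Am) → MemStep (3 + Ae) 0 1 2).

Definition ForcesEq (J s t : nat) : fml :=
  exs 2 (Justified 0 1 ∧ TripleIn (2 + J) (2 + s) (2 + t) 0).
Definition ForcesMem (J s t : nat) : fml :=
  exs 2 (Justified 0 1 ∧ TripleIn (2 + J) (2 + s) (2 + t) 1).

(* The primitive relations at the node [r] *)
Definition AtEq (r s t : nat) : fml :=
  Ex (Open 0 ∧ S r ∈ 0 ∧ ForcesEq 0 (S s) (S t)).
Definition AtMem (r s t : nat) : fml :=
  Ex (Open 0 ∧ S r ∈ 0 ∧ ForcesMem 0 (S s) (S t)).

Local Close Scope fml_scope.

(** * The sequence of models *)

Fixpoint numeral {M : structure} (k : nat) (x : M) : Prop :=
  match k with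
  | O => is_empty x
  | S k => exists y, numeral k y /\ is_succ y x
  end.

(* The sequence from [M n] on is definable in [M n]: with parameters [p], the
   formulas [dom], [rel], [emb] define, uniformly in a natural number of [M n],
   the universes, the membership relations and the embeddings.  The [k]-th
   model so defined is identified with [M (k + n)] by [iota k]. *)
Definition tail_definable (M : nat -> structure)
    (f : forall n, M n -> M (S n)) (n : nat) : Prop :=
  exists (dom rel emb : fml) (p : nat -> M n)
         (iota : forall k, M (k + n) -> M n),
    (forall x : M n, iota 0 x = x) /\
    forall (k : nat) (c : M n), numeral k c ->
      (forall x y : M (k + n), iota k x = iota k y -> x = y) /\
      (forall y : M n, sat (y .: c .: p) dom <-> exists x, iota k x = y) /\
      (forall x y : M (k + n),
         sat (iota k x .: iota k y .: c .: p) rel <-> mem x y) /\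
      (forall (x : M (k + n)) (y : M (S k + n)),
         sat (iota k x .: iota (S k) y .: c .: p) emb <-> f (k + n) x = y).

Record model_sequence : Type := {
  Mod :> nat -> structure;
  emb : forall n, Mod n -> Mod (S n);
  Mod_ZF : forall n, ZF (Mod n);
  emb_elementary : forall n, elementary (emb n);
  Mod_tail_definable : forall n, tail_definable Mod emb n;
  (* [emb n] is definable in [Mod n], and identifies the integers of [Mod n]
     with an initial segment of those of [Mod (S n)]. *)
  Mod_nonstandard : forall n, exists c : Mod (S n),
    sat (cst c) (Nat 0) /\
    forall k : Mod n, sat (cst k) (Nat 0) -> emb n k <> c }.
Arguments emb {_ _} _.

(** * The Kripke model *)

Section Kripke.
Variable M : model_sequence.

Definition is_real {n : nat} (r : M n) : Prop := sat (cst r) (Ded 0).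
Definition is_term {n : nat} (s : M n) : Prop := sat (cst s) (Term 0).

(* For real numbers [r] and [s]: [f(r) - s] is smaller in absolute value than
   every positive rational of [M n]. *)
Definition immediate {n : nat} (r : M n) (s : M (S n)) : Prop :=
  exists d : M (S n),
    sat (emb r .: s .: cst d) (RealSub 0 1 2) /\
    forall q : M n, sat (cst q) (RatPos 0) ->
      sat (d .: cst (emb q)) (AbsLtRat 0 1).

(* Transition functions are only ever applied to terms; the value of [g]
   elsewhere is irrelevant. *)
Inductive step {n : nat} (r : M n) (s : M (S n)) : (M n -> M (S n)) -> Prop :=
| step_f : is_real s -> immediate r s -> step r s emb
| step_g (g : M n -> M (S n)) : is_real s -> immediate r s ->
    (forall t, is_term t ->
       sat (s .: emb t .: cst (g t)) (Settle 0 1 2)) ->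
    step r s g.

Inductive transition {n : nat} (r : M n) :
    forall m : nat, M m -> (M n -> M m) -> Prop :=
| transition_id : transition r n r (fun t => t)
| transition_step (m : nat) (s : M m) (h : M n -> M m)
    (s' : M (S m)) (k : M m -> M (S m)) :
    transition r m s h -> step s s' k ->
    transition r (S m) s' (fun t => k (h t)).

(* The assignment [e] gives representatives of the classes modulo [=_M], and
   equality is interpreted by [=_M]. *)
Fixpoint ksat (A : fml) {n : nat} (r : M n) (e : nat -> M n) : Prop :=
  match A with
  | FMem i j => sat (r .: e i .: cst (e j)) (AtMem 0 1 2)
  | FEq i j => sat (r .: e i .: cst (e j)) (AtEq 0 1 2)
  | FBot => False
  | FAnd A B => ksat A r e /\ ksat B r e
  | FOr A B => ksat A r e \/ ksat B r e
  | FImp A B => forall (m : nat) (s : M m) (h : M n -> M m),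
      transition r m s h ->
      ksat A s (fun i => h (e i)) -> ksat B s (fun i => h (e i))
  | All A => forall (m : nat) (s : M m) (h : M n -> M m),
      transition r m s h ->
      forall t : M m, is_term t -> ksat A s (t .: fun i => h (e i))
  | Ex A => exists t : M n, is_term t /\ ksat A r (t .: e)
  end.

Definition kripke_valid (A : fml) : Prop :=
  forall (n : nat) (r : M n), is_real r ->
  forall e : nat -> M n, (forall i, is_term (e i)) -> ksat A r e.

End Kripke.

(* Main.v *)
(* Suppose that at a node [s] the name [z] denotes the set of Dedekind reals.  Move by
   the settling transition function [g] to a real [s'] of the next model infinitely
   close to [s]; there [g z] is a settled name and still denotes the set of Dedekind
   reals.  The generic name [gen], the set of all pairs [<q^, {x | q in x}>], denotes a
   Dedekind real at every node, so some open [J] around [s'] forces [gen = t] with [t]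
   a member of [g z].  Then [x^ = gen^x = t^x = t] for every [x] in [J], because [t] is
   settled, so that [J] contains a single real.

   To see that [gen] denotes a Dedekind real at every node, arithmetical formulas are
   shown to be absolute on the names [x^] of sets of the ground model.  Equality of names
   is recovered from membership at the successors of a node: because of the non-standard
   integers, each real has a neighbourhood in the next model that consists of immediate
   successors. *)

From Stdlib Require Import Arith Setoid ClassicalEpsilon ssreflect ssrfun.
Require Import Defs.

(* Each [M n] is an arbitrary model of ZF whose integers may be non-standard. Induction, recursion
   and comprehension inside it are therefore available only for predicates given by formulas with
   parameters, and [Df] exists to certify that a Rocq predicate is one. Settling is unavoidable: an
   unsettled [z] may contain a pair of [gen] and an open set, and then [gen] is a member of it
   without contradiction. The delicate point in seeing that [gen] is a Dedekind real is negation. A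
   rational outside the cut at one node may enter it at the next, for instance when it equals the
   cut and the successor lies infinitesimally above. Only strict upper bounds persist ([above]);
   they suffice because locatedness compares two distinct rationals. Absoluteness of the integers
   meets arbitrary names of inductive sets. The forcing relations are definable in [M n], so the
   induction can be carried out there, over all of its integers. The definability of the sequence
   enters once: to take, in [M n], the least integer whose image is not below a given non-standard
   one. *)
Existing Class ZF.
Declare Scope zf_scope.
Open Scope zf_scope.
Notation "x ∈ y" := (mem x y) (at level 70) : zf_scope.

(** * Environments and renaming of variables *)

Definition tl {X : Type} (e : nat -> X) : nat -> X := fun i => e (S i).

Lemma sat_ext {M : structure} (A : fml) (e e' : nat -> M) :
  (forall i, e i = e' i) -> sat e A <-> sat e' A.
Proof.
elim: A e e' => [i j|i j||A IA B IB|A IA B IB|A IA B IB|A IA|A IA] e e' E /=.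
- by rewrite !E.
- by rewrite !E.
- done.
- by rewrite (IA e e') ?(IB e e').
- by rewrite (IA e e') ?(IB e e').
- by rewrite (IA e e') ?(IB e e').
- by split=> H x; move: (H x); apply IA => -[|i] /=.
- by split=> -[x H]; exists x; move: H; apply IA => -[|i] /=.
Qed.

Fixpoint ren (f : nat -> nat) (A : fml) : fml :=
  match A with
  | FMem i j => FMem (f i) (f j)
  | FEq i j => FEq (f i) (f j)
  | FBot => FBot
  | FAnd A B => FAnd (ren f A) (ren f B)
  | FOr A B => FOr (ren f A) (ren f B)
  | FImp A B => FImp (ren f A) (ren f B)
  | All A => All (ren (scons 0 (fun i => S (f i))) A)
  | Ex A => Ex (ren (scons 0 (fun i => S (f i))) A)
  end.

Lemma sat_ren {M : structure} (A : fml) (f : nat -> nat) (e : nat -> M) :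
  sat e (ren f A) <-> sat (fun i => e (f i)) A.
Proof.
elim: A f e => [i j|i j||A IA B IB|A IA B IB|A IA B IB|A IA|A IA] f e //=.
- by rewrite IA IB.
- by rewrite IA IB.
- by rewrite IA IB.
- by split=> H x; move: (H x); rewrite IA; apply sat_ext => -[|i].
- by split=> -[x H]; exists x; move: H; rewrite IA; apply sat_ext => -[|i].
Qed.

(* Even variables are the arguments, odd variables the parameters. *)
Definition mix {X : Type} (e p : nat -> X) (i : nat) : X :=
  if Nat.even i then e (Nat.div2 i) else p (Nat.div2 i).

Lemma mix_even {X : Type} (e p : nat -> X) i : mix e p (2 * i) = e i.
Proof. by rewrite /mix Nat.even_mul Nat.div2_double. Qed.
Lemma mix_odd {X : Type} (e p : nat -> X) i : mix e p (S (2 * i)) = p i.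
Proof. by rewrite /mix Nat.even_succ Nat.odd_mul Nat.div2_succ_double. Qed.

Lemma mixP (i : nat) : {j | i = 2 * j} + {j | i = S (2 * j)}.
Proof.
elim: i => [|i [[j ->]|[j ->]]].
- by left; exists 0.
- by right; exists j.
- by left; exists (S j) => /=; rewrite Nat.add_succ_r.
Qed.

Lemma inh (M : structure) {HZ : ZF M} : inhabited M.
Proof. by have [w _] := zf_infinity M HZ. Qed.

(** * Definability *)

Section Definability.
Context {M : structure} {HZ : ZF M}.

(** Separation and Replacement speak of formulas only. Working with predicates on environments
    replaces the writing of formulas by closure properties, which a syntax-directed tactic can
    apply; the parameters stay hidden in [p]. *)
Definition Df (P : (nat -> M) -> Prop) : Prop :=
  exists A p, forall e, P e <-> sat (mix e p) A.

(** A function is treated through its graph, with the value at variable 0 and the arguments shifted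
    up by one. *)
Definition DfT (t : (nat -> M) -> M) : Prop := Df (fun e => e 0 = t (tl e)).

Lemma Df_iff P Q : (forall e, P e <-> Q e) -> Df P -> Df Q.
Proof. by move=> E [A [p H]]; exists A, p => e; rewrite -E. Qed.

Lemma Df_ren (f : nat -> nat) P : Df P -> Df (fun e => P (fun i => e (f i))).
Proof.
move=> [A [p H]].
exists (ren (fun i => if Nat.even i then 2 * f (Nat.div2 i) else i) A), p => e.
rewrite H sat_ren; apply sat_ext => i.
case: (mixP i) => -[j ->]; rewrite ?mix_even ?mix_odd.
- by rewrite Nat.even_mul Nat.div2_double /= mix_even.
- by rewrite Nat.even_succ Nat.odd_mul /= mix_odd.
Qed.

Lemma Df_merge (P Q : (nat -> M) -> Prop) : Df P -> Df Q ->
  exists A B p, forall e, (P e <-> sat (mix e p) A) /\ (Q e <-> sat (mix e p) B).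
Proof.
move=> [A [p HA]] [B [q HB]].
(* Arguments stay where they are. Parameter [k] of the first formula becomes parameter [2 * k] of
   [mix p q], and parameter [k] of the second becomes parameter [2 * k + 1]. *)
exists (ren (fun i => if Nat.even i then i else S (2 * (2 * Nat.div2 i))) A),
  (ren (fun i => if Nat.even i then i else S (2 * S (2 * Nat.div2 i))) B),
  (mix p q) => e.
rewrite HA HB !sat_ren; split; apply sat_ext => i;
case: (mixP i) => -[j ->]; rewrite ?mix_even ?mix_odd.
- by rewrite Nat.even_mul /= mix_even.
- by rewrite Nat.even_succ Nat.odd_mul mix_odd Nat.div2_succ_double mix_even.
- by rewrite Nat.even_mul /= mix_even.
- by rewrite Nat.even_succ Nat.odd_mul mix_odd Nat.div2_succ_double mix_odd.
Qed.

Lemma Df_and P Q : Df P -> Df Q -> Df (fun e => P e /\ Q e).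
Proof.
move=> HP HQ; have [A [B [p H]]] := Df_merge _ _ HP HQ.
by exists (FAnd A B), p => e /=; have [-> ->] := H e.
Qed.
Lemma Df_or P Q : Df P -> Df Q -> Df (fun e => P e \/ Q e).
Proof.
move=> HP HQ; have [A [B [p H]]] := Df_merge _ _ HP HQ.
by exists (FOr A B), p => e /=; have [-> ->] := H e.
Qed.
Lemma Df_imp (P Q : (nat -> M) -> Prop) : Df P -> Df Q -> Df (fun e => P e -> Q e).
Proof.
move=> HP HQ; have [A [B [p H]]] := Df_merge _ _ HP HQ.
by exists (FImp A B), p => e /=; have [-> ->] := H e.
Qed.
(** Excluded middle decides [P], and a true or a false formula takes its place. Side conditions that
    do not mention the environment may thus occur in definable predicates. *)
Lemma Df_const (P : Prop) : Df (fun _ => P).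
Proof.
have [a] := inh M; case: (classic P) => h.
- exists (FImp FBot FBot), (fun _ => a) => e /=; tauto.
- exists FBot, (fun _ => a) => e /=; tauto.
Qed.
Lemma Df_false : Df (fun _ => False).
Proof. exact: Df_const. Qed.
Lemma Df_not P : Df P -> Df (fun e => ~ P e).
Proof. by move=> HP; apply: Df_imp => //; apply: Df_false. Qed.
Lemma Df_equiv P Q : Df P -> Df Q -> Df (fun e => P e <-> Q e).
Proof. by move=> HP HQ; apply: Df_and; apply: Df_imp. Qed.

Lemma Df_quant (P : M -> (nat -> M) -> Prop) : Df (fun e => P (e 0) (tl e)) ->
  exists A p, forall e x, P x e <-> sat (scons x (mix e p)) A.
Proof.
move=> [A [p H]].
(* Argument 0 becomes the bound variable. The remaining arguments move down to the preceding even
   variables, and everything is shifted by one under the binder. *)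
exists (ren (fun i => if Nat.even i
    then (match Nat.div2 i with 0 => 0 | S j => S (2 * j) end) else S i) A), p => e x.
rewrite (H (scons x e)) sat_ren; apply sat_ext => i.
case: (mixP i) => -[j ->]; rewrite ?mix_even ?mix_odd.
- rewrite Nat.even_mul Nat.div2_double /=.
  by case: j => [|j] //=; rewrite -[_ + _]/(2 * j) mix_even.
- by rewrite Nat.even_succ Nat.odd_mul; cbn -[mix Nat.mul]; rewrite mix_odd.
Qed.
Lemma Df_all (P : M -> (nat -> M) -> Prop) :
  Df (fun e => P (e 0) (tl e)) -> Df (fun e => forall x, P x e).
Proof.
move=> /Df_quant [A [p H]]; exists (All A), p => e /=.
by split=> h x; move: (h x); rewrite H.
Qed.
Lemma Df_ex (P : M -> (nat -> M) -> Prop) :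
  Df (fun e => P (e 0) (tl e)) -> Df (fun e => exists x, P x e).
Proof.
move=> /Df_quant [A [p H]]; exists (Ex A), p => e /=.
by split=> -[x h]; exists x; move: h; rewrite H.
Qed.

Lemma DfT_var i : DfT (fun e => e i).
Proof.
have [a] := inh M; exists (FEq 0 (2 * S i)), (fun _ => a) => e.
by rewrite /sat mix_even.
Qed.
Lemma DfT_cst a : DfT (fun _ => a).
Proof. by exists (FEq 0 1), (fun _ => a) => e. Qed.

Lemma DfT_tl t : DfT t -> DfT (fun e => t (tl e)).
Proof. by move=> /(Df_ren (scons 0 (fun i => S (S i)))). Qed.

(** Substitution of definable functions: their values are introduced by existential quantifiers over
    their graphs. *)
Lemma Df_bin (P : M -> M -> Prop) t u :
  Df (fun e => P (e 0) (e 1)) -> DfT t -> DfT u -> Df (fun e => P (t e) (u e)).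
Proof.
move=> HP Ht Hu.
apply: (Df_iff (fun e => exists x, x = t e /\ exists y, y = u e /\ P x y)) => [e|].
  split=> [[x [-> [y [-> ?]]]] //|h]; exists (t e); split=> //; by exists (u e).
apply: Df_ex; apply: Df_and; first exact: Ht.
apply: Df_ex; apply: Df_and; first exact: (DfT_tl _ Hu).
exact: (Df_ren (scons 1 (scons 0 (fun i => i))) _ HP).
Qed.

Lemma Df_atom_mem : Df (fun e => e 0 ∈ e 1).
Proof.
by have [a] := inh M; exists (FMem 0 2), (fun _ => a) => e.
Qed.
Lemma Df_atom_eq : Df (fun e => e 0 = e 1).
Proof. exact: (DfT_var 0). Qed.

Lemma Df_mem t u : DfT t -> DfT u -> Df (fun e => t e ∈ u e).
Proof. exact: (Df_bin mem _ _ Df_atom_mem). Qed.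
Lemma Df_eq t u : DfT t -> DfT u -> Df (fun e => t e = u e).
Proof. exact: (Df_bin eq _ _ Df_atom_eq). Qed.

Lemma DfT_scons t (E : (nat -> M) -> nat -> M) :
  DfT t -> (forall i, DfT (fun e => E e i)) -> forall i, DfT (fun e => (t e .: E e) i).
Proof. by move=> Ht HE [|i] //=. Qed.

Lemma Df_sat A (E : (nat -> M) -> nat -> M) :
  (forall i, DfT (fun e => E e i)) -> Df (fun e => sat (E e) A).
Proof.
elim: A E => [i j|i j||A IA B IB|A IA B IB|A IA B IB|A IA|A IA] E H /=.
- exact: Df_mem.
- exact: Df_eq.
- exact: Df_const.
- by apply: Df_and; [apply: IA|apply: IB].
- by apply: Df_or; [apply: IA|apply: IB].
- by apply: Df_imp; [apply: IA|apply: IB].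
- apply: Df_all; apply: IA => -[|i] /=; first exact: DfT_var.
  exact: (DfT_tl _ (H i)).
- apply: Df_ex; apply: IA => -[|i] /=; first exact: DfT_var.
  exact: (DfT_tl _ (H i)).
Qed.
End Definability.

(** * Definite descriptions *)

Section The.
Context {M : structure} {HZ : ZF M}.

Lemma ext (x y : M) : (forall z, z ∈ x <-> z ∈ y) -> x = y.
Proof. exact: zf_extensionality. Qed.

(* [the P] is the empty set unless exactly one element satisfies [P]. *)
Definition is_the (P : M -> Prop) (y : M) : Prop :=
  (P y /\ forall y', P y' -> y' = y) \/
  (~ (exists y, P y /\ forall y', P y' -> y' = y) /\ is_empty y).

Definition the (P : M -> Prop) : M := epsilon (inh M) (is_the P).

Lemma is_the_uniq P x y : is_the P x -> is_the P y -> x = y.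
Proof.
move=> [[Hx Ux]|[Nx Ex]] [[Hy Uy]|[Ny Ey]].
- exact: Uy.
- by case: Ny; exists x.
- by case: Nx; exists y.
- by apply: ext => z; split=> h; [case: (Ex z)|case: (Ey z)].
Qed.

Lemma the_is_the P : is_the P (the P).
Proof.
apply: (epsilon_spec (inh M) (is_the P)).
case: (classic (exists y, P y /\ forall y', P y' -> y' = y)) => [[y H]|H].
- by exists y; left.
- have [w [[e [He _]] _]] := zf_infinity M HZ.
  by exists e; right.
Qed.

Lemma the_spec (P : M -> Prop) :
  (exists y, P y) -> (forall y y', P y -> P y' -> y = y') -> P (the P).
Proof.
move=> [y Hy] U; case: (the_is_the P) => -[] //.
by case; exists y; split=> // y' h; apply: U.
Qed.

End The.
#[global] Opaque the.

Section DefinableTerms.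
Context {M : structure} {HZ : ZF M}.

(** Thanks to the default value, [is_the] holds of exactly one element whatever [P] is. It is thus
    the graph of [the], and it is first-order in [P]. *)
Lemma DfT_the (P : M -> (nat -> M) -> Prop) :
  Df (fun e => P (e 0) (tl e)) -> DfT (fun e => the (fun y => P y e)).
Proof.
move=> HP.
apply: (Df_iff (fun e => is_the (fun y => P y (tl e)) (e 0))) => [e|].
  by split=> [h|->]; [apply: is_the_uniq h _|]; apply: the_is_the.
have H1 : Df (fun e => P (e 0) (tl (tl e))).
  exact: (Df_ren (scons 0 (fun i => S (S i)))) _ HP.
have H2 : Df (fun e => P (e 0) (tl (tl (tl e)))).
  exact: (Df_ren (scons 0 (fun i => S (S (S i))))) _ HP.
have H3 : Df (fun e => forall y', P y' (tl (tl e)) -> y' = e 0).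
  apply: (Df_all (fun y' e => P y' (tl (tl e)) -> y' = e 0)); apply: Df_imp => //.
  by apply: Df_eq; [apply: DfT_var|apply: (DfT_var 1)].
apply: Df_or; apply: Df_and.
- exact: HP.
- apply: (Df_all (fun y' e => P y' (tl e) -> y' = e 0)); apply: Df_imp => //.
  by apply: Df_eq; [apply: DfT_var|apply: (DfT_var 1)].
- apply: Df_not.
  apply: (Df_ex (fun y e => P y (tl e) /\ forall y', P y' (tl e) -> y' = y)).
  exact: Df_and.
- apply: (Df_all (fun z e => ~ z ∈ e 0)).
  by apply: Df_not; apply: Df_mem; [apply: DfT_var|apply: (DfT_var 1)].
Qed.

Lemma Df_pred1 (P : M -> Prop) t : Df (fun e => P (e 0)) -> DfT t -> Df (fun e => P (t e)).
Proof. by move=> HP Ht; apply: (Df_bin (fun x _ => P x) t t). Qed.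
Lemma Df_pred_env (P : (nat -> M) -> Prop) (E : (nat -> M) -> nat -> M) :
  Df P -> (forall i, DfT (fun e => E e i)) -> Df (fun e => P (E e)).
Proof.
move=> [A [p H]] HE.
apply: (Df_iff (fun e => sat (mix (E e) p) A)) => [e|]; first by rewrite H.
apply: Df_sat => i; case: (mixP i) => -[j ->].
- by apply: (Df_iff _ _ _ (HE j)) => e; rewrite mix_even.
- by apply: (Df_iff _ _ _ (DfT_cst (p j))) => e; rewrite mix_odd.
Qed.
Lemma Df_pred3 (P : M -> M -> M -> Prop) t u v : Df (fun e => P (e 0) (e 1) (e 2)) ->
  DfT t -> DfT u -> DfT v -> Df (fun e => P (t e) (u e) (v e)).
Proof.
move=> HP Ht Hu Hv.
apply: (Df_pred_env _ (fun e => t e .: u e .: cst (v e)) HP).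
case=> [|[|i]] /=; [exact: Ht|exact: Hu|exact: Hv].
Qed.
Lemma Df_pred4 (P : M -> M -> M -> M -> Prop) t u v w :
  Df (fun e => P (e 0) (e 1) (e 2) (e 3)) ->
  DfT t -> DfT u -> DfT v -> DfT w -> Df (fun e => P (t e) (u e) (v e) (w e)).
Proof.
move=> HP Ht Hu Hv Hw.
apply: (Df_pred_env _ (fun e => t e .: u e .: v e .: cst (w e)) HP).
case=> [|[|[|i]]] /=; [exact: Ht|exact: Hu|exact: Hv|exact: Hw].
Qed.
Lemma DfT_fun1 (F : M -> M) t :
  Df (fun e => e 0 = F (e 1)) -> DfT t -> DfT (fun e => F (t e)).
Proof.
move=> HF /DfT_tl Ht.
exact: (Df_bin (fun y x => y = F x) (fun e => e 0) _ HF (DfT_var 0) Ht).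
Qed.
Lemma DfT_fun2 (F : M -> M -> M) t u :
  Df (fun e => e 0 = F (e 1) (e 2)) -> DfT t -> DfT u -> DfT (fun e => F (t e) (u e)).
Proof.
move=> HF /DfT_tl Ht /DfT_tl Hu.
apply: (Df_pred3 (fun y x z => y = F x z) (fun e => e 0) _ _ HF (DfT_var 0)); [exact: Ht|exact: Hu].
Qed.

Lemma DfT_fun3 (F : M -> M -> M -> M) t u v : Df (fun e => e 0 = F (e 1) (e 2) (e 3)) ->
  DfT t -> DfT u -> DfT v -> DfT (fun e => F (t e) (u e) (v e)).
Proof.
move=> HF /DfT_tl Ht /DfT_tl Hu /DfT_tl Hv.
apply: (Df_pred4 (fun y x z w => y = F x z w) (fun e => e 0) _ _ _ HF (DfT_var 0));
  [exact: Ht|exact: Hu|exact: Hv].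
Qed.

Lemma Df1_formula (P : M -> Prop) : Df (fun e => P (e 0)) ->
  exists A e, forall x, P x <-> sat (x .: e) A.
Proof.
move=> /(Df_quant (fun x _ => P x)) [A [p H]]; have [a] := inh M.
by exists A, (mix (cst a) p) => x; apply: H.
Qed.
Lemma Df2_formula (P : M -> M -> Prop) : Df (fun e => P (e 0) (e 1)) ->
  exists A e, forall x y, P x y <-> sat (x .: y .: e) A.
Proof.
move=> /(Df_quant (fun x e => P x (e 0))) [A [p H]]; have [a] := inh M.
exists A, (tl (mix (cst a) p)) => x y; rewrite (H (y .: cst a) x).
apply: sat_ext => -[|[|i]] //=; rewrite /tl.
case: (mixP i) => -[j ->]; first by rewrite !mix_odd.
by rewrite (_ : S (S (2 * j)) = 2 * S j) ?mix_even //= Nat.add_succ_r.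
Qed.
End DefinableTerms.

Create HintDb dfn.
Ltac dfn_step :=
  cbv beta delta [tl];
  lazymatch goal with
  | |- forall i : nat, DfT _ => first [apply DfT_scons | intros ?]
  | |- Df (fun _ => ?P) => apply Df_const
  | |- Df (fun e => _ /\ _) => apply Df_and
  | |- Df (fun e => _ \/ _) => apply Df_or
  | |- Df (fun e => ~ _) => apply Df_not
  | |- Df (fun e => _ <-> _) => apply Df_equiv
  | |- Df (fun e => exists x, _) => apply Df_ex
  (* An implication matches this pattern as a non-dependent product, so it is tried before the
     quantifier over the model. *)
  | |- Df (fun e => forall x, _) => first [apply Df_imp | apply Df_all]
  | |- Df (fun e => mem _ _) => apply Df_mem
  | |- Df (fun e => _ = _) => apply Df_eq
  | |- Df (fun e => sat _ _) => apply Df_sat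
  | |- DfT (fun _ => ?a) => apply DfT_cst
  | |- DfT (fun e => e _) => apply DfT_var
  | |- DfT (fun e => the _) => apply DfT_the
  | |- DfT (fun e => cst _ _) => unfold cst
  | |- _ => solve [auto 2 with dfn nocore]
  end.
Ltac dfn := solve [repeat dfn_step].

(** * Sets *)

Ltac set_uniq :=
  let h1 := fresh in let h2 := fresh in
  intros ? ? h1 h2; apply: ext => ?; rewrite h1 h2; reflexivity.

Section Sets.
Context {M : structure} {HZ : ZF M}.
Implicit Types x y z a b : M.

Definition emp : M := the is_empty.
Definition pair x y : M := the (fun p => forall z, z ∈ p <-> z = x \/ z = y).
Definition opair x y : M := pair (pair x x) (pair x y).
Definition bunion x : M := the (fun u => forall z, z ∈ u <-> exists y, y ∈ x /\ z ∈ y).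
Definition pow x : M := the (fun p => forall y, y ∈ p <-> forall z, z ∈ y -> z ∈ x).
Definition sep x (P : M -> Prop) : M := the (fun y => forall z, z ∈ y <-> z ∈ x /\ P z).
Definition rep x (F : M -> M) : M :=
  the (fun y => forall b, b ∈ y <-> exists a, a ∈ x /\ b = F a).
Definition union x y : M := bunion (pair x y).
Definition succ x : M := union x (pair x x).

Lemma emp_spec : is_empty emp.
Proof.
apply: the_spec; first by have [w [[e [He _]] _]] := zf_infinity M HZ; exists e.
by move=> x y hx hy; apply: ext => z; split=> h; [case: (hx z)|case: (hy z)].
Qed.
Lemma in_emp z : z ∈ emp <-> False.
Proof. by split=> // /emp_spec. Qed.
Lemma in_pair x y z : z ∈ pair x y <-> z = x \/ z = y.
Proof.
move: z; apply: (the_spec (fun p => forall z, z ∈ p <-> z = x \/ z = y)); last set_uniq.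
exact: zf_pairing.
Qed.
Lemma in_bunion x z : z ∈ bunion x <-> exists y, y ∈ x /\ z ∈ y.
Proof.
move: z; apply: (the_spec (fun u => forall z, z ∈ u <-> exists y, y ∈ x /\ z ∈ y)); last set_uniq.
exact: zf_union.
Qed.
Lemma in_pow x y : y ∈ pow x <-> forall z, z ∈ y -> z ∈ x.
Proof.
move: y; apply: (the_spec (fun p => forall y, y ∈ p <-> forall z, z ∈ y -> z ∈ x)); last set_uniq.
exact: zf_power.
Qed.
Lemma in_union x y z : z ∈ union x y <-> z ∈ x \/ z ∈ y.
Proof.
rewrite in_bunion; split=> [[u [/in_pair [] -> ?]]|[h|h]]; auto.
- by exists x; rewrite in_pair; auto.
- by exists y; rewrite in_pair; auto.
Qed.
Lemma in_succ x z : z ∈ succ x <-> z ∈ x \/ z = x.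
Proof. by rewrite in_union in_pair; intuition. Qed.
Lemma in_sep x (P : M -> Prop) : Df (fun e => P (e 0)) ->
  forall z, z ∈ sep x P <-> z ∈ x /\ P z.
Proof.
move=> /Df1_formula [A [e H]].
apply: (the_spec (fun y => forall z, z ∈ y <-> z ∈ x /\ P z)); last set_uniq.
have [y Hy] := zf_separation M HZ A e x.
by exists y => z; rewrite Hy H.
Qed.
Lemma in_rep x (F : M -> M) : Df (fun e => e 0 = F (e 1)) ->
  forall b, b ∈ rep x F <-> exists a, a ∈ x /\ b = F a.
Proof.
move=> /(Df2_formula (fun y x => y = F x)) [A [e H]].
apply: (the_spec (fun y => forall b, b ∈ y <-> exists a, a ∈ x /\ b = F a)); last set_uniq.
have [|y Hy] := zf_replacement M HZ A e x.
  by move=> a b c _; rewrite -!H => -> ->.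
by exists y => b; rewrite Hy; split=> -[a]; rewrite -?H => h; exists a; rewrite -?H.
Qed.

Lemma is_emptyP x : is_empty x <-> x = emp.
Proof.
split=> [h|->]; last exact: emp_spec.
by apply: ext => z; rewrite in_emp; split=> // /h.
Qed.
Lemma is_succP x y : is_succ x y <-> y = succ x.
Proof.
split=> [h|->]; last by move=> z; rewrite in_succ.
by apply: ext => z; rewrite in_succ h.
Qed.
Lemma pairP x y p : (forall z, z ∈ p <-> z = x \/ z = y) <-> p = pair x y.
Proof.
split=> [h|->]; last exact: in_pair.
by apply: ext => z; rewrite in_pair h.
Qed.

Lemma pair_inj x y x' y' : pair x y = pair x' y' ->
  (x = x' /\ y = y') \/ (x = y' /\ y = x').
Proof.
move=> E.
have h z : (z = x \/ z = y) <-> (z = x' \/ z = y') by rewrite -!in_pair E.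
have hx : x = x' \/ x = y' by apply/h; left.
have hy : y = x' \/ y = y' by apply/h; right.
have hx' : x' = x \/ x' = y by apply/h; left.
have hy' : y' = x \/ y' = y by apply/h; right.
by case: hx => ?; case: hy => ?; case: hx' => ?; case: hy' => ?; subst; auto.
Qed.
Lemma opair_inj x y x' y' : opair x y = opair x' y' -> x = x' /\ y = y'.
Proof.
by move=> /pair_inj [] [/pair_inj h1 /pair_inj h2]; intuition congruence.
Qed.

Lemma DfT_pair t u : DfT t -> DfT u -> DfT (fun e => pair (t e) (u e)).
Proof. by apply: DfT_fun2; rewrite /pair; dfn. Qed.
Lemma DfT_bunion t : DfT t -> DfT (fun e => bunion (t e)).
Proof. by apply: DfT_fun1; rewrite /bunion; dfn. Qed.
Lemma DfT_pow t : DfT t -> DfT (fun e => pow (t e)).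
Proof. by apply: DfT_fun1; rewrite /pow; dfn. Qed.
Lemma DfT_opair t u : DfT t -> DfT u -> DfT (fun e => opair (t e) (u e)).
Proof. by move=> ht hu; apply: DfT_pair; apply: DfT_pair. Qed.
Lemma DfT_union t u : DfT t -> DfT u -> DfT (fun e => union (t e) (u e)).
Proof. by move=> ht hu; apply: DfT_bunion; apply: DfT_pair. Qed.
Lemma DfT_succ t : DfT t -> DfT (fun e => succ (t e)).
Proof. by move=> ht; apply: DfT_union => //; apply: DfT_pair. Qed.
End Sets.
Arguments emp {M HZ}.

Hint Extern 0 (DfT (fun _ => pair _ _)) => apply DfT_pair; dfn : dfn.
Hint Extern 0 (DfT (fun _ => opair _ _)) => apply DfT_opair; dfn : dfn.
Hint Extern 0 (DfT (fun _ => bunion _)) => apply DfT_bunion; dfn : dfn.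
Hint Extern 0 (DfT (fun _ => union _ _)) => apply DfT_union; dfn : dfn.
Hint Extern 0 (DfT (fun _ => pow _)) => apply DfT_pow; dfn : dfn.
Hint Extern 0 (DfT (fun _ => succ _)) => apply DfT_succ; dfn : dfn.
Hint Extern 0 (DfT (fun _ => sep _ _)) => unfold sep; dfn : dfn.
Hint Extern 0 (DfT (fun _ => rep _ _)) => unfold rep; dfn : dfn.

(** * Natural numbers of a model *)

Section Omega.
Context {M : structure} {HZ : ZF M}.
Implicit Types x y z a b m n : M.

Lemma mem_asym x y : x ∈ y -> ~ y ∈ x.
Proof.
move=> h h'; have [|z [/in_pair hz H]] := zf_foundation M HZ (pair x y).
  by exists x; rewrite in_pair; left.
by case: hz => E; subst z; [apply: (H y)|apply: (H x)] => //; rewrite in_pair; auto.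
Qed.
Lemma succ_inj x y : succ x = succ y -> x = y.
Proof.
move=> E.
have /in_succ [h|//] : x ∈ succ y by rewrite -E in_succ; right.
have /in_succ [h'|//] : y ∈ succ x by rewrite E in_succ; right.
by case: (mem_asym _ _ h).
Qed.
Lemma succ_neq_emp x : succ x <> emp.
Proof. by move=> E; apply: (emp_spec x); rewrite -E in_succ; right. Qed.

Definition inductive_set (I : M) : Prop :=
  (forall z, is_empty z -> z ∈ I) /\ forall y x, x ∈ I -> is_succ x y -> y ∈ I.
(** Has the shape of the formula [Nat], so that [sat_Nat] holds by conversion. *)
Definition isnat x : Prop := forall I, inductive_set I -> x ∈ I.
Definition omega : M := the (fun w => forall z, z ∈ w <-> isnat z).

Lemma Df_isnat t : DfT t -> Df (fun e => isnat (t e)).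
Proof. by apply: Df_pred1; rewrite /isnat /inductive_set /is_empty /is_succ; dfn. Qed.

Lemma in_omega x : x ∈ omega <-> isnat x.
Proof.
move: x; apply: (the_spec (fun w => forall z, z ∈ w <-> isnat z)); last set_uniq.
have [w [[e [He ew]] Hw]] := zf_infinity M HZ.
exists (sep w isnat) => z; rewrite in_sep; first by apply Df_isnat; dfn.
split=> [[] //|h]; split=> //; apply: h; split.
- by move=> y /is_emptyP ->; move/is_emptyP: He => <-.
- by move=> y x /Hw [y' [/is_succP -> ?]] /is_succP ->.
Qed.
Lemma isnat0 : isnat emp.
Proof. by move=> I [h _]; apply: h; apply: emp_spec. Qed.
Lemma isnatS x : isnat x -> isnat (succ x).
Proof. by move=> hx I hI; apply: (proj2 hI _ x); [apply: hx|apply/is_succP]. Qed.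

(** Definability of [P] is what makes [sep omega P] a set of the model; it is then an inductive set,
    and every natural number belongs to it. Non-standard numbers are included. *)
Lemma nat_ind (P : M -> Prop) : Df (fun e => P (e 0)) -> P emp ->
  (forall x, isnat x -> P x -> P (succ x)) -> forall x, isnat x -> P x.
Proof.
move=> DP P0 PS x hx.
apply: (proj2 (proj1 (in_sep omega P DP x) _)).
apply: hx; split=> [z /is_emptyP ->|y z].
- by rewrite in_sep // in_omega; split=> //; apply: isnat0.
- rewrite !in_sep // !in_omega => -[hz Pz] /is_succP ->.
  by split; [apply: isnatS|apply: PS].
Qed.
Lemma nat_case x : isnat x -> x = emp \/ exists y, isnat y /\ x = succ y.
Proof.
move: x; apply: nat_ind => [||x hx _]; [|by left|by right; exists x].
apply: Df_or; first dfn; apply: Df_ex; apply: Df_and; last dfn.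
by apply Df_isnat; dfn.
Qed.
End Omega.

Hint Extern 0 (Df (fun _ => isnat _)) => apply Df_isnat; dfn : dfn.

(** * Recursion on the natural numbers *)

Section Recursion.
Context {M : structure} {HZ : ZF M}.
Implicit Types x y z a b m n : M.
Variable F : M -> M -> M.
Hypothesis DF : Df (fun e => e 0 = F (e 1) (e 2)).

(** [P] is a derivation: each of its pairs is the initial one or follows from another pair in it.
    Functionality is not demanded of [P]; uniqueness of the value comes from induction on [n]. *)
Definition rec_rel p a n y : Prop := exists P, opair n y ∈ P /\
  forall m v, opair m v ∈ P -> (m = emp /\ v = a) \/
    exists m' v', opair m' v' ∈ P /\ isnat m' /\ m = succ m' /\ v = F p v'.
Definition orec p a n : M := the (rec_rel p a n).

Lemma DfT_F t u : DfT t -> DfT u -> DfT (fun e => F (t e) (u e)).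
Proof. exact: DfT_fun2. Qed.
Hint Extern 0 (DfT (fun _ => F _ _)) => apply DfT_F; dfn : dfn.

Lemma DfT_orec t u v : DfT t -> DfT u -> DfT v -> DfT (fun e => orec (t e) (u e) (v e)).
Proof. by apply: DfT_fun3; rewrite /orec /rec_rel; dfn. Qed.

Lemma rec_rel0 p a y : rec_rel p a emp y <-> y = a.
Proof.
split=> [[P [h H]]|->].
- case: (H _ _ h) => [[] //|[m' [v' [_ [_ [/esym /succ_neq_emp []]]]]]].
- exists (pair (opair emp a) (opair emp a)); split; first by rewrite in_pair; left.
  by move=> m v /in_pair [] /opair_inj; left.
Qed.
Lemma rec_relS p a n y : isnat n ->
  rec_rel p a (succ n) y <-> exists v, rec_rel p a n v /\ y = F p v.
Proof.
move=> hn; split=> [[P [h H]]|[v [[P [h H]] ->]]].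
- case: (H _ _ h) => [[/succ_neq_emp [] //]|[m' [v' [h' [_ [/succ_inj E ->]]]]]].
  by subst m'; exists v'; split=> //; exists P.
- set q := opair (succ n) (F p v).
  exists (union P (pair q q)); split; first by rewrite in_union !in_pair; auto.
  move=> m w /in_union [/H [|[m' [v' [? ?]]]]|/in_pair hq]; auto.
  + by right; exists m', v'; rewrite in_union; auto.
  + have /opair_inj [-> ->] : opair m w = q by case: hq.
    by right; exists n, v; rewrite in_union; auto.
Qed.
Lemma rec_rel_total p a n : isnat n ->
  (exists y, rec_rel p a n y) /\ (forall y y', rec_rel p a n y -> rec_rel p a n y' -> y = y').
Proof.
move: n; apply: nat_ind => [||n hn [[y hy] U]].
- by rewrite /rec_rel; dfn.
- by split=> [|y y' /rec_rel0 -> /rec_rel0 ->] //; exists a; apply/rec_rel0.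
- split; first by exists (F p y); apply/(rec_relS _ _ _ _ hn); exists y.
  move=> z z' /(rec_relS _ _ _ _ hn) [v [hv ->]] /(rec_relS _ _ _ _ hn) [v' [hv' ->]].
  by rewrite (U _ _ hv hv').
Qed.
Lemma orec_spec p a n : isnat n -> rec_rel p a n (orec p a n).
Proof. by move=> /(rec_rel_total p a) [? ?]; apply: the_spec. Qed.
Lemma orec0 p a : orec p a emp = a.
Proof. by apply/(rec_rel0 p); apply: orec_spec; apply: isnat0. Qed.
Lemma orecS p a n : isnat n -> orec p a (succ n) = F p (orec p a n).
Proof.
move=> hn; have hS : isnat (succ n) by apply: isnatS.
move: (orec_spec p a _ hS) => /(rec_relS _ _ _ _ hn) [v [hv ->]].
by rewrite ((proj2 (rec_rel_total p a n hn)) _ _ hv (orec_spec p a n hn)).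
Qed.
End Recursion.

Hint Extern 0 (DfT (fun _ => orec _ _ _ _)) => apply DfT_orec; dfn : dfn.

(** * Transitive closures, well-founded induction and products *)

Section TransitiveClosure.
Context {M : structure} {HZ : ZF M}.
Implicit Types x y z a b m n : M.

Definition transitive_set x : Prop := forall y z, y ∈ x -> z ∈ y -> z ∈ x.
Definition tc x : M := bunion (rep omega (orec (fun _ v => bunion v) x (pair x x))).

Lemma Df_bunion2 : Df (fun e : nat -> M => e 0 = bunion (e 2)).
Proof. by dfn. Qed.

Lemma in_tc x y : y ∈ tc x <->
  exists n, isnat n /\ y ∈ orec (fun _ v => bunion v) x (pair x x) n.
Proof.
rewrite in_bunion; split=> [[z []]|[n [hn hy]]].
- rewrite in_rep; first dfn.
  by move=> [n [/in_omega hn ->]]; exists n.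
- exists (orec (fun _ v => bunion v) x (pair x x) n); split=> //.
  rewrite in_rep; first dfn.
  by exists n; rewrite in_omega.
Qed.
Lemma tc_self x : x ∈ tc x.
Proof.
apply/in_tc; exists emp; split; first exact: isnat0.
rewrite orec0; first exact: Df_bunion2.
by rewrite in_pair; left.
Qed.
Lemma tc_trans x : transitive_set (tc x).
Proof.
move=> y z /in_tc [n [hn hy]] hz; apply/in_tc; exists (succ n).
split; first exact: isnatS.
rewrite orecS //; first exact: Df_bunion2.
by rewrite in_bunion; exists y.
Qed.

(** Foundation gives a minimal element of a set, not of a class, so the counterexamples are
    collected inside the transitive set [tc x]. *)
Lemma eps_ind (P : M -> Prop) : Df (fun e => P (e 0)) ->
  (forall x, (forall y, y ∈ x -> P y) -> P x) -> forall x, P x.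
Proof.
move=> DP H x; apply: NNPP => hx.
have DN : Df (fun e => ~ P (e 0)) by apply: Df_not.
have [|y [/(in_sep _ _ DN) [hy Py] Hy]] := zf_foundation M HZ (sep (tc x) (fun y => ~ P y)).
  by exists x; rewrite in_sep //; split=> //; apply: tc_self.
apply: Py; apply: H => z hz; apply: NNPP => hPz; apply: (Hy z) => //.
by rewrite in_sep //; split=> //; apply: tc_trans hz.
Qed.

(** The first component of a pair in [x] lies three memberships down: [u ∈ {u} ∈ opair u j ∈ x]. The
    left disjunct serves the recursion for [hat], the right one the recursion on names. *)
Definition below y x : Prop := y ∈ x \/ exists w z, y ∈ w /\ w ∈ z /\ z ∈ x.

Lemma below_ind (P : M -> Prop) : Df (fun e => P (e 0)) ->
  (forall x, (forall y, below y x -> P y) -> P x) -> forall x, P x.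
Proof.
move=> DP H x.
have DP' t : DfT t -> Df (fun e => P (t e)) by move=> ?; apply: Df_pred1.
(* The statement is strengthened by two levels of members, so that the hypothesis for a member of
   [x] reaches what lies three memberships below [x]. *)
suff [] : P x /\ (forall y, y ∈ x -> P y) /\ forall z y, z ∈ x -> y ∈ z -> P y by [].
move: x; apply: eps_ind.
  by repeat first [dfn_step | apply: DP'].
move=> x IH.
have h1 y : y ∈ x -> P y by move=> /IH [].
have h2 z y : z ∈ x -> y ∈ z -> P y by move=> /IH [_ [h _]] /h.
split=> //; apply: H => y [/h1 //|[w [z [hy [hw /IH [_ [_ h]]]]]]].
exact: (h w).
Qed.

Lemma below_trans T y x : transitive_set T -> x ∈ T -> below y x -> y ∈ T.
Proof. by move=> HT hx [h|[w [z [h [hw hz]]]]]; eauto. Qed.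

Lemma below_opair u j x : opair u j ∈ x -> below u x.
Proof.
move=> h; right; exists (pair u u), (opair u j); rewrite !in_pair.
by split; [left|split=> //; left].
Qed.

Definition prod x y : M :=
  sep (pow (pow (union x y))) (fun p => exists a b, a ∈ x /\ b ∈ y /\ p = opair a b).

Lemma in_prod x y p : p ∈ prod x y <-> exists a b, a ∈ x /\ b ∈ y /\ p = opair a b.
Proof.
rewrite in_sep; first dfn.
split=> [[] //|h]; split=> //; case: h => a [b [ha [hb ->]]].
rewrite in_pow => z hz; rewrite in_pow => w hw; rewrite in_union.
by case/in_pair: hz => hz; subst z; case/in_pair: hw => ->; auto.
Qed.
Lemma in_prod_opair x y a b : opair a b ∈ prod x y <-> a ∈ x /\ b ∈ y.
Proof.
rewrite in_prod; split=> [[? [? [? [? /opair_inj [-> ->]]]]] //|[? ?]].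
by exists a, b.
Qed.
End TransitiveClosure.

(** * Arithmetic *)

Section NatArithmetic.
Context {M : structure} {HZ : ZF M}.
Implicit Types x y z a b c m n k : M.

Definition nadd a n : M := orec (fun _ v => succ v) a a n.
Definition nmul a n : M := orec (fun p v => nadd v p) a emp n.

Lemma DfT_nadd t u : DfT t -> DfT u -> DfT (fun e => nadd (t e) (u e)).
Proof. by apply: DfT_fun2; rewrite /nadd; dfn. Qed.
Hint Extern 0 (DfT (fun _ => nadd _ _)) => apply DfT_nadd; dfn : dfn.
Lemma DfT_nmul t u : DfT t -> DfT u -> DfT (fun e => nmul (t e) (u e)).
Proof. by apply: DfT_fun2; rewrite /nmul; dfn. Qed.
Hint Extern 0 (DfT (fun _ => nmul _ _)) => apply DfT_nmul; dfn : dfn.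

Lemma nadd0 a : nadd a emp = a.
Proof. by rewrite /nadd orec0 //; dfn. Qed.
Lemma naddS a n : isnat n -> nadd a (succ n) = succ (nadd a n).
Proof. by move=> hn; rewrite /nadd orecS //; dfn. Qed.
Lemma nmul0 a : nmul a emp = emp.
Proof. by rewrite /nmul orec0 //; dfn. Qed.
Lemma nmulS a n : isnat n -> nmul a (succ n) = nadd (nmul a n) a.
Proof. by move=> hn; rewrite /nmul orecS //; dfn. Qed.

Lemma isnat_nadd a n : isnat a -> isnat n -> isnat (nadd a n).
Proof.
move=> ha; move: n; apply: nat_ind => [||n hn h]; first dfn.
- by rewrite nadd0.
- by rewrite naddS //; apply: isnatS.
Qed.
Lemma isnat_nmul a n : isnat a -> isnat n -> isnat (nmul a n).
Proof.
move=> ha; move: n; apply: nat_ind => [||n hn h]; first dfn.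
- by rewrite nmul0; apply: isnat0.
- by rewrite nmulS //; apply: isnat_nadd.
Qed.
Hint Resolve isnat0 isnatS isnat_nadd isnat_nmul : core.

Lemma nadd0l n : isnat n -> nadd emp n = n.
Proof.
move: n; apply: nat_ind => [||n hn h]; first dfn; first exact: nadd0.
by rewrite naddS // h.
Qed.
Lemma naddSl a n : isnat n -> nadd (succ a) n = succ (nadd a n).
Proof.
move: n; apply: nat_ind => [||n hn h]; first dfn; first by rewrite !nadd0.
by rewrite !naddS // h.
Qed.
Lemma naddC a n : isnat a -> isnat n -> nadd a n = nadd n a.
Proof.
move=> ha; move: n; apply: nat_ind => [||n hn h]; first dfn.
- by rewrite nadd0 nadd0l.
- by rewrite naddS // naddSl // h.
Qed.
Lemma naddA a b n : isnat b -> isnat n -> nadd a (nadd b n) = nadd (nadd a b) n.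
Proof.
move=> hb; move: n; apply: nat_ind => [||n hn h]; first dfn.
- by rewrite !nadd0.
- by rewrite !naddS ?h //; auto.
Qed.
Lemma nmul0l n : isnat n -> nmul emp n = emp.
Proof.
move: n; apply: nat_ind => [||n hn h]; first dfn; first exact: nmul0.
by rewrite nmulS // h nadd0.
Qed.
Lemma nmulSl a n : isnat a -> isnat n -> nmul (succ a) n = nadd (nmul a n) n.
Proof.
move=> ha; move: n; apply: nat_ind => [||n hn h]; first dfn.
- by rewrite !nmul0 nadd0.
- have ? : isnat (nmul a n) by auto.
  rewrite !nmulS // h naddS // naddS //; congr succ.
  by rewrite -!naddA // (naddC n).
Qed.
Lemma nmulC a n : isnat a -> isnat n -> nmul a n = nmul n a.
Proof.
move=> ha; move: n; apply: nat_ind => [||n hn h]; first dfn.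
- by rewrite nmul0 nmul0l.
- by rewrite nmulS // nmulSl // h.
Qed.
Lemma nmulDr a b n : isnat a -> isnat b -> isnat n ->
  nmul a (nadd b n) = nadd (nmul a b) (nmul a n).
Proof.
move=> ha hb; move: n; apply: nat_ind => [||n hn h]; first dfn.
- by rewrite nmul0 !nadd0.
- by rewrite naddS // !nmulS // ?h ?naddA //; auto.
Qed.
Lemma nmulA a b n : isnat a -> isnat b -> isnat n ->
  nmul a (nmul b n) = nmul (nmul a b) n.
Proof.
move=> ha hb; move: n; apply: nat_ind => [||n hn h]; first dfn.
- by rewrite !nmul0.
- by rewrite !nmulS // ?nmulDr ?h //; auto.
Qed.
Lemma nadd_cancel a b n : isnat n -> nadd a n = nadd b n -> a = b.
Proof.
move: n; apply: nat_ind => [||n hn h]; first dfn.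
- by rewrite !nadd0.
- by rewrite !naddS // => /succ_inj /h.
Qed.
Lemma nat_trichotomy m n : isnat n -> isnat m ->
  (exists k, isnat k /\ n = nadd m (succ k)) \/ m = n \/
  (exists k, isnat k /\ m = nadd n (succ k)).
Proof.
move=> hn; move: m; apply: nat_ind => [||m hm]; first dfn.
- case: (nat_case n hn) => [->|[k [hk ->]]]; first by right; left.
  by left; exists k; rewrite nadd0l; auto.
- case=> [[k [hk ->]]|[->|[k [hk ->]]]].
  + case: (nat_case k hk) => [->|[j [hj ->]]].
      by right; left; rewrite naddS // nadd0.
    by left; exists j; rewrite naddSl // -?naddS //; auto.
  + by right; right; exists emp; rewrite naddS // nadd0.
  + by right; right; exists (succ k); rewrite -naddS //; auto.
Qed.
Lemma mem_nat m n : isnat m -> isnat n ->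
  m ∈ n <-> exists k, isnat k /\ n = nadd m (succ k).
Proof.
move=> hm; move: n; apply: nat_ind => [||n hn IH]; first dfn.
- rewrite in_emp; split=> // -[k [hk]]; rewrite naddS //.
  by move/esym/succ_neq_emp.
- rewrite in_succ IH; split=> [[[k [hk ->]]|->]|[k [hk]]].
  + by exists (succ k); rewrite -naddS //; auto.
  + by exists emp; rewrite naddS // nadd0.
  + rewrite naddS // => /succ_inj ->.
    case: (nat_case k hk) => [->|[j [hj ->]]]; first by right; rewrite nadd0.
    by left; exists j.
Qed.
Lemma isnat_mem m n : isnat n -> m ∈ n -> isnat m.
Proof.
move=> hn; move: m; move: n hn; apply: nat_ind => [||n hn IH m]; first dfn.
- by move=> m /in_emp.
- by move=> /in_succ [/IH|->].
Qed.
Lemma nat_least (P : M -> Prop) : Df (fun e => P (e 0)) -> (exists n, isnat n /\ P n) ->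
  exists n, isnat n /\ P n /\ forall m, m ∈ n -> ~ P m.
Proof.
move=> DP [n [hn Pn]].
have [|y [/(in_sep _ _ DP) [/in_omega hy Py] H]] := zf_foundation M HZ (sep omega P).
  by exists n; rewrite in_sep // in_omega.
exists y; split=> //; split=> // m hm Pm; apply: (H m) => //.
by rewrite in_sep // in_omega; split=> //; apply: isnat_mem hm.
Qed.
End NatArithmetic.
#[export] Hint Resolve isnat0 isnatS isnat_nadd isnat_nmul : core.

Hint Extern 0 (DfT (fun _ => nadd _ _)) => apply DfT_nadd; dfn : dfn.
Hint Extern 0 (DfT (fun _ => nmul _ _)) => apply DfT_nmul; dfn : dfn.

(** * Integers and fractions of a model as Rocq types *)

Section NatType.
Context {M : structure} {HZ : ZF M}.

(** The integers of the model, standard or not, form a commutative semiring. As a Rocq type they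
    become accessible to [ring]. *)
Definition N := {x : M | isnat x}.
Definition mkN (x : M) (h : isnat x) : N := exist _ x h.
Definition N0 : N := mkN emp isnat0.
Definition N1 : N := mkN (succ emp) (isnatS _ isnat0).
Definition Nadd (a b : N) : N := mkN _ (isnat_nadd _ _ (proj2_sig a) (proj2_sig b)).
Definition Nmul (a b : N) : N := mkN _ (isnat_nmul _ _ (proj2_sig a) (proj2_sig b)).

Lemma N_eq (a b : N) : sval a = sval b -> a = b.
Proof.
case: a b => [x hx] [y hy] /= E; subst y.
by rewrite (proof_irrelevance _ hx hy).
Qed.

Lemma N_semiring : semi_ring_theory N0 N1 Nadd Nmul eq.
Proof.
constructor=> *; apply: N_eq => /=; repeat match goal with a : N |- _ =>
  destruct a end; cbn [proj1_sig].
- by rewrite nadd0l.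
- exact: naddC.
- exact: naddA.
- by rewrite nmulSl // nmul0l // nadd0l.
- by rewrite nmul0l.
- exact: nmulC.
- exact: nmulA.
- by rewrite nmulC ?nmulDr ?(nmulC _ x) ?(nmulC _ x0) //; auto; rewrite (nmulC x1) // (nmulC x1).
Qed.
End NatType.
Arguments N : clear implicits.

Declare Scope n_scope.
Delimit Scope n_scope with n.
Infix "+" := Nadd : n_scope.
Infix "*" := Nmul : n_scope.

(* [Qv a b d] stands for the fraction [(a - b) / (d + 1)]. *)
Record qv {M : structure} {HZ : ZF M} : Type := Qv { qa : N M; qb : N M; qd : N M }.
Arguments qv M {HZ}.
Arguments Qv {M HZ}.

Section Fractions.
Context {M : structure} {HZ : ZF M}.
Open Scope n_scope.
Implicit Types (a b c : N M) (x y z : qv M).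

Add Ring N_ring : (N_semiring (M := M)).

Lemma N_cancel a b c : a + c = b + c -> a = b.
Proof.
move=> E; apply: N_eq; apply: (nadd_cancel _ _ (sval c)); first exact: (proj2_sig c).
exact: (f_equal sval E).
Qed.
Lemma N_succ_neq0 a : a + N1 <> N0.
Proof.
move=> /(f_equal sval) /=; rewrite naddS // => /succ_neq_emp [].
Qed.
Lemma N_trichotomy a b :
  (exists k, b = a + (k + N1)) \/ a = b \/ (exists k, a = b + (k + N1)).
Proof.
case: a b => [a ha] [b hb].
case: (nat_trichotomy a b hb ha) => [[k [hk E]]|[E|[k [hk E]]]].
- left; exists (mkN k hk); apply: N_eq => /=; by rewrite (naddS _ emp) ?nadd0.
- by right; left; apply: N_eq.
- right; right; exists (mkN k hk); apply: N_eq => /=; by rewrite (naddS _ emp) ?nadd0.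
Qed.
Lemma N_lt_irrefl a k : a <> a + (k + N1).
Proof.
move=> E; apply: (N_succ_neq0 k); apply: (N_cancel _ _ a).
by transitivity (a + (k + N1)); [ring|rewrite -E; ring].
Qed.
Lemma N_mul_cancel a b c : a * (c + N1) = b * (c + N1) -> a = b.
Proof.
case: (N_trichotomy a b) => [[k ->]|[-> //|[k ->]]] E; exfalso.
- apply: (N_lt_irrefl (a * (c + N1)) (k * (c + N1) + c)); rewrite {1}E; ring.
- apply: (N_lt_irrefl (b * (c + N1)) (k * (c + N1) + c)); rewrite -{1}E; ring.
Qed.
Lemma N_mul_lt_cancel a b c k : b * (c + N1) = a * (c + N1) + (k + N1) ->
  exists j, b = a + (j + N1).
Proof.
case: (N_trichotomy a b) => [//|[->|[j ->]]] E; exfalso.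
- exact: (N_lt_irrefl _ _ E).
- apply: (N_lt_irrefl (b * (c + N1)) (j * (c + N1) + c + N1 + k)).
  rewrite {1}E; ring.
Qed.

Definition qc x : N M := qd x + N1.
Definition qeq x y : Prop := qa x * qc y + qb y * qc x = qa y * qc x + qb x * qc y.
Definition qlt x y : Prop := exists k,
  qa y * qc x + qb x * qc y = qa x * qc y + qb y * qc x + (k + N1).
Definition qadd x y : qv M :=
  Qv (qa x * qc y + qa y * qc x) (qb x * qc y + qb y * qc x) (qd x * qd y + qd x + qd y).
Definition qmul x y : qv M :=
  Qv (qa x * qa y + qb x * qb y) (qa x * qb y + qb x * qa y) (qd x * qd y + qd x + qd y).
Definition qopp x : qv M := Qv (qb x) (qa x) (qd x).
Definition qsub x y : qv M := qadd x (qopp y).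
Definition q0 : qv M := Qv N0 N0 N0.
Definition q1 : qv M := Qv N1 N0 N0.

Lemma qeq_refl x : qeq x x.
Proof. by rewrite /qeq. Qed.
Lemma qeq_sym x y : qeq x y -> qeq y x.
Proof. by rewrite /qeq => E; symmetry. Qed.
(** In the absence of subtraction, the terms coming from [y] are added to both sides; they are
    cancelled afterwards, together with the denominator of [y]. *)
Lemma qeq_trans x y z : qeq x y -> qeq y z -> qeq x z.
Proof.
rewrite /qeq {3 6}/qc => h1 h2; apply: (N_mul_cancel _ _ (qd y)).
apply: (N_cancel _ _ (qa y * qc x * qc z + qb y * qc x * qc z)).
transitivity ((qa x * qc y + qb y * qc x) * qc z + (qa y * qc z + qb z * qc y) * qc x).
  by rewrite /qc; ring.
rewrite h1 h2 /qc; ring.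
Qed.
#[local] Instance qeq_equiv : Equivalence qeq.
Proof. split; [exact: qeq_refl|exact: qeq_sym|exact: qeq_trans]. Qed.

Lemma qadd_extl x x' y : qeq x x' -> qeq (qadd x y) (qadd x' y).
Proof.
rewrite /qeq /qadd /= => h.
transitivity ((qa x * qc x' + qb x' * qc x) * qc y * qc y +
  (qa y * qc x * qc x' * qc y + qb y * qc x * qc x' * qc y)).
  by rewrite /qc /=; ring.
by rewrite h /qc /=; ring.
Qed.
Lemma qmul_extl x x' y : qeq x x' -> qeq (qmul x y) (qmul x' y).
Proof.
rewrite /qeq /qmul /= => h.
transitivity ((qa x * qc x' + qb x' * qc x) * qa y * qc y +
  (qa x' * qc x + qb x * qc x') * qb y * qc y).
  by rewrite /qc /=; ring.
transitivity ((qa x' * qc x + qb x * qc x') * qa y * qc y +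
  (qa x * qc x' + qb x' * qc x) * qb y * qc y); first by rewrite h.
by rewrite /qc /=; ring.
Qed.
Lemma qadd_comm x y : qeq (qadd x y) (qadd y x).
Proof. by rewrite /qeq /qadd /qc /=; ring. Qed.
Lemma qmul_comm x y : qeq (qmul x y) (qmul y x).
Proof. by rewrite /qeq /qmul /qc /=; ring. Qed.

Add Parametric Morphism : qadd with signature qeq ==> qeq ==> qeq as qadd_ext.
Proof.
move=> x x' hx y y' hy; transitivity (qadd x' y); first exact: qadd_extl.
by rewrite (qadd_comm x' y) (qadd_comm x' y'); apply: qadd_extl.
Qed.
Add Parametric Morphism : qmul with signature qeq ==> qeq ==> qeq as qmul_ext.
Proof.
move=> x x' hx y y' hy; transitivity (qmul x' y); first exact: qmul_extl.
by rewrite (qmul_comm x' y) (qmul_comm x' y'); apply: qmul_extl.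
Qed.
Add Parametric Morphism : qopp with signature qeq ==> qeq as qopp_ext.
Proof.
move=> x y; rewrite /qeq /qopp /qc /= => h.
transitivity (qa y * (qd x + N1) + qb x * (qd y + N1)); first ring.
by rewrite -h; ring.
Qed.

Add Parametric Morphism : qsub with signature qeq ==> qeq ==> qeq as qsub_ext.
Proof. by move=> x x' hx y y' hy; apply: qadd_ext => //; apply: qopp_ext. Qed.

Lemma qv_ring : ring_theory q0 q1 qadd qmul qsub qopp qeq.
Proof.
constructor=> *; rewrite /qeq /qsub /qadd /qmul /qopp /qc /=; ring.
Qed.
Lemma qv_ext : ring_eq_ext qadd qmul qopp qeq.
Proof. by constructor; [exact: qadd_ext_Proper|exact: qmul_ext_Proper|exact: qopp_ext_Proper]. Qed.
Lemma qv_setoid : Setoid_Theory (qv M) qeq.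
Proof. exact: qeq_equiv. Qed.

(** Reduces the order to positivity of differences, after which inequalities become ring
    identities. *)
Lemma qlt_pos x y : qlt x y <-> qlt q0 (qsub y x).
Proof.
rewrite /qlt /qsub /qadd /qopp /qc /=; split=> -[k E]; exists k.
- transitivity (qa y * (qd x + N1) + qb x * (qd y + N1)); first ring.
  by rewrite E; ring.
- transitivity ((qa y * (qd x + N1) + qb x * (qd y + N1)) * (N0 + N1) +
    N0 * (qd y * qd x + qd y + qd x + N1)); first ring.
  by rewrite E; ring.
Qed.
Lemma qpos_ext x y : qeq x y -> qlt q0 x -> qlt q0 y.
Proof.
rewrite /qlt /qeq /qc /= => h [k E].
apply: (N_mul_lt_cancel _ _ (qd x) (k * (qd y + N1) + qd y)).
apply: (N_cancel _ _ (qb x * (qd y + N1))).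
transitivity ((qa y * (qd x + N1) + qb x * (qd y + N1)) + N0); first ring.
rewrite -h.
transitivity ((qa x * (N0 + N1) + N0 * (qd x + N1)) * (qd y + N1) + qb y * (qd x + N1)).
  by ring.
by rewrite E; ring.
Qed.
Lemma qpos_add x y : qlt q0 x -> qlt q0 y -> qlt q0 (qadd x y).
Proof.
rewrite /qlt /qadd /qc /= => -[k hk] [l hl].
have {}hk : qa x = qb x + (k + N1).
  transitivity (qa x * (N0 + N1) + N0 * (qd x + N1)); first ring.
  by rewrite hk; ring.
have {}hl : qa y = qb y + (l + N1).
  transitivity (qa y * (N0 + N1) + N0 * (qd y + N1)); first ring.
  by rewrite hl; ring.
exists ((k + N1) * (qd y + N1) + l * (qd x + N1) + qd x).
by rewrite hk hl; ring.
Qed.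
Lemma qpos_mul x y : qlt q0 x -> qlt q0 y -> qlt q0 (qmul x y).
Proof.
rewrite /qlt /qmul /qc /= => -[k hk] [l hl].
have {}hk : qa x = qb x + (k + N1).
  transitivity (qa x * (N0 + N1) + N0 * (qd x + N1)); first ring.
  by rewrite hk; ring.
have {}hl : qa y = qb y + (l + N1).
  transitivity (qa y * (N0 + N1) + N0 * (qd y + N1)); first ring.
  by rewrite hl; ring.
exists (k * l + k + l).
by rewrite hk hl; ring.
Qed.
Lemma q0_irrefl : ~ qlt q0 q0.
Proof.
rewrite /qlt /qc /= => -[k E]; apply: (N_succ_neq0 k).
by transitivity (N0 * (N0 + N1) + N0 * (N0 + N1) + (k + N1)); [ring|rewrite -E; ring].
Qed.
Lemma qlt_trichotomy x y : qlt x y \/ qeq x y \/ qlt y x.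
Proof.
rewrite /qlt /qeq.
by case: (N_trichotomy (qa x * qc y + qb y * qc x) (qa y * qc x + qb x * qc y));
  [left|right].
Qed.

Definition qhalf : qv M := Qv N1 N0 N1.
Lemma qhalf_pos : qlt q0 qhalf.
Proof. by exists N0; rewrite /qc /=; ring. Qed.
Lemma qhalf_double : qeq (qadd qhalf qhalf) q1.
Proof. by rewrite /qeq /qadd /qhalf /qc /=; ring. Qed.
Lemma q1_pos : qlt q0 q1.
Proof. by exists N0; rewrite /qc /=; ring. Qed.

Definition qinv (n : N M) : qv M := Qv N1 N0 n.
Lemma qinv_pos n : qlt q0 (qinv n).
Proof. by exists N0; rewrite /qc /=; ring. Qed.
Lemma qinv_below x : qlt q0 x -> exists n, qlt (qinv n) x.
Proof.
rewrite /qlt /qc /= => -[k hk].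
have {}hk : qa x = qb x + (k + N1).
  transitivity (qa x * (N0 + N1) + N0 * (qd x + N1)); first ring.
  by rewrite hk; ring.
exists (qd x + N1), (k * (qd x + N1) + k).
by rewrite hk; ring.
Qed.
(** A positive fraction is at least the inverse of its denominator. For a non-standard [n] this puts
    [qinv n] below every positive rational of the preceding model. *)
Lemma qinv_below_den x n : qlt q0 x -> (exists k, n = qd x + (k + N1)) -> qlt (qinv n) x.
Proof.
rewrite /qlt /qc /= => -[k hk] [l ->].
have {}hk : qa x = qb x + (k + N1).
  transitivity (qa x * (N0 + N1) + N0 * (qd x + N1)); first ring.
  by rewrite hk; ring.
exists (k * (qd x + l + N1 + N1) + l).
by rewrite hk; ring.
Qed.
End Fractions.
#[export] Existing Instances qeq_equiv qadd_ext_Proper qmul_ext_Proper qopp_ext_Proper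
  qsub_ext_Proper.

(** * Evaluation of arithmetical formulas in a model of ZF *)

Arguments sat : simpl never.
(** Unfolds connectives and quantifiers but stops at named formulas such as [OPair] or [Rat], for
    which lemmas [sat_...] are available. *)
Ltac ssat :=
  cbv beta iota delta [sat alls exs FIff FNot]; fold @sat; cbn [scons Nat.add].

Section BasicFormulas.
Context {M : structure} {HZ : ZF M}.
Implicit Types (e : nat -> M).

Lemma sat_Empty e x : sat e (Empty x) <-> e x = emp.
Proof. exact: is_emptyP. Qed.
Lemma sat_Succ e x y : sat e (Succ x y) <-> e y = succ (e x).
Proof. exact: is_succP. Qed.
Lemma sat_UPair e x y p : sat e (UPair x y p) <-> e p = pair (e x) (e y).
Proof. exact: pairP. Qed.
Lemma sat_OPair e x y p : sat e (OPair x y p) <-> e p = opair (e x) (e y).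
Proof.
rewrite /OPair; ssat; split=> [[v [u]]|E].
- by rewrite !sat_UPair /= => -[-> [->]].
- by exists (pair (e x) (e y)), (pair (e x) (e x)); rewrite !sat_UPair.
Qed.
Lemma sat_PairIn e x y P : sat e (PairIn x y P) <-> opair (e x) (e y) ∈ e P.
Proof.
rewrite /PairIn; ssat; split=> [[v]|h]; last exists (opair (e x) (e y)).
- by rewrite sat_OPair /= => -[->].
- by rewrite sat_OPair.
Qed.
Lemma sat_TripleIn e x y z P :
  sat e (TripleIn x y z P) <-> opair (e x) (opair (e y) (e z)) ∈ e P.
Proof.
rewrite /TripleIn; ssat; split=> [[v]|h]; last exists (opair (e y) (e z)).
- by rewrite sat_OPair sat_PairIn /= => -[->].
- by rewrite sat_OPair sat_PairIn.
Qed.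
Lemma sat_Nat e x : sat e (Nat x) <-> isnat (e x).
Proof. by []. Qed.

Definition rec_graph (g : M -> M) : M :=
  rep omega (fun n => opair n (g n)).
Lemma in_rec_graph (g : M -> M) z :
  Df (fun e => e 0 = g (e 1)) ->
  z ∈ rec_graph g <-> exists n, isnat n /\ z = opair n (g n).
Proof.
move=> Dg; rewrite in_rep.
  apply: Df_eq; first dfn.
  by apply: DfT_opair; [dfn|apply: (DfT_fun1 g) => //; dfn].
by split=> -[n [hn ->]]; exists n; rewrite ?in_omega in hn *.
Qed.

(** The common form of [Plus] and [Times]: [i] is the place of the initial value and [T] describes
    the step. From left to right, the graph of [g] is one of the closed sets [P] over which the
    formula quantifies; from right to left, induction shows that every such [P] contains that
    graph. *)
Lemma sat_rec (g : M -> M) (T : fml) i e b c : Df (fun e => e 0 = g (e 1)) ->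
  (forall P, (emp .: P .: e) i = g emp) ->
  (forall x z w P, isnat x ->
     sat (x .: g x .: z .: w .: P .: e) T <-> w = g (succ x)) ->
  sat e (All (FImp (All (FImp (Empty 0) (PairIn 0 i 1)))
    (FImp (alls 4 (FImp (PairIn 0 1 4) (FImp (Succ 0 2) (FImp T (PairIn 2 3 4)))))
    (PairIn (S b) (S c) 0)))) <->
  isnat (e b) /\ e c = g (e b).
Proof.
move=> Dg H0 HT; ssat; split=> [H|[hb E] P].
- generalize (H (rec_graph g)); rewrite sat_PairIn /= (in_rec_graph _ _ Dg) => -[].
  + move=> z; rewrite sat_Empty sat_PairIn /= => ->; rewrite H0 (in_rec_graph _ _ Dg).
    by exists emp; auto.
  + move=> w z y x; rewrite !sat_PairIn sat_Succ /= !(in_rec_graph _ _ Dg).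
    move=> [n [hn /opair_inj [-> ->]]] ->; rewrite HT // => ->.
    by exists (succ n); auto.
  + by move=> n [hn /opair_inj [-> ->]].
- move=> h0 hS; rewrite sat_PairIn /= E; move: (e b) hb.
  apply: nat_ind => [||n hn h].
  + by apply: Df_mem; [apply: DfT_opair; [dfn|apply: (DfT_fun1 g) => //; dfn]|dfn].
  + by generalize (h0 emp); rewrite sat_Empty sat_PairIn /= H0; apply.
  + generalize (hS (g (succ n)) (succ n) (g n) n).
    by rewrite !sat_PairIn sat_Succ HT //; apply.
Qed.
Lemma sat_Plus e a b c : isnat (e a) ->
  (sat e (Plus a b c) <-> isnat (e b) /\ e c = nadd (e a) (e b)).
Proof.
move=> ha; apply: (sat_rec (nadd (e a)) (Succ 1 3)) => [|P|x z w P hx]; first dfn.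
- by rewrite nadd0.
- by rewrite sat_Succ naddS.
Qed.
Lemma sat_Times e a b c : isnat (e a) ->
  (sat e (Times a b c) <-> isnat (e b) /\ e c = nmul (e a) (e b)).
Proof.
move=> ha; apply: (sat_rec (nmul (e a)) (Plus 1 (5 + a) 3)) => [|P|x z w P hx]; first dfn.
- by rewrite nmul0.
- rewrite nmulS // sat_Plus /=; first exact: isnat_nmul.
  by split=> [[]|].
Qed.

Fixpoint aval (v : nat -> M) (t : aexp) : M :=
  match t with
  | AVar i => v i
  | AAdd s t => nadd (aval v s) (aval v t)
  | AMul s t => nmul (aval v s) (aval v t)
  end.
Fixpoint avars (P : nat -> Prop) (t : aexp) : Prop :=
  match t with
  | AVar i => P i
  | AAdd s t | AMul s t => avars P s /\ avars P t
  end.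

Lemma isnat_aval v t : avars (fun i => isnat (v i)) t -> isnat (aval v t).
Proof. by elim: t => [i|s IHs t IHt|s IHs t IHt] //= [? ?]; auto. Qed.

Lemma sat_Val e k t z v : (forall i, e (k + i) = v i) ->
  avars (fun i => isnat (v i)) t -> (sat e (Val k t z) <-> e z = aval v t).
Proof.
elim: t e k z => [i|s IHs t IHt|s IHs t IHt] e k z E; cbn [Val avars aval]; ssat.
- by rewrite E; split=> ->.
- move=> [hs ht]; have ? := isnat_aval _ _ hs; have ? := isnat_aval _ _ ht.
  split=> [[y [x]]|h]; last exists (aval v t), (aval v s).
  + rewrite IHs // IHt //= => -[-> [->]].
    by rewrite sat_Plus //= => -[].
  + by rewrite IHs // IHt // sat_Plus.
- move=> [hs ht]; have ? := isnat_aval _ _ hs; have ? := isnat_aval _ _ ht.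
  split=> [[y [x]]|h]; last exists (aval v t), (aval v s).
  + rewrite IHs // IHt //= => -[-> [->]].
    by rewrite sat_Times //= => -[].
  + by rewrite IHs // IHt // sat_Times.
Qed.

Lemma sat_AEq e s t : avars (fun i => isnat (e i)) s -> avars (fun i => isnat (e i)) t ->
  (sat e (AEq s t) <-> aval e s = aval e t).
Proof.
move=> hs ht; rewrite /AEq; ssat; split=> [[x]|h]; last exists (aval e s).
- by rewrite !(sat_Val _ _ _ _ e) //= => -[-> ->].
- by rewrite !(sat_Val _ _ _ _ e).
Qed.
Lemma sat_ALt e s t : avars (fun i => isnat (e i)) s -> avars (fun i => isnat (e i)) t ->
  (sat e (ALt s t) <-> aval e s ∈ aval e t).
Proof.
move=> hs ht; rewrite /ALt; ssat; split=> [[y [x]]|h]; last exists (aval e t), (aval e s).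
- by rewrite !(sat_Val _ _ _ _ e) //= => -[-> [->]].
- by rewrite !(sat_Val _ _ _ _ e).
Qed.

Lemma sat_Frac e a b c q : sat e (Frac a b c q) <-> e q = opair (e a) (opair (e b) (e c)).
Proof.
rewrite /Frac; ssat; split=> [[v]|h]; last exists (opair (e b) (e c)).
- by rewrite !sat_OPair /= => -[->].
- by rewrite !sat_OPair.
Qed.

Definition coprime_pair (k c : M) : Prop := forall n m d, isnat d -> isnat m -> isnat n ->
  nmul d m = k -> nmul d n = c -> d = succ emp.
Definition isrep (a b c q : M) : Prop :=
  isnat a /\ isnat b /\ isnat c /\ q = opair a (opair b c) /\ c <> emp /\
  (a = emp \/ b = emp) /\ coprime_pair (nadd a b) c.
Definition israt (q : M) : Prop := exists c b a, isrep a b c q.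

Lemma israt_rep q : israt q <-> exists c b a, isrep a b c q.
Proof. by []. Qed.

Lemma Df_israt t : DfT t -> Df (fun e => israt (t e)).
Proof. by apply: Df_pred1; rewrite /israt /isrep /coprime_pair; dfn. Qed.

Lemma sat_Rat e q : sat e (Rat q) <-> israt (e q).
Proof.
rewrite /Rat; ssat.
split=> -[c [b [a]]]; rewrite ?sat_Nat ?sat_Frac ?sat_Empty /=;
  move=> [ha [hb [hc [hq [c0 [ab H]]]]]]; exists c, b, a.
- do 6 (split=> //); move=> n m d hd hm hn E1 E2.
  generalize (H n m d); rewrite !sat_Nat !sat_AEq //=.
  by case=> // z; rewrite sat_Empty sat_Succ /= => -[->].
- rewrite ?sat_Nat ?sat_Frac ?sat_Empty /=; do 6 (split=> //).
  move=> n m d; rewrite !sat_Nat /= => hd hm hn.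
  rewrite !sat_AEq //= => E1 E2.
  by exists emp; rewrite sat_Empty sat_Succ /=; split=> //; apply: (H n m).
Qed.
End BasicFormulas.

Hint Extern 0 (Df (fun _ => israt _)) => apply Df_israt; dfn : dfn.

(** * Codes of rational numbers *)

Section Codes.
Context {M : structure} {HZ : ZF M}.
Open Scope n_scope.
Implicit Types (x y z v w : qv M) (p q r : M).

Add Ring N_ring2 : (N_semiring (M := M)).

Definition code v : M :=
  opair (sval (qa v)) (opair (sval (qb v)) (succ (sval (qd v)))).

Lemma code_inj v w : code v = code w -> v = w.
Proof.
case: v w => [a b d] [a' b' d'] /opair_inj /= [ea /opair_inj [eb /succ_inj ed]].
by rewrite (N_eq _ _ ea) (N_eq _ _ eb) (N_eq _ _ ed).
Qed.

Lemma israt_code q : israt q -> exists v, q = code v.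
Proof.
move=> [c [b [a [ha [hb [hc [-> [c0 _]]]]]]]].
case: (nat_case c hc) => [//|[d [hd ->]]].
by exists (Qv (mkN a ha) (mkN b hb) (mkN d hd)).
Qed.

(** Choice makes [qval] total; its value is determined only when [q] is a code. *)
Definition qval q : qv M := epsilon (inhabits q0) (fun v => q = code v).
Lemma code_qval q : israt q -> q = code (qval q).
Proof. by move=> /israt_code h; apply: (epsilon_spec (inhabits q0) (fun v => q = code v)). Qed.

Lemma N_lt_mem (m n : N M) :
  sval m ∈ sval n <-> exists k, n = m + (k + N1).
Proof.
rewrite mem_nat; [exact: (proj2_sig m)|exact: (proj2_sig n)|].
split=> [[k [hk E]]|[k E]].
- by exists (mkN k hk); apply: N_eq; rewrite E /= (naddS _ emp) // nadd0.
- exists (sval k); split; first exact: (proj2_sig k).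
  by rewrite E /= (naddS _ emp) // nadd0.
Qed.
Lemma N_case (n : N M) : n = N0 \/ exists k, n = k + N1.
Proof.
case: n => n hn; case: (nat_case n hn) => [E|[k [hk E]]].
- by left; apply: N_eq.
- by right; exists (mkN k hk); apply: N_eq; rewrite /= (naddS _ emp) // nadd0.
Qed.

(* The representation with the least denominator is in lowest terms. *)
Lemma reduced_exists (k d : N M) :
  exists k' d', k' * (d + N1) = k * (d' + N1) /\
    coprime_pair (sval k') (sval (d' + N1)).
Proof.
case: (nat_least (fun n => exists j, isnat j /\
  nmul j (sval (d + N1)) = nmul (sval k) (succ n))) => [||n [hn [[j [hj E]] Hmin]]]; first dfn.
  exists (sval d); split; first exact: (proj2_sig d).
  exists (sval k); split; first exact: (proj2_sig k).
  by rewrite /= (naddS _ emp) // nadd0.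
have {}E : mkN j hj * (d + N1) = k * (mkN n hn + N1).
  by apply: N_eq; rewrite /= !(naddS _ emp) // !nadd0; rewrite /= (naddS _ emp) ?nadd0 in E.
exists (mkN j hj), (mkN n hn); split=> // u m d0 hd0 hm hu.
set J := mkN j hj in E *; set n' := mkN n hn in E *.
move=> E1 E2.
have {}E1 : mkN d0 hd0 * mkN m hm = J by apply: N_eq.
have {}E2 : mkN d0 hd0 * mkN u hu = n' + N1 by apply: N_eq.
case: (N_case (mkN d0 hd0)) => [h0|[d1 h1]].
  by case: (N_succ_neq0 n'); rewrite -E2 h0; ring.
case: (N_case (mkN u hu)) => [h0|[u1 h2]].
  by case: (N_succ_neq0 n'); rewrite -E2 h0; ring.
case: (N_case d1) => [h3|[d2 h3]].
  have : mkN d0 hd0 = N1 by rewrite h1 h3; ring.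
  by move=> /(f_equal sval).
(* A common divisor [d0] other than 1 is at least 2. Dividing by it yields the representation
   [m / (u1 + 1)] of the same fraction, with a smaller denominator. *)
exfalso; apply: (Hmin (sval u1)).
- apply/(N_lt_mem u1 n'); exists (d2 * (u1 + N1) + u1).
  apply: (N_cancel _ _ N1); rewrite -E2 h1 h2 h3; ring.
- exists m; split=> //.
  have : mkN m hm * (d + N1) = k * (u1 + N1).
    apply: (N_mul_cancel _ _ d1); rewrite -h1 -h2.
    transitivity (mkN d0 hd0 * mkN m hm * (d + N1)); first ring.
    by rewrite E1 E -E2; ring.
  move=> /(f_equal sval); by rewrite /= !(naddS _ emp) // !nadd0.
Qed.

Lemma qval_code v : israt (code v) -> qval (code v) = v.
Proof. by move=> h; apply: code_inj; rewrite -code_qval. Qed.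

Lemma israt_exists v : exists q, israt q /\ qeq (qval q) v.
Proof.
(* [s] is the sign. A code has one of its two numerators equal to 0, so the smaller numerator is
   first subtracted from both. *)
enough (H : forall (k d : N M) (s : bool), exists q : M, israt q /\
    qeq (qval q) (if s then Qv k N0 d else Qv N0 k d)).
{ case: v => a b d; case: (N_trichotomy a b) => [[k ->]|[->|[k ->]]].
  - have [q [hq E]] := H (k + N1) d false; exists q; split=> //.
    by apply: qeq_trans E _; rewrite /qeq /qc /=; ring.
  - have [q [hq E]] := H N0 d false; exists q; split=> //.
    by apply: qeq_trans E _; rewrite /qeq /qc /=; ring.
  - have [q [hq E]] := H (k + N1) d true; exists q; split=> //.
    by apply: qeq_trans E _; rewrite /qeq /qc /=; ring. }
move=> k d s; have [k' [d' [E cop]]] := reduced_exists k d.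
pose (v0 := if s then Qv k' N0 d' else Qv N0 k' d').
have h : israt (code v0).
  exists (succ (sval (qd v0))), (sval (qb v0)), (sval (qa v0)).
  split; first exact: (proj2_sig (qa v0)).
  split; first exact: (proj2_sig (qb v0)).
  split; first by apply: isnatS; exact: (proj2_sig (qd v0)).
  split=> //; split; first exact: succ_neq_emp.
  split; first by rewrite /v0; case: (s); [right|left].
  have -> : nadd (sval (qa v0)) (sval (qb v0)) = sval k'.
    rewrite /v0; case: (s) => /=; first by rewrite nadd0.
    by rewrite nadd0l //; exact: (proj2_sig k').
  have -> : succ (sval (qd v0)) = sval (d' + N1).
    by rewrite /v0 /= (naddS _ emp) // nadd0; case: (s).
  exact: cop.
exists (code v0); split=> //; rewrite qval_code // /v0 /qeq /qc.
case: (s) => /=; [rewrite E|rewrite -E]; ring.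
Qed.

Definition rlt p q : Prop := qlt (qval p) (qval q).
Definition radd p q r : Prop := qeq (qadd (qval p) (qval q)) (qval r).
Definition rzero : M := code q0.

Lemma israt_rzero : israt rzero.
Proof.
exists (succ emp), emp, emp; do 4 (split; first by auto).
split; first exact: succ_neq_emp.
split; first by left.
move=> n m d hd hm hn _ E.
have : mkN d hd * mkN n hn = N1 by apply: N_eq.
case: (N_case (mkN d hd)) => [->|[d1 h1]] E1.
  by case: (N_succ_neq0 (M := M) N0); transitivity (N1 (M := M)); [ring|rewrite -E1; ring].
case: (N_case (mkN n hn)) => [h2|[n1 h2]].
  by case: (N_succ_neq0 (M := M) N0); transitivity (N1 (M := M)); [ring|rewrite -E1 h2; ring].
case: (N_case d1) => [h3|[d2 h3]].
  have : mkN d hd = N1 by rewrite h1 h3; ring.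
  by move=> /(f_equal sval).
exfalso; case: (N_succ_neq0 (d2 + n1 + d1 * n1)).
apply: (N_cancel _ _ N1); transitivity ((d1 + N1) * (n1 + N1)).
  by rewrite h3; ring.
by rewrite -h1 -h2 E1; ring.
Qed.
Lemma qval_rzero : qval rzero = q0.
Proof. by apply: qval_code; exact: israt_rzero. Qed.

Lemma code_rep q a b c : israt q -> q = opair a (opair b c) <->
  a = sval (qa (qval q)) /\ b = sval (qb (qval q)) /\ c = sval (qc (qval q)).
Proof.
move=> /code_qval {1}->; rewrite /qc /= (naddS _ emp) // nadd0.
by split=> [/opair_inj [-> /opair_inj [-> ->]]|[-> [-> ->]]].
Qed.

Lemma repE q : israt q -> q = opair (sval (qa (qval q)))
  (opair (sval (qb (qval q))) (sval (qc (qval q)))).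
Proof. by move=> hq; apply/(code_rep _ _ _ _ hq). Qed.

Lemma rat_opair q : israt q -> exists a b c, q = opair a (opair b c).
Proof. by move=> [c [b [a [_ [_ [_ [-> _]]]]]]]; exists a, b, c. Qed.

Lemma isnat_N (n : N M) : isnat (sval n).
Proof. exact: (proj2_sig n). Qed.
Hint Resolve isnat_N : core.

Lemma rep_isnat q a b c : israt q -> q = opair a (opair b c) ->
  isnat a /\ isnat b /\ isnat c.
Proof. by move=> hq /(code_rep _ _ _ _ hq) [-> [-> ->]]; split; last split; apply: isnat_N. Qed.
Lemma rlt_rep p q a b c a' b' c' : israt p -> israt q ->
  p = opair a (opair b c) -> q = opair a' (opair b' c') ->
  rlt p q <-> nadd (nmul a c') (nmul b' c) ∈ nadd (nmul a' c) (nmul b c').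
Proof.
move=> hp hq /(code_rep _ _ _ _ hp) [-> [-> ->]] /(code_rep _ _ _ _ hq) [-> [-> ->]].
rewrite /rlt; set x := qval p; set y := qval q.
exact: iff_sym (N_lt_mem (qa x * qc y + qb y * qc x) (qa y * qc x + qb x * qc y)).
Qed.

Lemma sat_RatLt (e : nat -> M) (p q : nat) : israt (e p) -> israt (e q) ->
  (sat e (RatLt p q) <-> rlt (e p) (e q)).
Proof.
move=> hp hq; rewrite /RatLt; ssat.
split=> [[c' [b' [a' [c [b [a]]]]]]|h].
- rewrite !sat_Frac; cbn [scons] => -[Ep [Eq]].
  have [? [? ?]] := rep_isnat _ _ _ _ hp Ep; have [? [? ?]] := rep_isnat _ _ _ _ hq Eq.
  rewrite (rlt_rep _ _ _ _ _ _ _ _ hp hq Ep Eq) sat_ALt; cbn [avars aval scons];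
    [by auto 10|by auto 10|exact: id].
- have [a [b [c Ep]]] := rat_opair _ hp; have [a' [b' [c' Eq]]] := rat_opair _ hq.
  have [? [? ?]] := rep_isnat _ _ _ _ hp Ep; have [? [? ?]] := rep_isnat _ _ _ _ hq Eq.
  exists c', b', a', c, b, a; rewrite !sat_Frac; cbn [scons]; do 2 (split=> //).
  rewrite sat_ALt; cbn [avars aval scons]; [by auto 10|by auto 10|].
  exact/(rlt_rep _ _ _ _ _ _ _ _ hp hq Ep Eq).
Qed.

Lemma sat_RatAdd (e : nat -> M) (p q s : nat) : israt (e p) -> israt (e q) -> israt (e s) ->
  (sat e (RatAdd p q s) <-> radd (e p) (e q) (e s)).
Proof.
move=> hp hq hs; rewrite /RatAdd /radd; ssat.
set x := qval (e p); set y := qval (e q); set z := qval (e s).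
pose (l := (qa x * qc y + qa y * qc x) * qc z + qb z * (qc x * qc y)).
pose (r := (qb x * qc y + qb y * qc x) * qc z + qa z * (qc x * qc y)).
have Ec : qc (qadd x y) = qc x * qc y by rewrite /qc /=; ring.
have H : l = r <-> qeq (qadd x y) z.
  rewrite /qeq Ec /=.
  by have -> : qa z * (qc x * qc y) + (qb x * qc y + qb y * qc x) * qc z = r by rewrite /r; ring.
split=> [[c'' [b'' [a'' [c' [b' [a' [c [b [a]]]]]]]]]|/H h].
- rewrite !sat_Frac /= !code_rep //.
  move=> [[-> [-> ->]] [[-> [-> ->]] [[-> [-> ->]]]]].
  rewrite sat_AEq; cbn [aval avars scons]; [by auto 10|by auto 10|].
  by move/(N_eq l r)/H.
- exists (sval (qc z)), (sval (qb z)), (sval (qa z)),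
    (sval (qc y)), (sval (qb y)), (sval (qa y)),
    (sval (qc x)), (sval (qb x)), (sval (qa x)).
  rewrite !sat_Frac; cbn [scons]; split; first exact: (repE _ hp).
  split; first exact: (repE _ hq).
  split; first exact: (repE _ hs).
  rewrite sat_AEq; cbn [aval avars scons]; [by auto 10|by auto 10|by move: (f_equal sval h) => /=].
Qed.

Lemma sat_RatZero (e : nat -> M) (z : nat) : sat e (RatZero z) <-> e z = rzero.
Proof.
rewrite /RatZero; ssat; split=> [[u [v]]|h].
- by rewrite sat_Empty sat_Succ sat_Frac /= => -[-> [-> ->]].
- by exists (succ emp), emp; rewrite sat_Empty sat_Succ sat_Frac /= h.
Qed.

Definition rpos q : Prop := israt q /\ rlt rzero q.
Lemma sat_RatPos (e : nat -> M) (q : nat) : sat e (RatPos q) <-> rpos (e q).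
Proof.
rewrite /RatPos /rpos; ssat; rewrite sat_Rat.
split=> -[hq]; first move=> [z]; last move=> h.
- by rewrite sat_RatZero /= => -[->]; rewrite sat_RatLt //; exact: israt_rzero.
- split=> //; exists rzero; rewrite sat_RatZero sat_RatLt //=; exact: israt_rzero.
Qed.
End Codes.
#[global] Opaque israt qeq qlt.

(** * Reals *)

Declare Scope q_scope.
Delimit Scope q_scope with q.
Infix "+" := qadd : q_scope.
Infix "-" := qsub : q_scope.
Infix "*" := qmul : q_scope.
Infix "<" := qlt : q_scope.
Infix "==" := qeq (at level 70) : q_scope.

Section Ordering.
Context {M : structure} {HZ : ZF M}.
Open Scope q_scope.
Implicit Types (u v w x y z : qv M).

Add Ring qv_ring1 : (qv_ring (M := M)) (setoid qv_setoid qv_ext).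

(** The workhorse for inequalities: a known strict inequality gives any other with an equal
    difference, and equality of differences is left to [ring]. *)
Lemma qlt_by x y x' y' : x < y -> y - x == y' - x' -> x' < y'.
Proof. by rewrite (qlt_pos x) (qlt_pos x') => h E; apply: qpos_ext h. Qed.
Lemma qlt_add x y x' y' : x < y -> x' < y' -> x + x' < y + y'.
Proof.
rewrite (qlt_pos x) (qlt_pos x') (qlt_pos (x + x')) => h h'.
by apply: qpos_ext (qpos_add _ _ h h'); ring.
Qed.
Lemma qlt_trans x y z : x < y -> y < z -> x < z.
Proof. by move=> h h'; apply: qlt_by (qlt_add _ _ _ _ h h') _; ring. Qed.
Lemma qlt_irrefl x : ~ x < x.
Proof. by move=> h; apply: q0_irrefl; apply: qlt_by h _; ring. Qed.
Lemma qlt_ext x x' y y' : x == x' -> y == y' -> x < y -> x' < y'.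
Proof. by move=> E E' h; apply: qlt_by h _; setoid_rewrite E; setoid_rewrite E'; ring. Qed.
Lemma qlt_dense x y : x < y -> exists z, x < z /\ z < y.
Proof.
rewrite (qlt_pos x) => h; have hh := qpos_mul _ _ h qhalf_pos.
have E : (y - x) * qhalf + (y - x) * qhalf == y - x.
  transitivity ((y - x) * (qhalf + qhalf)); first by ring.
  by setoid_rewrite qhalf_double; ring.
exists (x + (y - x) * qhalf); split; apply: qlt_by hh _; first by ring.
transitivity ((y - x) * qhalf + (y - x) * qhalf - (y - x) * qhalf); first by ring.
by setoid_rewrite E; ring.
Qed.
Lemma qadd_sub x y : x + (y - x) == y.
Proof. by ring. Qed.
Lemma qadd_subl x y : x + y - x == y.
Proof. by ring. Qed.
Lemma qhalf_add x : x * qhalf + x * qhalf == x.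
Proof.
transitivity (x * (qhalf + qhalf)); first by ring.
by setoid_rewrite qhalf_double; ring.
Qed.
End Ordering.

Section Reals.
Context {M : structure} {HZ : ZF M}.
Open Scope q_scope.
Implicit Types (u v w : qv M) (p q x y J K : M).

Add Ring qv_ring2 : (qv_ring (M := M)) (setoid qv_setoid qv_ext).

Definition isreal x : Prop :=
  (forall q, q ∈ x -> israt q) /\
  ((exists q, israt q /\ q ∈ x) /\ (exists q, israt q /\ ~ q ∈ x)) /\
  (forall q, q ∈ x -> exists p, p ∈ x /\ rlt q p) /\
  (forall q p, israt p -> israt q -> rlt p q -> p ∈ x \/ ~ q ∈ x).

Lemma sat_Ded (e : nat -> M) (x : nat) : sat e (Ded x) <-> isreal (e x).
Proof.
rewrite /Ded /isreal; ssat.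
have E : (forall q, q ∈ e x -> sat (q .: e) (Rat 0)) <-> (forall q, q ∈ e x -> israt q).
  by split=> h q /h; rewrite sat_Rat.
rewrite E; split=> -[h1 [[[q [hq hqx]] [p [hp hpx]]] [h3 h4]]]; split=> //.
- rewrite sat_Rat /= in hq; rewrite sat_Rat /= in hp.
  split; first by split; [exists q|exists p].
  split=> [a ha|b a ha hb hab].
  + have [b [hb]] := h3 a ha; rewrite sat_RatLt /=; [exact: h1|exact: h1|].
    by move=> ?; exists b.
  + move: (h4 b a); rewrite !sat_Rat sat_RatLt //=; apply=> //.
- split; first by split; [exists q|exists p]; rewrite sat_Rat.
  split=> [a ha|b a].
  + have [b [hb hab]] := h3 a ha; exists b; split=> //.
    by rewrite sat_RatLt //=; exact: h1.
  + rewrite !sat_Rat /= => ha hb; rewrite sat_RatLt //=; exact: h4.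
Qed.

(** A cut contains only reduced codes. This extends membership to all fractions, invariantly under
    [==], so that sums and differences need not be brought to lowest terms. *)
Definition inval x v : Prop := exists q, q ∈ x /\ qval q == v.

Section OneReal.
Variable x : M.
Hypothesis Hx : isreal x.

Lemma inval_lt u v : u < v -> inval x v -> inval x u.
Proof.
move=> huv [q [hq E]]; have [p [hp Ep]] := israt_exists u.
exists p; split=> //; have [h1 [_ [_ h4]]] := Hx.
case: (h4 q p hp (h1 _ hq)) => //; rewrite /rlt.
by apply: qlt_ext huv; symmetry.
Qed.
Lemma inval_ext u v : u == v -> inval x u -> inval x v.
Proof. by move=> E [q [hq Eq]]; exists q; split=> //; setoid_rewrite Eq. Qed.
Lemma inval_open u : inval x u -> exists v, u < v /\ inval x v.
Proof.
move=> [q [hq E]]; have [_ [_ [h3 _]]] := Hx; have [p [hp hqp]] := h3 q hq.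
exists (qval p); split; last by exists p; split=> //; apply: qeq_refl.
by apply: qlt_ext hqp => //; apply: qeq_refl.
Qed.
Lemma inval_mem q : israt q -> inval x (qval q) <-> q ∈ x.
Proof.
move=> hq; split=> [h|h]; last by exists q; split=> //; apply: qeq_refl.
have [h1 [_ [_ h4]]] := Hx; have [v [hv [p [hp Ep]]]] := inval_open _ h.
case: (h4 p q hq (h1 _ hp)) => //; rewrite /rlt.
by apply: qlt_ext hv; [apply: qeq_refl|symmetry].
Qed.
Lemma inval_ex : exists v, inval x v.
Proof.
by have [_ [[[q [_ hq]] _] _]] := Hx; exists (qval q), q; split=> //; apply: qeq_refl.
Qed.
Lemma inval_nex : exists v, ~ inval x v.
Proof.
have [_ [[_ [q [hq hqx]]] _]] := Hx; exists (qval q).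
by rewrite inval_mem.
Qed.
Lemma inval_le u v : inval x u -> ~ inval x v -> u < v.
Proof.
move=> hu hv; case: (qlt_trichotomy u v) => [//|[E|h]]; case: hv.
- exact: inval_ext hu.
- exact: inval_lt hu.
Qed.
End OneReal.
End Reals.

Section Gaps.
Context {M : structure} {HZ : ZF M}.
Open Scope q_scope.
Implicit Types (u v w : qv M) (p q x y J K : M).

Add Ring N_ring3 : (N_semiring (M := M)).
Add Ring qv_ring3 : (qv_ring (M := M)) (setoid qv_setoid qv_ext).

#[local] Transparent qeq qlt.

(** Spells [inval] out in terms of elements of [M]. The right-hand side is a definable predicate of
    the numerator, which [gap] needs for its induction. *)
Lemma inval_frac x (k b n : N M) : isreal x ->
  inval x (Qv k b n) <-> exists a' b' c', isnat a' /\ isnat b' /\ isnat c' /\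
    opair a' (opair b' c') ∈ x /\
    nadd (nmul a' (sval (n + N1)%n)) (nmul (sval b) c') =
    nadd (nmul (sval k) c') (nmul b' (sval (n + N1)%n)).
Proof.
move=> [h1 _]; split=> [[q [hq E]]|[a' [b' [c' [ha [hb [hc [hq E]]]]]]]].
- exists (sval (qa (qval q))), (sval (qb (qval q))), (sval (qc (qval q))).
  do 3 (split; first exact: isnat_N).
  rewrite -repE; first exact: h1.
  split=> //; exact: (f_equal sval E).
- exists (opair a' (opair b' c')); split=> //.
  move: (qval _) (repE _ (h1 _ hq)) => v /opair_inj [Ea /opair_inj [Eb Ec]].
  rewrite {}Ea {}Eb {}Ec in E; apply: N_eq; exact: E.
Qed.

(** A walk in steps of [1 / (n + 1)], smaller than [e], from a point inside the cut to a point
    outside it. If the cut had no gap of width [e], every step would stay inside, and induction on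
    the numerator would put the final point inside. *)
Lemma gap x e : isreal x -> q0 < e -> exists v, inval x v /\ ~ inval x (v + e).
Proof.
move=> Hx he.
have [n hn] := qinv_below e he.
have [u hu] := inval_ex x Hx; have [w hw] := inval_nex x Hx.
(* The walk starts at [- B / (n + 1) = - (qb u + 1)], which is below [u]. *)
pose (B := ((qb u + N1) * (n + N1))%n).
have hB : inval x (Qv N0 B n).
  apply: (inval_lt x Hx _ u) => //.
  exists (qa u * (n + N1) + qb u * qd u * (n + N1) + qd u * (n + N1) + n)%n.
  rewrite /B /qc /=; ring.
have [k hk] : exists k, ~ inval x (Qv k B n).
  (* With this numerator the point has the value [qa w + 1], which is above [w]. *)
  exists (B + (qa w + N1) * (n + N1))%n => h; apply: hw.
  apply: (inval_lt x Hx) h.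
  exists (qa w * qd w * (n + N1) + qd w * (n + N1) + qb w * (n + N1) + n)%n.
  rewrite /qc /=; ring.
apply: NNPP => hno; apply: hk.
have step m : inval x (Qv m B n) -> inval x (Qv (m + N1)%n B n).
{ move=> h; apply: NNPP => h'; apply: hno; exists (Qv m B n); split=> // h2.
  apply: h'; apply: (inval_lt x Hx) h2.
  apply: (qlt_ext (Qv m B n + qinv n) _ (Qv m B n + e)); last 1 first.
  - by rewrite qlt_pos; move: hn; rewrite qlt_pos => hn; apply: qpos_ext hn; ring.
  - by rewrite /qeq /qadd /qinv /qc /=; ring.
  - exact: qeq_refl. }
apply/(inval_frac _ _ _ _ Hx).
apply: (nat_ind (fun j => exists a' b' c', isnat a' /\ isnat b' /\ isnat c' /\
    opair a' (opair b' c') ∈ x /\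
    nadd (nmul a' (sval (n + N1)%n)) (nmul (sval B) c') =
    nadd (nmul j c') (nmul b' (sval (n + N1)%n)))); first dfn; last exact: isnat_N.
- exact: (proj1 (inval_frac x N0 B n Hx) hB).
- move=> j hj; move/(inval_frac _ (mkN j hj) _ _ Hx)/step/(inval_frac _ _ _ _ Hx).
  by rewrite (_ : sval (mkN j hj + N1)%n = succ j) ?/=; [rewrite (naddS j emp) // nadd0|exact: id].
Qed.
End Gaps.

(** * Differences of reals, open sets and neighbourhoods *)

Section OpenSets.
Context {M : structure} {HZ : ZF M}.
Open Scope q_scope.
Implicit Types (u v w : qv M) (p q x y J K : M).

Add Ring qv_ring4 : (qv_ring (M := M)) (setoid qv_setoid qv_ext).

(** A strict upper bound. Unlike [~ inval x v], the image of such a bound for a rational [v] is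
    preserved in passing to an infinitesimally close real. *)
Definition above x v : Prop := exists u, u < v /\ ~ inval x u.
(* [close x y v] says that [-v < x - y < v]. *)
Definition close x y v : Prop :=
  (exists u, ~ inval y u /\ inval x (u - v)) /\
  (exists w, w < v /\ forall u, ~ inval y u -> ~ inval x (w + u)).

Lemma above_lt x u v : u < v -> above x u -> above x v.
Proof. by move=> h [w [hw ?]]; exists w; split=> //; apply: qlt_trans h. Qed.

Lemma sat_LtRat (e : nat -> M) (x q : nat) : isreal (e x) -> israt (e q) ->
  (sat e (LtRat x q) <-> above (e x) (qval (e q))).
Proof.
move=> hx hq; rewrite /LtRat; ssat; split=> [[p]|[u [hu hux]]].
- rewrite sat_Rat /= => -[hp]; rewrite sat_RatLt //= => -[hpq hpx].
  by exists (qval p); split=> //; rewrite inval_mem.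
- have [p [hp E]] := israt_exists u; exists p; rewrite sat_Rat sat_RatLt //=.
  split=> //; split; first by apply: qlt_ext hu; [symmetry|apply: qeq_refl].
  by rewrite -inval_mem // => h; apply: hux; apply: inval_ext h.
Qed.

Definition ratset : M := sep (prod omega (prod omega omega)) israt.
Lemma in_ratset q : q ∈ ratset <-> israt q.
Proof.
rewrite in_sep; first dfn; split=> [[] //|hq]; split=> //.
rewrite (repE q hq) !in_prod_opair !in_omega; do 2 (split; first exact: isnat_N).
exact: isnat_N.
Qed.

Lemma diff_witness x y q : isreal x -> isreal y -> israt q ->
  (exists u, ~ inval y u /\ inval x (qval q + u)) <->
  exists b a, israt a /\ israt b /\ ~ a ∈ y /\ radd q a b /\ b ∈ x.
Proof.
move=> hx hy hq; split=> [[u [hu [b [hb Eb]]]]|[b [a [ha [hb [hay [hab hbx]]]]]]].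
- have [a [ha Ea]] := israt_exists u; have hb' : israt b by apply: (proj1 hx).
  exists b, a; do 2 (split=> //).
  split; first by rewrite -inval_mem // => h; apply: hu; apply: inval_ext h.
  split=> //; rewrite /radd; setoid_rewrite Ea; symmetry; exact: Eb.
- exists (qval a); split; first by rewrite inval_mem.
  by exists b; split=> //; symmetry.
Qed.
Lemma sat_RealSub (e : nat -> M) (x y d : nat) : isreal (e x) -> isreal (e y) ->
  (sat e (RealSub x y d) <-> forall q, q ∈ e d <->
    israt q /\ exists u, ~ inval (e y) u /\ inval (e x) (qval q + u)).
Proof.
move=> hx hy; rewrite /RealSub; ssat.
have E q : sat (q .: e) (Rat 0) /\ (exists x0 x1 : M,
        sat (x1 .: x0 .: q .: e) (Rat 0) /\
        sat (x1 .: x0 .: q .: e) (Rat 1) /\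
        (x1 ∈ e y -> False) /\
        sat (x1 .: x0 .: q .: e) (RatAdd 2 0 1) /\ x0 ∈ e x) <->
    israt q /\ exists u, ~ inval (e y) u /\ inval (e x) (qval q + u).
{ rewrite sat_Rat /=; split=> -[hq]; rewrite diff_witness // => -[b [a]];
    rewrite ?sat_Rat /= => -[ha [hb [hay [hab hbx]]]]; split=> //; exists b, a.
  - by move: hab; rewrite sat_RatAdd.
  - by rewrite !sat_Rat sat_RatAdd. }
by split=> h q; [rewrite -E; apply: h|move: (h q); rewrite -E].
Qed.
Lemma diff_exists x y : isreal x -> isreal y -> exists d, forall q, q ∈ d <->
  israt q /\ exists u, ~ inval y u /\ inval x (qval q + u).
Proof.
move=> hx hy.
(* The relation [radd] is expressed by satisfaction of its formula, for which definability is
   immediate; on rationals the two agree. *)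
exists (sep ratset (fun q => exists b a, israt a /\ israt b /\ ~ a ∈ y /\
  sat (q .: a .: cst b) (RatAdd 0 1 2) /\ b ∈ x)) => q.
rewrite in_sep; first dfn.
rewrite in_ratset; split=> -[hq]; rewrite diff_witness // => -[b [a [ha [hb [? [hab ?]]]]]];
  split=> //; exists b, a; do 3 (split=> //).
- by move: hab; rewrite sat_RatAdd.
- by rewrite sat_RatAdd.
Qed.

Lemma sat_AbsLtRat (e : nat -> M) (d q : nat) x y :
  isreal x -> isreal y -> israt (e q) ->
  (forall p, p ∈ e d <-> israt p /\ exists u, ~ inval y u /\ inval x (qval p + u)) ->
  (sat e (AbsLtRat d q) <-> close x y (qval (e q))).
Proof.
move=> hx hy hq Hd.
rewrite /AbsLtRat /LtRat /close; ssat; split=> -[h1 h2]; split.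
- move: h1 => [z [p]]; rewrite sat_Rat sat_RatZero /= => -[hp [hz]].
  rewrite sat_RatAdd //=; first by rewrite hz; apply: israt_rzero.
  rewrite /radd hz qval_rzero => -[E /Hd [_ [u [hu hxu]]]].
  exists u; split=> //; apply: inval_ext hxu.
  transitivity ((qval p + qval (e q)) + u - qval (e q)); first by ring.
  by setoid_rewrite E; ring.
- move: h2 => [p]; rewrite sat_Rat /= => -[hp]; rewrite sat_RatLt //= => -[hpq hpd].
  exists (qval p); split=> // u hu h; apply: hpd; apply/Hd; split=> //.
  by exists u.
- move: h1 => [u [hu hxu]]; have [p [hp E]] := israt_exists (qopp (qval (e q))).
  exists rzero, p; rewrite sat_Rat sat_RatZero sat_RatAdd //=; first exact: israt_rzero.
  split=> //; split=> //; split.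
    by rewrite /radd qval_rzero; setoid_rewrite E; ring.
  apply/Hd; split=> //; exists u; split=> //; apply: inval_ext hxu.
  by setoid_rewrite E; ring.
- move: h2 => [w [hw H]]; have [p [hp E]] := israt_exists w.
  exists p; rewrite sat_Rat sat_RatLt //=; split=> //; split.
    by apply: qlt_ext hw; [symmetry|apply: qeq_refl].
  move=> /Hd [_ [u [hu h]]]; apply: (H u hu); apply: inval_ext h.
  by setoid_rewrite E; ring.
Qed.

Lemma close_ext x y v w : v == w -> close x y v -> close x y w.
Proof.
move=> E [[u [hu hx]] [w' [hw H]]]; split.
- by exists u; split=> //; apply: inval_ext hx; setoid_rewrite E; apply: qeq_refl.
- by exists w'; split=> //; apply: qlt_ext hw; [apply: qeq_refl|].
Qed.
Lemma close_inval x y u v : isreal x -> isreal y -> close x y (v - u) ->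
  inval x v -> inval y u.
Proof.
move=> hx hy [_ [w [hw H]]] hv; apply: NNPP => h; apply: (H u h).
by apply: (inval_lt x hx) hv; apply: qlt_by hw _; ring.
Qed.
Lemma close_above x y u v : isreal x -> isreal y -> close x y (v - u) ->
  ~ inval x u -> above y v.
Proof.
move=> hx hy [[w [hw H]] _] hu; exists w; split=> //.
by apply: qlt_by (inval_le x hx _ _ H hu) _; ring.
Qed.

Lemma Df_isreal t : DfT t -> Df (fun e => isreal (t e)).
Proof.
move=> ht; apply: (Df_iff (fun e => sat (cst (t e)) (Ded 0))) => [e|].
  by rewrite sat_Ded.
by apply: Df_sat.
Qed.

Definition RR : M := sep (pow ratset) isreal.
Lemma in_RR x : x ∈ RR <-> isreal x.
Proof.
rewrite in_sep; first by apply Df_isreal; dfn.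
split=> [[] //|hx]; split=> //; apply/in_pow => q hq.
by apply/in_ratset; apply: (proj1 hx).
Qed.
Lemma sat_Reals (e : nat -> M) (X : nat) : sat e (Reals X) <-> e X = RR.
Proof.
rewrite /Reals; ssat; split=> [h|->].
- by apply: ext => z; rewrite in_RR; move: (h z); rewrite sat_Ded.
- by move=> x; rewrite in_RR sat_Ded.
Qed.

Definition isopen J : Prop := (forall y, y ∈ J -> isreal y) /\
  forall x, x ∈ J -> exists p q, israt p /\ israt q /\ p ∈ x /\ above x (qval q) /\
    forall y, isreal y -> p ∈ y -> above y (qval q) -> y ∈ J.

Lemma sat_Open (e : nat -> M) (J : nat) : sat e (Open J) <-> isopen (e J).
Proof.
rewrite /Open /isopen; ssat.
have E : (forall y, y ∈ e J -> sat (y .: e) (Ded 0)) <-> (forall y, y ∈ e J -> isreal y).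
  by split=> h y /h; rewrite sat_Ded.
rewrite E; split=> -[h1 h2]; split=> // x hx; have hx' := h1 x hx.
- have [q [p]] := h2 x hx; rewrite !sat_Rat /= => -[hp [hq [hpx]]].
  rewrite sat_LtRat //= => -[hxq H]; exists p, q; do 4 (split=> //).
  move=> y hy hpy hyq; move: (H y); rewrite sat_Ded sat_LtRat //=; apply=> //.
- have [p [q [hp [hq [hpx [hxq H]]]]]] := h2 x hx; exists q, p.
  rewrite !sat_Rat sat_LtRat //=; do 4 (split=> //).
  move=> y; rewrite sat_Ded /= => hy; rewrite sat_LtRat //=; exact: H.
Qed.

Lemma Df_isopen t : DfT t -> Df (fun e => isopen (t e)).
Proof.
move=> ht; apply: (Df_iff (fun e => sat (cst (t e)) (Open 0))) => [e|].
  by rewrite sat_Open.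
by apply: Df_sat.
Qed.

Lemma above_rat x : isreal x -> exists q, israt q /\ above x (qval q).
Proof.
move=> hx; have [u hu] := inval_nex x hx.
have [q [hq E]] := israt_exists (u + q1); exists q; split=> //; exists u; split=> //.
have h : q0 (M := M) < q1 by exact: q1_pos.
by apply: qlt_by h _; setoid_rewrite E; ring.
Qed.

Lemma isopen_RR : isopen RR.
Proof.
split=> [y|x]; rewrite in_RR // => hx; have [q [hq hxq]] := above_rat x hx.
have [h1 [[[p [hp hpx]] _] _]] := hx.
by exists p, q; do 4 (split=> //); move=> y hy; rewrite in_RR.
Qed.

Definition inter J K : M := sep J (fun x => x ∈ K).
Lemma in_inter J K x : x ∈ inter J K <-> x ∈ J /\ x ∈ K.
Proof. by rewrite in_sep //; dfn. Qed.

Lemma isopen_inter J K : isopen J -> isopen K -> isopen (inter J K).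
Proof.
move=> [hJ1 hJ2] [hK1 hK2]; split=> [y /in_inter [/hJ1] //|x /in_inter [xJ xK]].
have hx := hJ1 _ xJ.
have [p [q [hp [hq [hpx [hxq H]]]]]] := hJ2 _ xJ.
have [p' [q' [hp' [hq' [hpx' [hxq' H']]]]]] := hK2 _ xK.
have [p0 [hp0 [hpx0 Hp]]] : exists p0, israt p0 /\ p0 ∈ x /\
    forall y, isreal y -> p0 ∈ y -> p ∈ y /\ p' ∈ y.
{ case: (qlt_trichotomy (qval p) (qval p')) => [h|[h|h]]; [exists p'|exists p|exists p];
    do 2 (split=> //); move=> y hy hpy; split=> //; rewrite -inval_mem //;
    [apply: (inval_lt y hy _ _ h)|apply: (inval_ext _ _ _ h)|apply: (inval_lt y hy _ _ h)];
    by rewrite inval_mem. }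
have [q0 [hq0 [hxq0 Hq]]] : exists q0, israt q0 /\ above x (qval q0) /\
    forall y, above y (qval q0) -> above y (qval q) /\ above y (qval q').
{ case: (qlt_trichotomy (qval q) (qval q')) => [h|[E|h]].
  - by exists q; do 2 (split=> //); move=> y hy; split=> //; apply: above_lt hy.
  - exists q; do 2 (split=> //); move=> y [u [hu hyu]]; split; exists u; split=> //.
    by apply: qlt_ext hu => //; apply: qeq_refl.
  - by exists q'; do 2 (split=> //); move=> y hy; split=> //; apply: above_lt hy. }
exists p0, q0; do 4 (split=> //); move=> y hy hpy hyq.
have [? ?] := Hp y hy hpy; have [? ?] := Hq y hyq.
by rewrite in_inter; split; [apply: H|apply: H'].
Qed.

Definition ray q : M := sep RR (fun x => q ∈ x).
Lemma in_ray q x : x ∈ ray q <-> isreal x /\ q ∈ x.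
Proof. by rewrite in_sep; [dfn|rewrite in_RR]. Qed.
Lemma isopen_ray q : isopen (ray q).
Proof.
split=> [y /in_ray [] //|x /in_ray [hx hq]].
have [q' [hq' hxq]] := above_rat x hx; have hq0 := proj1 hx _ hq.
by exists q, q'; do 4 (split=> //); move=> y hy hqy _; rewrite in_ray.
Qed.

Definition interval p q : M := sep RR (fun x => p ∈ x /\ sat (x .: cst q) (LtRat 0 1)).
Lemma in_interval p q x : israt q ->
  x ∈ interval p q <-> isreal x /\ p ∈ x /\ above x (qval q).
Proof.
move=> hq; rewrite in_sep; first dfn; rewrite in_RR.
by split=> -[hx]; rewrite sat_LtRat.
Qed.
Lemma isopen_interval p q : israt p -> israt q -> isopen (interval p q).
Proof.
move=> hp hq; split=> [y /(in_interval _ _ _ hq) [] //|x].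
move=> /(in_interval _ _ _ hq) [hx [hpx hxq]]; exists p, q.
by do 4 (split=> //); move=> y hy hpy hyq; rewrite in_interval.
Qed.

Lemma emp_mem_nat n : isnat n -> n = emp \/ emp ∈ n.
Proof.
move: n; apply: nat_ind => [||n hn [->|h]]; first dfn; first by left.
- by right; rewrite in_succ; right.
- by right; rewrite in_succ; left.
Qed.
Lemma pair_neq_emp p q : pair p q <> emp.
Proof. by move=> E; apply: (emp_spec p); rewrite -E in_pair; left. Qed.

(* A real that is also an ordered pair [<a,_>] would contain [{a}], whose first
   component is a natural number that is itself an ordered pair. *)
Lemma isreal_neq_israt x : isreal x -> ~ israt x.
Proof.
move=> hx hq; have hE := repE _ hq; have hr := proj1 hx.
set a := sval (qa (qval x)) in hE.
have ha : isnat a by exact: isnat_N.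
have h : israt (pair a a) by apply: hr; rewrite hE in_pair; left.
move: (repE _ h) => /pair_inj.
set a' := sval _; set b := opair _ _ => E.
have {E} [E1 E2] : a = pair a' a' /\ a = pair a' b by case: E => -[].
have Eb : b = a'.
  have : b ∈ pair a' a' by rewrite -E1 E2 in_pair; right.
  by rewrite in_pair => -[].
(* A natural number is empty or contains the empty set. Here [a] is the singleton of an ordered
   pair, so it is neither. *)
case: (emp_mem_nat a ha) => [Ea|]; first by apply: (pair_neq_emp a' a'); rewrite -E1.
rewrite E1 in_pair -Eb => h'; apply: (pair_neq_emp _ _ (esym _)).
by case: h' => ->.
Qed.

Definition rcut q : M := sep ratset (fun p => israt q /\ sat (p .: cst q) (RatLt 0 1)).
Lemma in_rcut p q : israt q -> p ∈ rcut q <-> israt p /\ rlt p q.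
Proof.
move=> hq; rewrite in_sep; first dfn; rewrite in_ratset.
split=> [[hp [_]]|[hp h]]; first by rewrite sat_RatLt.
by rewrite sat_RatLt.
Qed.
Lemma isreal_rcut q : israt q -> isreal (rcut q).
Proof.
move=> hq; split=> [p /(in_rcut _ _ hq) [] //|]; split; first split.
- have [p [hp E]] := israt_exists (qval q - q1); exists p; split=> //.
  rewrite in_rcut //; split=> //; have h : q0 (M := M) < q1 by exact: q1_pos.
  apply: qlt_by h _.
  by setoid_rewrite E; ring.
- by exists q; split=> //; rewrite in_rcut // => -[_ h]; exact: (qlt_irrefl _ h).
- split=> [p /(in_rcut _ _ hq) [hp /qlt_dense [v [h1 h2]]]|r p hp hr hpr].
  + have [r [hr E]] := israt_exists v; exists r; rewrite in_rcut //; split; first split=> //.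
    * by apply: qlt_ext h2; [symmetry|apply: qeq_refl].
    * by apply: qlt_ext h1; [apply: qeq_refl|symmetry].
  + case: (classic (r ∈ rcut q)) => [h|]; [left|by right].
    move: h; rewrite !in_rcut // => -[_ h]; split=> //; exact: qlt_trans h.
Qed.

(** Beyond the lower endpoint of an interval around [x] inside [J] there is still a rational [p'] in
    [x]. Its own cut remains in the interval and differs from [x], since it lacks [p']. *)
Lemma isopen_other J x : isopen J -> x ∈ J -> exists y, y ∈ J /\ y <> x.
Proof.
move=> [h1 h2] hxJ; have hx := h1 x hxJ.
have [p [q [hp [hq [hpx [[u [huq hxu]] H]]]]]] := h2 x hxJ.
have [p' [hp'x hpp']] := proj1 (proj2 (proj2 hx)) p hpx.
have hp' := proj1 hx _ hp'x.
exists (rcut p'); split.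
- apply: H; [exact: isreal_rcut|by rewrite in_rcut|exists u; split=> //].
  move=> [r [/(in_rcut _ _ hp') [hr hrp'] E]]; apply: hxu.
  apply: (inval_lt x hx _ (qval p')); last by rewrite inval_mem.
  by apply: qlt_ext hrp' => //; apply: qeq_refl.
- by move=> E; move: hp'x; rewrite -E in_rcut // => -[_ h]; exact: (qlt_irrefl _ h).
Qed.

(* Two reals in an interval of length [2e] around a gap of [x] are [2e]-close. *)
Lemma close_nbhd x e : isreal x -> q0 < e -> exists J, isopen J /\ x ∈ J /\
  forall y, y ∈ J -> forall v, e + e < v -> close x y v.
Proof.
move=> hx he; have [w [hw hw']] := gap x e hx he.
have [p [hp Ep]] := israt_exists w; have [q [hq Eq]] := israt_exists (w + (e + e)).
have hpx : p ∈ x by rewrite -inval_mem //; apply: inval_ext hw; symmetry.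
exists (interval p q); split; first exact: isopen_interval.
split.
  rewrite in_interval //; split=> //; split=> //; exists (w + e); split=> //.
  by apply: qlt_by he _; setoid_rewrite Eq; ring.
move=> y /(in_interval _ _ _ hq) [hy [hpy [u [huq hyu]]]] v hv; split.
- exists u; split=> //; apply: (inval_lt x hx) hw.
  apply: qlt_by (qlt_add _ _ _ _ huq hv) _; setoid_rewrite Eq; ring.
- exists (e + e); split=> // u' hu' h; apply: hw'.
  apply: (inval_lt x hx) h.
  have h : qval p < u' by apply: (inval_le y hy) => //; rewrite inval_mem.
  apply: qlt_by (qlt_add _ _ _ _ h he) _; setoid_rewrite Ep; ring.
Qed.
End OpenSets.

Hint Extern 0 (Df (fun _ => isreal _)) => apply Df_isreal; dfn : dfn.
Hint Extern 0 (Df (fun _ => isopen _)) => apply Df_isopen; dfn : dfn.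

(** * Names *)

Definition isterm {M : structure} {HZ : ZF M} (s : M) : Prop := exists T, s ∈ T /\
  forall y, y ∈ T -> forall x, x ∈ y -> exists j t,
    x = opair t j /\ t ∈ T /\ (isopen j \/ isreal j).

(** * Recursion on names *)

Section Fold.
Context {M : structure} {HZ : ZF M}.
Implicit Types p s t u v x y z : M.
Variable Sel : M -> M -> M -> Prop.
Hypothesis DSel : Df (fun e => Sel (e 0) (e 1) (e 2)).
Hypothesis Sel_below : forall p u' u, Sel p u' u -> below u' u.

Lemma Df_Sel (t u v : (nat -> M) -> M) : DfT t -> DfT u -> DfT v ->
  Df (fun e => Sel (t e) (u e) (v e)).
Proof. exact: Df_pred3. Qed.
Hint Extern 0 (Df (fun _ => Sel _ _ _)) => apply Df_Sel; dfn : dfn.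

Definition fold_closed p F : Prop := forall v u, opair u v ∈ F ->
  (forall u', Sel p u' u -> exists v', opair u' v' ∈ F) /\
  (forall z, z ∈ v <->
    exists v' u', Sel p u' u /\ opair u' v' ∈ F /\ z = opair v' RR).
Definition fold_rel p s t : Prop := exists F, opair s t ∈ F /\ fold_closed p F.
(** The common recursion behind settling and [hat]: each selected [u'] is replaced by its own value,
    paired with the set of all reals. The two differ only in [Sel]. *)
Definition fold p s : M := the (fold_rel p s).

Lemma Df_fold_rel (t u v : (nat -> M) -> M) : DfT t -> DfT u -> DfT v ->
  Df (fun e => fold_rel (t e) (u e) (v e)).
Proof. by apply: Df_pred3; rewrite /fold_rel /fold_closed; dfn. Qed.
Hint Extern 0 (Df (fun _ => fold_rel _ _ _)) => apply Df_fold_rel; dfn : dfn.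
Lemma DfT_fold (t u : (nat -> M) -> M) : DfT t -> DfT u -> DfT (fun e => fold (t e) (u e)).
Proof. by apply: DfT_fun2; rewrite /fold; dfn. Qed.
Hint Extern 0 (DfT (fun _ => fold _ _)) => apply DfT_fold; dfn : dfn.

Lemma fold_rel_uniq p s t t' : fold_rel p s t -> fold_rel p s t' -> t = t'.
Proof.
move: s t t'; apply: below_ind; first dfn.
move=> s IH t t' [F [h H]] [F' [h' H']].
have [h1 h2] := H _ _ h; have [h1' h2'] := H' _ _ h'.
apply: ext => z; rewrite h2 h2'; split=> -[v [u [hu [huv ->]]]].
- have [w hw] := h1' u hu; exists w, u; do 2 (split=> //); congr opair.
  by apply: (IH u (Sel_below _ _ _ hu)); [exists F|exists F'].
- have [w hw] := h1 u hu; exists w, u; do 2 (split=> //); congr opair.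
  by apply: (IH u (Sel_below _ _ _ hu)); [exists F'|exists F].
Qed.
Lemma fold_relE p s t : fold_rel p s t -> t = fold p s.
Proof.
move=> h; apply: (fold_rel_uniq _ _ _ _ h); apply: the_spec; first by exists t.
exact: fold_rel_uniq.
Qed.

Lemma fold_rel_sub p s t u : fold_rel p s t -> Sel p u s -> fold_rel p u (fold p u).
Proof.
move=> [F [h H]] hu; have [h1 _] := H _ _ h; have [v hv] := h1 u hu.
have h2 : fold_rel p u v by exists F.
by rewrite -(fold_relE _ _ _ h2).
Qed.
Lemma fold_rel_mem p s t z : fold_rel p s t ->
  z ∈ t <-> exists u, Sel p u s /\ z = opair (fold p u) RR.
Proof.
move=> [F [h H]]; have [h1 h2] := H _ _ h; rewrite h2; split=> [[v [u [hu [huv ->]]]]|[u [hu ->]]].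
- by exists u; split=> //; rewrite -(fold_relE p u v) //; exists F.
- have [v hv] := h1 u hu; exists v, u; do 2 (split=> //).
  by rewrite -(fold_relE p u v) //; exists F.
Qed.

(** The values already available inside [tc s] are gathered in one set [W], and the pair for [s] is
    added to it. Assuming that [s] has no value makes this harmless: nothing with a value can select
    [s], so the added pair does not interfere with the closure of [W]. *)
Lemma fold_rel_total p s : fold_rel p s (fold p s).
Proof.
move: s; apply: below_ind; first dfn.
move=> s IH; apply: NNPP => no.
have {}no t : ~ fold_rel p s t by move=> h; apply: no; rewrite -(fold_relE _ _ _ h).
have D1 : Df (fun e => fold_rel p (e 0) (fold p (e 0))) by dfn.
have D2 : Df (fun e => Sel p (e 0) s) by dfn.
have D3 : Df (fun e => e 0 = opair (e 1) (fold p (e 1))) by dfn.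
have D4 : Df (fun e => e 0 = opair (fold p (e 1)) RR) by dfn.
pose (W := rep (sep (tc s) (fun u => fold_rel p u (fold p u))) (fun u => opair u (fold p u))).
(* The value that [s] ought to have, computed from the values of what [s] selects; the induction
   hypothesis supplies those. *)
pose (t := rep (sep (tc s) (fun u => Sel p u s)) (fun u => opair (fold p u) RR)).
pose (q := opair s t).
have inW u v : opair u v ∈ W <-> u ∈ tc s /\ fold_rel p u v.
{ rewrite (in_rep _ (fun u => opair u (fold p u)) D3).
  split=> [[u' []]|[hu h]].
  - rewrite (in_sep _ (fun u => fold_rel p u (fold p u)) D1) => -[hu h] /opair_inj [-> ->].
    by [].
  - exists u; rewrite (in_sep _ (fun u => fold_rel p u (fold p u)) D1).
    by rewrite -(fold_relE _ _ _ h). }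
have int z : z ∈ t <-> exists u, Sel p u s /\ z = opair (fold p u) RR.
{ rewrite (in_rep _ (fun u => opair (fold p u) RR) D4).
  split=> [[u]|[u [hu ->]]].
  - by rewrite (in_sep _ (fun u => Sel p u s) D2) => -[[_ hu] ->]; exists u.
  - exists u; rewrite (in_sep _ (fun u => Sel p u s) D2); split=> //; split=> //.
    by apply: (below_trans _ _ s) (Sel_below _ _ _ hu); [exact: tc_trans|exact: tc_self]. }
have sub u u' : u ∈ tc s -> Sel p u' u -> u' ∈ tc s.
  by move=> hu /Sel_below; apply: below_trans => //; exact: tc_trans.
apply: (no t); exists (union W (pair q q)).
split; first by rewrite in_union in_pair; right; left.
move=> v u; rewrite in_union inW in_pair => -[[hu huv]|huv].
- split=> [u' hu'|z].
  + exists (fold p u'); rewrite in_union inW; left; split; first exact: (sub _ _ hu hu').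
    exact: (fold_rel_sub _ _ _ _ huv hu').
  + rewrite (fold_rel_mem _ _ _ _ huv); split=> [[u' [hu' ->]]|[v' [u' [hu' [H ->]]]]].
    * exists (fold p u'), u'; do 2 (split=> //); rewrite in_union inW; left.
      split; first exact: (sub _ _ hu hu').
      exact: (fold_rel_sub _ _ _ _ huv hu').
    * exists u'; split=> //; congr opair; apply: fold_relE.
      move: H; rewrite in_union inW in_pair => -[[] //|H].
      have {H} [E _] : u' = s /\ v' = t by apply: opair_inj; case: H.
      by subst u'; case: (no (fold p s)); exact: (fold_rel_sub _ _ _ _ huv hu').
- have {huv} [-> ->] : u = s /\ v = t by apply: opair_inj; case: huv.
  split=> [u' hu'|z].
  + exists (fold p u'); rewrite in_union inW; left; split; last first.
      exact: (IH _ (Sel_below _ _ _ hu')).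
    by apply: (sub _ _ _ hu'); exact: tc_self.
  + rewrite int; split=> [[u' [hu' ->]]|[v' [u' [hu' [H ->]]]]].
    * exists (fold p u'), u'; do 2 (split=> //); rewrite in_union inW; left.
      split; last exact: (IH _ (Sel_below _ _ _ hu')).
      by apply: (sub _ _ _ hu'); exact: tc_self.
    * exists u'; split=> //; congr opair; apply: fold_relE.
      move: H; rewrite in_union inW in_pair => -[[] //|H].
      have {H} [E _] : u' = s /\ v' = t by apply: opair_inj; case: H.
      by subst u'; case: (no (fold p s)); exact: (IH _ (Sel_below _ _ _ hu')).
Qed.

Lemma fold_relP p s t : fold_rel p s t <-> t = fold p s.
Proof. by split=> [|->]; [exact: fold_relE|exact: fold_rel_total]. Qed.
Lemma in_fold p s z : z ∈ fold p s <-> exists u, Sel p u s /\ z = opair (fold p u) RR.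
Proof. exact: fold_rel_mem (fold_rel_total p s). Qed.

(** The image of [tc s] under [fold p] is the required set of names; all second components are [RR],
    which is open. *)
Lemma isterm_fold p s : isterm (fold p s).
Proof.
have D : Df (fun e => e 0 = fold p (e 1)) by dfn.
exists (rep (tc s) (fold p)); split.
  by rewrite (in_rep _ (fold p) D); exists s; split=> //; exact: tc_self.
move=> y; rewrite (in_rep _ (fold p) D) => -[u [hu ->]] x.
move=> /in_fold [u' [hu' ->]]; exists RR, (fold p u'); split=> //; split.
- rewrite (in_rep _ (fold p) D); exists u'; split=> //.
  by apply: below_trans (Sel_below _ _ _ hu') => //; exact: tc_trans.
- by left; exact: isopen_RR.
Qed.
End Fold.

(* [y = hat x], where [hat x = {<hat u, R> | u in x}] *)
Definition Hat (x y : nat) : fml :=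
  Ex (FAnd (PairIn (S x) (S y) 0) (alls 2 (FImp (PairIn 0 1 2) (FAnd
    (All (FImp (FMem 0 1) (Ex (PairIn 1 0 4))))
    (All (FIff (FMem 0 2) (exs 3 (FAnd (FMem 0 4)
      (FAnd (PairIn 0 1 6) (FAnd (Reals 2) (OPair 1 2 3))))))))))).

Section Names.
Context {M : structure} {HZ : ZF M}.
Implicit Types r s t u v x y z : M.

Definition active r j : Prop := (isopen j /\ r ∈ j) \/ j = r.
Definition settle_sel r u' u : Prop := exists j, opair u' j ∈ u /\ active r j.
Definition hat_sel (r u' u : M) : Prop := u' ∈ u.

Lemma Df_settle_sel : Df (fun e : nat -> M => settle_sel (e 0) (e 1) (e 2)).
Proof. by rewrite /settle_sel /active; dfn. Qed.
Lemma Df_hat_sel : Df (fun e : nat -> M => hat_sel (e 0) (e 1) (e 2)).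
Proof. by rewrite /hat_sel; dfn. Qed.
Lemma settle_sel_below r u' u : settle_sel r u' u -> below u' u.
Proof. by move=> [j [h _]]; exact: below_opair h. Qed.
Lemma hat_sel_below r u' u : hat_sel r u' u -> below u' u.
Proof. by left. Qed.

Definition settle r s : M := fold settle_sel r s.
Definition hat x : M := fold hat_sel emp x.

Lemma DfT_settle (t u : (nat -> M) -> M) :
  DfT t -> DfT u -> DfT (fun e => settle (t e) (u e)).
Proof. by apply: DfT_fold; exact: Df_settle_sel. Qed.
Lemma DfT_hat (t : (nat -> M) -> M) : DfT t -> DfT (fun e => hat (t e)).
Proof. by apply: DfT_fold; [exact: Df_hat_sel|exact: DfT_cst]. Qed.

Lemma in_settle r s z : z ∈ settle r s <->
  exists u j, opair u j ∈ s /\ active r j /\ z = opair (settle r u) RR.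
Proof.
rewrite /settle in_fold; [exact: Df_settle_sel|exact: settle_sel_below|].
split=> [[u [[j [h ha]] ->]]|[u [j [h [ha ->]]]]]; first by exists u, j.
by exists u; split=> //; exists j.
Qed.
Lemma in_hat x z : z ∈ hat x <-> exists y, y ∈ x /\ z = opair (hat y) RR.
Proof. exact: (in_fold _ Df_hat_sel hat_sel_below). Qed.

Lemma isterm_settle r s : isterm (settle r s).
Proof. exact: (isterm_fold _ Df_settle_sel settle_sel_below). Qed.
Lemma isterm_hat x : isterm (hat x).
Proof. exact: (isterm_fold _ Df_hat_sel hat_sel_below). Qed.

Lemma active_RR r : isreal r -> active r RR.
Proof. by move=> hr; left; rewrite in_RR; split=> //; exact: isopen_RR. Qed.

(** Every pair of a [fold] carries [RR], which is active at every real. Settling therefore drops no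
    pair and, by induction, changes none; this covers settled names and names [hat x] alike. *)
Lemma settle_fixed (Sel : M -> M -> M -> Prop) p s r :
  Df (fun e => Sel (e 0) (e 1) (e 2)) -> (forall p u' u, Sel p u' u -> below u' u) ->
  isreal r -> settle r (fold Sel p s) = fold Sel p s.
Proof.
move=> DS SB hr; move: s; apply: below_ind.
  apply: Df_eq; last by apply: DfT_fold => //; dfn.
  by apply: DfT_settle; [dfn|apply: DfT_fold => //; dfn].
move=> s IH; apply: ext => z; rewrite in_settle in_fold //.
split=> [[w [j [+ [_ ->]]]]|[u [hu ->]]].
- rewrite in_fold // => -[u [hu /opair_inj [-> _]]].
  by exists u; split=> //; rewrite IH //; exact: SB hu.
- exists (fold Sel p u), RR; rewrite in_fold //; split; first by exists u.
  split; first exact: active_RR.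
  by rewrite IH //; exact: SB hu.
Qed.
Lemma settle_settle r r' s : isreal r' -> settle r' (settle r s) = settle r s.
Proof. by apply: settle_fixed; [exact: Df_settle_sel|exact: settle_sel_below]. Qed.
Lemma settle_hat r x : isreal r -> settle r (hat x) = hat x.
Proof. by apply: settle_fixed; [exact: Df_hat_sel|exact: hat_sel_below]. Qed.

Lemma hat_inj x y : hat x = hat y -> x = y.
Proof.
move: x y; apply: (eps_ind (fun x => forall y, hat x = hat y -> x = y)).
  apply: Df_all; apply: Df_imp; last dfn.
  by apply: Df_eq; apply: DfT_hat; dfn.
move=> x IH y E; apply: ext => z; split=> hz.
- have : opair (hat z) RR ∈ hat y by rewrite -E in_hat; exists z.
  by rewrite in_hat => -[w [hw /opair_inj [/(IH _ hz) ->]]].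
- have : opair (hat z) RR ∈ hat x by rewrite E in_hat; exists z.
  by rewrite in_hat => -[w [hw /opair_inj [Ew _]]]; rewrite -(IH w hw z).
Qed.

Lemma sat_Active (e : nat -> M) (r j : nat) : sat e (Active r j) <-> active (e r) (e j).
Proof. by rewrite /Active; ssat; rewrite sat_Open. Qed.

Lemma sat_Settle (e : nat -> M) (r s t : nat) : sat e (Settle r s t) <-> e t = settle (e r) (e s).
Proof.
rewrite -fold_relP; [exact: Df_settle_sel|exact: settle_sel_below|].
rewrite /Settle; ssat.
split=> -[F [hF H]]; exists F; move: hF; rewrite sat_PairIn /= => hF; split=> // v u;
  move: (H v u); rewrite ?sat_PairIn /= => {}H /H [h1 h2]; split.
- move=> u' [j [h hj]]; have := h1 j u'; rewrite sat_PairIn sat_Active /=.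
  by case=> // v' ; rewrite sat_PairIn; exists v'.
- move=> z; apply: (iff_trans (h2 z)).
  split=> [[X [v' [j [u']]]]|[v' [u' [[j [h hj]] [hv' ->]]]]].
  + rewrite !sat_PairIn sat_Active sat_Reals sat_OPair /= => -[h [hj [hF' [-> ->]]]].
    by exists v', u'; split=> //; exists j.
  + by exists RR, v', j, u'; rewrite !sat_PairIn sat_Active sat_Reals sat_OPair /=.
- move=> j u'; rewrite sat_PairIn sat_Active /= => h hj.
  have [|v' hv'] := h1 u'; first by exists j.
  by exists v'; rewrite sat_PairIn.
- move=> z; apply: (iff_trans (h2 z)).
  split=> [[v' [u' [[j [h hj]] [hv' ->]]]]|[X [v' [j [u']]]]].
  + by exists RR, v', j, u'; rewrite !sat_PairIn sat_Active sat_Reals sat_OPair /=.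
  + rewrite !sat_PairIn sat_Active sat_Reals sat_OPair /= => -[h [hj [hF' [-> ->]]]].
    by exists v', u'; split=> //; exists j.
Qed.

Lemma sat_Hat (e : nat -> M) (x y : nat) : sat e (Hat x y) <-> e y = hat (e x).
Proof.
rewrite -fold_relP; [exact: Df_hat_sel|exact: hat_sel_below|].
rewrite /Hat; ssat.
split=> -[F [hF H]]; exists F; move: hF; rewrite sat_PairIn /= => hF; split=> // v u;
  move: (H v u); rewrite ?sat_PairIn /= => {}H /H [h1 h2]; split.
- move=> u' h; have [v'] := h1 u' h; rewrite sat_PairIn /= => hv'.
  by exists v'.
- move=> z; apply: (iff_trans (h2 z)).
  split=> [[X [v' [u']]]|[v' [u' [h [hv' ->]]]]].
  + rewrite !sat_PairIn sat_Reals sat_OPair /= => -[h [hF' [-> ->]]].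
    by exists v', u'.
  + by exists RR, v', u'; rewrite !sat_PairIn sat_Reals sat_OPair /=.
- move=> u' h; have [v' hv'] := h1 u' h.
  by exists v'; rewrite sat_PairIn.
- move=> z; apply: (iff_trans (h2 z)).
  split=> [[v' [u' [h [hv' ->]]]]|[X [v' [u']]]].
  + by exists RR, v', u'; rewrite !sat_PairIn sat_Reals sat_OPair /=.
  + rewrite !sat_PairIn sat_Reals sat_OPair /= => -[h [hF' [-> ->]]].
    by exists v', u'.
Qed.

Lemma sat_Term (e : nat -> M) (s : nat) : sat e (Term s) <-> isterm (e s).
Proof.
rewrite /Term /isterm; ssat.
split=> -[T [hs H]]; exists T; split=> // y hy x hx; have [j [t]] := H y hy x hx.
- rewrite sat_OPair sat_Open sat_Ded /= => -[E [ht hj]]; by exists j, t.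
- move=> [E [ht hj]]; by exists j, t; rewrite sat_OPair sat_Open sat_Ded.
Qed.

Lemma isterm_mem s u j : isterm s -> opair u j ∈ s -> isterm u.
Proof.
move=> [T [hs H]] h; have [j' [t [/opair_inj [-> _] [ht _]]]] := H s hs _ h.
by exists T.
Qed.
End Names.

Hint Extern 0 (DfT (fun _ => settle _ _)) => apply DfT_settle; dfn : dfn.
Hint Extern 0 (DfT (fun _ => hat _)) => apply DfT_hat; dfn : dfn.

(** * Forcing *)

Section Forcing.
Context {M : structure} {HZ : ZF M}.
Implicit Types r s t u v x y z J K : M.
Implicit Types P Q : M -> M -> M -> Prop.

Definition eq_step Q J s t : Prop :=
  (forall j u, opair u j ∈ s -> isopen j -> Q (inter J j) u t) /\
  (forall j u, opair u j ∈ t -> isopen j -> Q (inter J j) u s) /\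
  forall r, r ∈ J -> settle r s = settle r t.
Definition mem_step P J s t : Prop := forall r, r ∈ J ->
  (exists j u J', opair u j ∈ t /\ isopen j /\ isopen J' /\ (forall x, x ∈ J' -> x ∈ J) /\
     r ∈ inter J' j /\ P (inter J' j) s u) /\
  opair (settle r s) RR ∈ settle r t.
Definition justified (Ae Am : M) : Prop :=
  (forall t s J, opair J (opair s t) ∈ Ae ->
     eq_step (fun J s t => opair J (opair s t) ∈ Am) J s t) /\
  (forall t s J, opair J (opair s t) ∈ Am ->
     mem_step (fun J s t => opair J (opair s t) ∈ Ae) J s t).
Definition feq J s t : Prop :=
  exists Am Ae, justified Ae Am /\ opair J (opair s t) ∈ Ae.
Definition fmem J s t : Prop :=
  exists Am Ae, justified Ae Am /\ opair J (opair s t) ∈ Am.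

Lemma eq_step_mono Q Q' J s t : (forall K u v, Q K u v -> Q' K u v) ->
  eq_step Q J s t -> eq_step Q' J s t.
Proof.
move=> H [h1 [h2 h3]]; split; last split=> //; move=> j u hu hj; apply: H.
- exact: h1.
- exact: h2.
Qed.
Lemma mem_step_mono P P' J s t : (forall K u v, P K u v -> P' K u v) ->
  mem_step P J s t -> mem_step P' J s t.
Proof.
move=> H h r /h [[j [u [J' [? [? [? [? [? /H ?]]]]]]]] ?]; split=> //.
by exists j, u, J'.
Qed.

Lemma feq_unfold J s t : feq J s t -> eq_step fmem J s t.
Proof.
move=> [Am [Ae [H h]]]; apply: eq_step_mono (proj1 H _ _ _ h) => K u v hm.
by exists Am, Ae.
Qed.
Lemma fmem_unfold J s t : fmem J s t -> mem_step feq J s t.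
Proof.
move=> [Am [Ae [H h]]]; apply: mem_step_mono (proj2 H _ _ _ h) => K u v hm.
by exists Am, Ae.
Qed.

Lemma sat_Inter (e : nat -> M) (x y z : nat) :
  sat e (Inter x y z) <-> e z = inter (e x) (e y).
Proof.
rewrite /Inter; ssat; split=> [h|-> w]; last exact: in_inter.
by apply: ext => w; rewrite in_inter; exact: h.
Qed.
Lemma sat_Sub (e : nat -> M) (x y : nat) :
  sat e (Sub x y) <-> forall z, z ∈ e x -> z ∈ e y.
Proof. by []. Qed.

Lemma sat_EqHalf (e : nat -> M) (Am J s t : nat) : sat e (EqHalf Am J s t) <->
  forall j u, opair u j ∈ e s -> isopen j ->
    opair (inter (e J) j) (opair u (e t)) ∈ e Am.
Proof.
rewrite /EqHalf; ssat; split=> H j u; move: (H j u); rewrite sat_PairIn sat_Open /= => {}H.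
- move=> h hj; have [K] := H h hj; rewrite sat_Inter sat_TripleIn /= => -[-> //].
- move=> /H{}H /H h; exists (inter (e J) j).
  by rewrite sat_Inter sat_TripleIn.
Qed.
Lemma sat_EqStep (e : nat -> M) (Am J s t : nat) : sat e (EqStep Am J s t) <->
  eq_step (fun J s t => opair J (opair s t) ∈ e Am) (e J) (e s) (e t).
Proof.
rewrite /EqStep /eq_step; ssat; rewrite !sat_EqHalf.
have E : (forall r, r ∈ e J -> exists x, sat (x .: r .: e) (Settle 1 (S (S s)) 0) /\
    sat (x .: r .: e) (Settle 1 (S (S t)) 0)) <->
    (forall r, r ∈ e J -> settle r (e s) = settle r (e t)).
  split=> h r /h; first by move=> [x]; rewrite !sat_Settle /= => -[<- <-].
  by move=> {}h; exists (settle r (e s)); rewrite !sat_Settle /= {2}h.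
by rewrite E.
Qed.
Lemma sat_MemStep (e : nat -> M) (Ae J s t : nat) : sat e (MemStep Ae J s t) <->
  mem_step (fun J s t => opair J (opair s t) ∈ e Ae) (e J) (e s) (e t).
Proof.
rewrite /MemStep /mem_step; ssat; split=> H r /H{H} [h1 h2]; split.
- move: h1 => [K [J' [j [u]]]].
  rewrite sat_PairIn !sat_Open sat_Sub sat_Inter sat_TripleIn /=.
  by move=> [? [? [? [? [-> [? ?]]]]]]; exists j, u, J'.
- move: h2 => [X [t' [s']]]; rewrite !sat_Settle sat_Reals sat_PairIn /=.
  by move=> [-> [-> [-> ?]]].
- move: h1 => [j [u [J' h]]]; exists (inter J' j), J', j, u.
  rewrite sat_PairIn !sat_Open sat_Sub sat_Inter sat_TripleIn /=.
  by intuition.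
- exists RR, (settle r (e t)), (settle r (e s)).
  by rewrite !sat_Settle sat_Reals sat_PairIn /=.
Qed.
Lemma sat_Justified (e : nat -> M) (Ae Am : nat) :
  sat e (Justified Ae Am) <-> justified (e Ae) (e Am).
Proof.
rewrite /Justified /justified; ssat; split=> -[h1 h2]; split=> t s J.
- by move: (h1 t s J); rewrite sat_TripleIn sat_EqStep.
- by move: (h2 t s J); rewrite sat_TripleIn sat_MemStep.
- by move: (h1 t s J); rewrite sat_TripleIn sat_EqStep.
- by move: (h2 t s J); rewrite sat_TripleIn sat_MemStep.
Qed.
Lemma sat_ForcesEq (e : nat -> M) (J s t : nat) :
  sat e (ForcesEq J s t) <-> feq (e J) (e s) (e t).
Proof.
rewrite /ForcesEq /feq; ssat.
by split=> -[Am [Ae]]; [|move=> h]; [rewrite sat_Justified sat_TripleIn|];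
  exists Am, Ae; rewrite ?sat_Justified ?sat_TripleIn.
Qed.
Lemma sat_ForcesMem (e : nat -> M) (J s t : nat) :
  sat e (ForcesMem J s t) <-> fmem (e J) (e s) (e t).
Proof.
rewrite /ForcesMem /fmem; ssat.
by split=> -[Am [Ae]]; [|move=> h]; [rewrite sat_Justified sat_TripleIn|];
  exists Am, Ae; rewrite ?sat_Justified ?sat_TripleIn.
Qed.

Lemma Df_feq (t u v : (nat -> M) -> M) : DfT t -> DfT u -> DfT v ->
  Df (fun e => feq (t e) (u e) (v e)).
Proof.
apply: Df_pred3.
apply: (Df_iff (fun e => sat e (ForcesEq 0 1 2))) => [e|]; first by rewrite sat_ForcesEq.
by dfn.
Qed.
Lemma Df_fmem (t u v : (nat -> M) -> M) : DfT t -> DfT u -> DfT v ->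
  Df (fun e => fmem (t e) (u e) (v e)).
Proof.
apply: Df_pred3.
apply: (Df_iff (fun e => sat e (ForcesMem 0 1 2))) => [e|]; first by rewrite sat_ForcesMem.
by dfn.
Qed.

Section Coinduction.
Variables P Q : M -> M -> M -> Prop.
Hypothesis DP : Df (fun e => P (e 0) (e 1) (e 2)).
Hypothesis DQ : Df (fun e => Q (e 0) (e 1) (e 2)).
Hypothesis HP : forall J s t, P J s t -> eq_step Q J s t.
Hypothesis HQ : forall J s t, Q J s t -> mem_step P J s t.

(** Definable relations are classes, whereas [justified] asks for sets. Restricting to subsets of
    [RR] and to names in a transitive [T] loses nothing, because the clauses lead only to members of
    members of pairs in [T] and to smaller sets of reals. *)
Definition triples (R : M -> M -> M -> Prop) (T : M) : M :=
  sep (prod (pow RR) (prod T T)) (fun z => exists J s t, z = opair J (opair s t) /\ R J s t).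

Lemma in_triples R T J s t : Df (fun e => R (e 0) (e 1) (e 2)) ->
  opair J (opair s t) ∈ triples R T <->
  (forall x, x ∈ J -> x ∈ RR) /\ s ∈ T /\ t ∈ T /\ R J s t.
Proof.
move=> DR; rewrite in_sep.
  do 3 apply: Df_ex; apply: Df_and; first dfn.
  by apply: (Df_pred3 R _ _ _ DR); dfn.
rewrite !in_prod_opair in_pow.
split=> [[[h1 [h2 h3]] [J' [s' [t' [/opair_inj [E1 /opair_inj [E2 E3]] h4]]]]]|[h1 [h2 [h3 h4]]]].
  by subst.
split; last by exists J, s, t.
exact: (conj h1 (conj h2 h3)).
Qed.

Lemma justified_triples T : transitive_set T -> justified (triples P T) (triples Q T).
Proof.
move=> HT; split=> t s J; rewrite in_triples // => -[hJ [hs [ht h]]].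
- have [h1 [h2 h3]] := HP _ _ _ h; split; last split=> //; move=> j u hu hj;
  rewrite in_triples //; (split; first by move=> x /in_inter [/hJ]); split.
  + by apply: (below_trans T u s) => //; exact: below_opair hu.
  + by split=> //; exact: h1.
  + by apply: (below_trans T u t) => //; exact: below_opair hu.
  + by split=> //; exact: h2.
- move=> r hr; have [[j [u [J' [hu [hj [hJ' [sub [hr' h']]]]]]]] h2] := HQ _ _ _ h r hr.
  split=> //; exists j, u, J'; do 5 (split=> //).
  rewrite in_triples //; split; first by move=> x /in_inter [/sub /hJ].
  split=> //; split=> //.
  by apply: (below_trans T u t) => //; exact: below_opair hu.
Qed.

Lemma in_triples_tc R J s t : Df (fun e => R (e 0) (e 1) (e 2)) ->
  (forall x, x ∈ J -> x ∈ RR) -> R J s t ->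
  opair J (opair s t) ∈ triples R (tc (opair s t)).
Proof.
move=> DR hJ h; have hT : transitive_set (tc (opair s t)) by exact: tc_trans.
have hp : pair s t ∈ tc (opair s t).
  by apply: hT; [exact: tc_self|rewrite in_pair; right].
rewrite in_triples //; split=> //; split.
  by apply: hT hp _; rewrite in_pair; left.
by split=> //; apply: hT hp _; rewrite in_pair; right.
Qed.

(** Coinduction for forcing: any definable relations that satisfy the clauses from left to right are
    contained in it. *)
Lemma feq_coind J s t : (forall x, x ∈ J -> x ∈ RR) -> P J s t -> feq J s t.
Proof.
move=> hJ h; exists (triples Q (tc (opair s t))), (triples P (tc (opair s t))).
by split; [apply: justified_triples; exact: tc_trans|exact: in_triples_tc].
Qed.
Lemma fmem_coind J s t : (forall x, x ∈ J -> x ∈ RR) -> Q J s t -> fmem J s t.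
Proof.
move=> hJ h; exists (triples Q (tc (opair s t))), (triples P (tc (opair s t))).
by split; [apply: justified_triples; exact: tc_trans|exact: in_triples_tc].
Qed.
End Coinduction.
End Forcing.

Hint Extern 0 (Df (fun _ => feq _ _ _)) => apply Df_feq; dfn : dfn.
Hint Extern 0 (Df (fun _ => fmem _ _ _)) => apply Df_fmem; dfn : dfn.

(** * Equality and membership of names at a node *)

Section NodeRelations.
Context {M : structure} {HZ : ZF M}.
Implicit Types r s t u v x y z J K : M.

Lemma isopen_sub J : isopen J -> forall x, x ∈ J -> x ∈ RR.
Proof. by move=> [h _] x /h; rewrite in_RR. Qed.

(** Coinduction with [feq] enlarged by the single triple in question. *)
Lemma feq_fold J s t : isopen J -> eq_step fmem J s t -> feq J s t.
Proof.
move=> hJ h; pose (P K u v := feq K u v \/ (K = J /\ u = s /\ v = t)).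
apply: (feq_coind P fmem); rewrite /P; try dfn; last by right.
- move=> K u v [/feq_unfold //|[-> [-> ->]]] //.
- move=> K u v /fmem_unfold; apply: mem_step_mono; by left.
- exact: isopen_sub.
Qed.
Lemma fmem_fold J s t : isopen J -> mem_step feq J s t -> fmem J s t.
Proof.
move=> hJ h; pose (Q K u v := fmem K u v \/ (K = J /\ u = s /\ v = t)).
apply: (fmem_coind feq Q); rewrite /Q; try dfn; last by right.
- move=> K u v /feq_unfold; apply: eq_step_mono; by left.
- move=> K u v [/fmem_unfold //|[-> [-> ->]]] //.
- exact: isopen_sub.
Qed.

(** Being contained in a set that forces is itself preserved by the clauses: intersecting both sets
    with [j] serves for equality, and for membership the witness [J'] is cut down to the smaller
    set. *)
Lemma feq_mono J K s t : isopen K -> (forall x, x ∈ K -> x ∈ J) -> feq J s t -> feq K s t.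
Proof.
move=> hK hKJ h.
pose (P K u v := isopen K /\ exists J, (forall x, x ∈ K -> x ∈ J) /\ feq J u v).
pose (Q K u v := isopen K /\ exists J, (forall x, x ∈ K -> x ∈ J) /\ fmem J u v).
have inter_sub A B C : (forall x, x ∈ A -> x ∈ B) -> forall x, x ∈ inter A C -> x ∈ inter B C.
  by move=> sub x; rewrite !in_inter => -[/sub].
apply: (feq_coind P Q); rewrite /P /Q; try dfn; last by split=> //; exists J.
- move=> A u v [hA [B [hAB /feq_unfold [h1 [h2 h3]]]]]; split; last split.
  + move=> j w hw hj; split; first exact: isopen_inter.
    exists (inter B j); split; [exact: inter_sub|exact: h1].
  + move=> j w hw hj; split; first exact: isopen_inter.
    exists (inter B j); split; [exact: inter_sub|exact: h2].
  + by move=> r /hAB; exact: h3.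
- move=> A u v [hA [B [hAB /fmem_unfold H]]] r hr.
  have [[j [w [J' [hw [hj [hJ' [sub [+ hf]]]]]]]] h2] := H r (hAB r hr).
  rewrite in_inter => -[hr1 hr2].
  split=> //; exists j, w, (inter J' A); do 2 (split=> //).
  split; first exact: isopen_inter.
  split; first by move=> x; rewrite in_inter => -[].
  split; first by rewrite !in_inter.
  split; first by apply: isopen_inter => //; exact: isopen_inter.
  exists (inter J' j); split=> // x; rewrite !in_inter; tauto.
- exact: isopen_sub.
Qed.

Definition EQ r s t : Prop := exists J, isopen J /\ r ∈ J /\ feq J s t.
Definition MEM r s t : Prop := exists J, isopen J /\ r ∈ J /\ fmem J s t.

Lemma sat_AtEq (e : nat -> M) (r s t : nat) : sat e (AtEq r s t) <-> EQ (e r) (e s) (e t).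
Proof.
rewrite /AtEq /EQ; ssat.
by split=> -[J]; [rewrite sat_Open sat_ForcesEq|move=> h]; exists J; rewrite ?sat_Open ?sat_ForcesEq.
Qed.
Lemma sat_AtMem (e : nat -> M) (r s t : nat) : sat e (AtMem r s t) <-> MEM (e r) (e s) (e t).
Proof.
rewrite /AtMem /MEM; ssat.
by split=> -[J]; [rewrite sat_Open sat_ForcesMem|move=> h]; exists J; rewrite ?sat_Open ?sat_ForcesMem.
Qed.
Lemma Df_EQ (t u v : (nat -> M) -> M) : DfT t -> DfT u -> DfT v ->
  Df (fun e => EQ (t e) (u e) (v e)).
Proof. by apply: Df_pred3; rewrite /EQ; dfn. Qed.
Lemma Df_MEM (t u v : (nat -> M) -> M) : DfT t -> DfT u -> DfT v ->
  Df (fun e => MEM (t e) (u e) (v e)).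
Proof. by apply: Df_pred3; rewrite /MEM; dfn. Qed.

Hint Extern 0 (Df (fun _ => EQ _ _ _)) => apply Df_EQ; dfn : dfn.
Hint Extern 0 (Df (fun _ => MEM _ _ _)) => apply Df_MEM; dfn : dfn.

Lemma active_open r j : isopen j -> r ∈ j -> active r j.
Proof. by left. Qed.

(** The clause on settled names comes for free: forced equality makes [s] and [u] settle alike
    throughout [K], and the pair of [u] and [j] is active throughout [j]. *)
Lemma MEM_iff r s t : MEM r s t <->
  exists u j, opair u j ∈ t /\ isopen j /\ r ∈ j /\ EQ r s u.
Proof.
split=> [[J [hJ [hr /fmem_unfold H]]]|[u [j [hu [hj [hr [K [hK [hrK hf]]]]]]]]].
- have [[j [u [J' [hu [hj [hJ' [_ [hr' hf]]]]]]]] _] := H r hr.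
  exists u, j; move: (hr') => /in_inter [_ hrj]; do 3 (split=> //).
  exists (inter J' j); split=> //; exact: isopen_inter.
- exists (inter K j); split; first exact: isopen_inter.
  split; first by rewrite in_inter.
  apply: fmem_fold; first exact: isopen_inter.
  move=> r' hr'; split.
    exists j, u, (inter K j); do 2 (split=> //); split; first exact: isopen_inter.
    split=> //; split; first by move: hr'; rewrite !in_inter; tauto.
    apply: feq_mono hf; first by apply: isopen_inter => //; exact: isopen_inter.
    by move=> x; rewrite !in_inter; tauto.
  move: hr'; rewrite in_inter => -[hr1 hr2].
  have [_ [_ /(_ r' hr1) ->]] := feq_unfold _ _ _ hf.
  by rewrite in_settle; exists u, j; do 2 (split=> //); exact: active_open.
Qed.

Lemma EQ_settle r s t : EQ r s t -> settle r s = settle r t.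
Proof. by move=> [J [_ [hr /feq_unfold [_ [_ h]]]]]; exact: h. Qed.
Lemma MEM_settle r s t : MEM r s t -> opair (settle r s) RR ∈ settle r t.
Proof. by move=> [J [_ [hr /fmem_unfold h]]]; exact: (proj2 (h r hr)). Qed.

(** Forcing of membership is local, as its clause quantifies over the reals in [J] and allows a
    different witness near each of them. *)
Lemma fmem_pointwise J s t : isopen J -> (forall r, r ∈ J -> MEM r s t) -> fmem J s t.
Proof.
move=> hJ H; apply: fmem_fold => // r hr; split; last exact: MEM_settle (H r hr).
have := H r hr; rewrite MEM_iff => -[u [j [hu [hj [hrj [K [hK [hrK hf]]]]]]]].
exists j, u, (inter K J); do 2 (split=> //); split; first exact: isopen_inter.
split; first by move=> x; rewrite in_inter => -[].
split; first by rewrite !in_inter.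
apply: feq_mono hf; first by apply: isopen_inter => //; exact: isopen_inter.
by move=> x; rewrite !in_inter; tauto.
Qed.

(** The clauses for equality read at one real. Equality at a node is agreement in a neighbourhood
    ([EQ_iff]), which frees later arguments from open conditions. *)
Definition agree r s t : Prop :=
  (forall u j, opair u j ∈ s -> isopen j -> r ∈ j -> MEM r u t) /\
  (forall u j, opair u j ∈ t -> isopen j -> r ∈ j -> MEM r u s) /\
  settle r s = settle r t.

Lemma feq_agree J s t : isopen J -> feq J s t -> forall r, r ∈ J -> agree r s t.
Proof.
move=> hJ /feq_unfold [h1 [h2 h3]] r hr; split; last split; last exact: h3.
- move=> u j hu hj hrj; exists (inter J j); split; first exact: isopen_inter.
  by split; [rewrite in_inter|exact: h1].
- move=> u j hu hj hrj; exists (inter J j); split; first exact: isopen_inter.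
  by split; [rewrite in_inter|exact: h2].
Qed.

Lemma EQ_iff r s t : EQ r s t <->
  exists J, isopen J /\ r ∈ J /\ forall r', r' ∈ J -> agree r' s t.
Proof.
split=> -[J [hJ [hr H]]]; exists J; do 2 (split=> //); first exact: feq_agree.
apply: feq_fold => //; split; last split.
- move=> j u hu hj; apply: fmem_pointwise; first exact: isopen_inter.
  by move=> r'; rewrite in_inter => -[/H [h _]]; exact: h.
- move=> j u hu hj; apply: fmem_pointwise; first exact: isopen_inter.
  by move=> r'; rewrite in_inter => -[/H [_ [h _]]]; exact: h.
- by move=> r' /H [_ [_ h]].
Qed.
Lemma EQ_agree r s t : EQ r s t -> agree r s t.
Proof. by move=> [J [hJ [hr /feq_agree H]]]; exact: H. Qed.

Lemma EQ_refl r s : isreal r -> EQ r s s.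
Proof.
move: s r; apply: (below_ind (fun s => forall r, isreal r -> EQ r s s)).
  by dfn.
move=> s IH r hr; apply/EQ_iff; exists RR; split; first exact: isopen_RR.
split; first by rewrite in_RR.
move=> r'; rewrite in_RR => hr'.
have h u j : opair u j ∈ s -> isopen j -> r' ∈ j -> MEM r' u s.
  move=> hu hj hrj; apply/MEM_iff; exists u, j; do 3 (split=> //).
  by apply: IH => //; exact: below_opair hu.
by [].
Qed.
Lemma EQ_sym r s t : EQ r s t -> EQ r t s.
Proof.
move=> /EQ_iff [J [hJ [hr H]]]; apply/EQ_iff; exists J; do 2 (split=> //).
by move=> r' /H [? [? ?]].
Qed.
Lemma EQ_trans r s t u : EQ r s t -> EQ r t u -> EQ r s u.
Proof.
move: s r t u; apply: (below_ind (fun s => forall r t u, EQ r s t -> EQ r t u -> EQ r s u)).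
  by dfn.
move=> s IH r t u /EQ_iff [J [hJ [hrJ HJ]]] /EQ_iff [K [hK [hrK HK]]].
apply/EQ_iff; exists (inter J K); split; first exact: isopen_inter.
split; first by rewrite in_inter.
move=> r'; rewrite in_inter => -[/HJ [h1 [h2 h3]] /HK [k1 [k2 k3]]].
split; last split; last by rewrite h3.
- move=> w j hw hj hrj.
  have /MEM_iff [w' [j' [hw' [hj' [hrj' e1]]]]] := h1 w j hw hj hrj.
  have /MEM_iff [w'' [j'' [hw'' [hj'' [hrj'' e2]]]]] := k1 w' j' hw' hj' hrj'.
  apply/MEM_iff; exists w'', j''; do 3 (split=> //).
  by apply: IH e1 e2; exact: below_opair hw.
- move=> w j hw hj hrj.
  have /MEM_iff [w' [j' [hw' [hj' [hrj' e1]]]]] := k2 w j hw hj hrj.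
  have /MEM_iff [w'' [j'' [hw'' [hj'' [hrj'' e2]]]]] := h2 w' j' hw' hj' hrj'.
  apply/MEM_iff; exists w'', j''; do 3 (split=> //).
  (* The induction hypothesis applies to members of [s] only, so the chain of equalities is followed
     starting from [w'']. *)
  apply: EQ_sym; apply: (IH w'' _ _ w') (EQ_sym _ _ _ e2) (EQ_sym _ _ _ e1).
  exact: below_opair hw''.
Qed.
Lemma MEM_extl r s s' t : EQ r s s' -> MEM r s t -> MEM r s' t.
Proof.
move=> E /MEM_iff [u [j [hu [hj [hr h]]]]]; apply/MEM_iff; exists u, j.
by do 3 (split=> //); apply: EQ_trans h; exact: EQ_sym.
Qed.
Lemma MEM_extr r s t t' : EQ r t t' -> MEM r s t -> MEM r s t'.
Proof.
move=> /EQ_agree [h1 _] /MEM_iff [u [j [hu [hj [hr h]]]]].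
by apply: MEM_extl (h1 u j hu hj hr); exact: EQ_sym.
Qed.
Lemma MEM_pair r u j t : isreal r -> opair u j ∈ t -> isopen j -> r ∈ j -> MEM r u t.
Proof. by move=> hr hu hj hrj; apply/MEM_iff; exists u, j; do 3 (split=> //); exact: EQ_refl. Qed.

Lemma MEM_hat r t x : isreal r -> MEM r t (hat x) <-> exists y, y ∈ x /\ EQ r t (hat y).
Proof.
move=> hr; rewrite MEM_iff; split=> [[u [j [+ [hj [hrj h]]]]]|[y [hy h]]].
- by rewrite in_hat => -[y [hy /opair_inj [E _]]]; exists y; rewrite -E.
- exists (hat y), RR; rewrite in_hat in_RR; split; first by exists y.
  by split; first exact: isopen_RR.
Qed.
(** Equal names settle to the same set, names [hat x] are settled already, and [hat] is
    injective. *)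
Lemma EQ_hat r x y : isreal r -> EQ r (hat x) (hat y) <-> x = y.
Proof.
move=> hr; split=> [/EQ_settle|->]; last exact: EQ_refl.
by rewrite !settle_hat // => /hat_inj.
Qed.
End NodeRelations.

Hint Extern 0 (Df (fun _ => EQ _ _ _)) => apply Df_EQ; dfn : dfn.
Hint Extern 0 (Df (fun _ => MEM _ _ _)) => apply Df_MEM; dfn : dfn.

(** * The generic real *)

Section Generic.
Context {M : structure} {HZ : ZF M}.

Lemma DfT_ray (t : (nat -> M) -> M) : DfT t -> DfT (fun e => ray (t e)).
Proof. by apply: DfT_fun1; rewrite /ray /sep; dfn. Qed.

(* At the node [r] it settles to [hat r]. *)
Definition gen : M := rep ratset (fun q => opair (hat q) (ray q)).

Lemma in_gen z : z ∈ gen <-> exists q, israt q /\ z = opair (hat q) (ray q).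
Proof.
rewrite in_rep; first by apply: Df_eq; [dfn|apply: DfT_opair; [dfn|apply: DfT_ray; dfn]].
by split=> -[q [hq ->]]; exists q; rewrite ?in_ratset in hq *.
Qed.

(** A defining formula for [gen], from which its preservation by elementary embeddings follows. *)
Definition Gen (g : nat) : fml :=
  All (FIff (FMem 0 (S g)) (exs 3 (FAnd (Rat 0) (FAnd (Hat 0 1) (FAnd (OPair 1 2 3)
    (All (FIff (FMem 0 3) (FAnd (Ded 0) (FMem 1 0))))))))).
Lemma sat_Gen (e : nat -> M) (g : nat) : sat e (Gen g) <-> e g = gen.
Proof.
rewrite /Gen; ssat.
have E z : (exists J y q : M, sat (q .: y .: J .: z .: e) (Rat 0) /\
      sat (q .: y .: J .: z .: e) (Hat 0 1) /\
      sat (q .: y .: J .: z .: e) (OPair 1 2 3) /\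
      (forall x, (x ∈ J -> sat (x .: q .: y .: J .: z .: e) (Ded 0) /\ q ∈ x) /\
       (sat (x .: q .: y .: J .: z .: e) (Ded 0) /\ q ∈ x -> x ∈ J))) <-> z ∈ gen.
{ rewrite in_gen; split=> [[J [y [q]]]|[q [hq ->]]].
  - rewrite sat_Rat sat_Hat sat_OPair /= => -[hq [-> [-> H]]].
    exists q; split=> //; congr opair; apply: ext => x; rewrite in_ray.
    by move: (H x); rewrite sat_Ded.
  - exists (ray q), (hat q), q; rewrite sat_Rat sat_Hat sat_OPair /=.
    do 3 (split; first by []); move=> x; apply: (iff_trans (in_ray q x)).
    by rewrite sat_Ded. }
split=> [h|-> z]; last exact: iff_sym (E z).
by apply: ext => z; apply: (iff_trans (h z)); exact: E.
Qed.

Lemma isterm_gen : isterm gen.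
Proof.
have D : Df (fun e : nat -> M => e 0 = hat (e 1)) by dfn.
exists (union (pair gen gen) (rep (tc ratset) hat)); split.
  by rewrite in_union in_pair; left; left.
move=> y; rewrite in_union in_pair in_rep // => -[hy|[u [hu ->]]] x.
- have -> : y = gen by case: hy.
  rewrite in_gen => -[q [hq ->]]; exists (ray q), (hat q); split=> //; split.
    rewrite in_union; right; rewrite in_rep //; exists q; split=> //.
    by apply: (tc_trans _ _ _ (tc_self _)); rewrite in_ratset.
  by left; exact: isopen_ray.
- rewrite in_hat => -[w [hw ->]]; exists RR, (hat w); split=> //; split.
    rewrite in_union; right; rewrite in_rep //; exists w; split=> //.
    by apply: tc_trans hw.
  by left; exact: isopen_RR.
Qed.

Lemma settle_gen r : isreal r -> settle r gen = hat r.
Proof.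
move=> hr; apply: ext => z; rewrite in_settle in_hat.
split=> [[u [j [+ [ha ->]]]]|[q [hq ->]]].
- rewrite in_gen => -[q [hq /opair_inj [Eu Ej]]]; subst u j.
  exists q; rewrite settle_hat //; split=> //.
  case: ha => [[_]|E]; first by rewrite in_ray => -[].
  have [_ [[[p [hp hpr]] _] _]] := hr.
  move: (hpr); rewrite -E in_ray => -[hpreal _].
  by case: (isreal_neq_israt p).
- exists (hat q), (ray q); rewrite in_gen settle_hat //; split.
    by exists q; split=> //; exact: (proj1 hr).
  split=> //; left; split; first exact: isopen_ray.
  by rewrite in_ray.
Qed.

Lemma MEM_gen r t : isreal r -> MEM r t gen <-> exists q, q ∈ r /\ EQ r t (hat q).
Proof.
move=> hr; rewrite MEM_iff; split=> [[u [j [+ [_ [hj h]]]]]|[q [hq h]]].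
- rewrite in_gen => -[q [hq /opair_inj [Eu Ej]]]; subst u j.
  by exists q; move: hj; rewrite in_ray => -[].
- exists (hat q), (ray q); rewrite in_gen; split; first by exists q; split=> //; exact: (proj1 hr).
  by split; [exact: isopen_ray|rewrite in_ray].
Qed.
End Generic.
Arguments gen {M HZ}.

(** * Elementary embeddings *)

Section Elementary.
Context {M N : structure} {HM : ZF M} {HN : ZF N}.
Variable F : M -> N.
Hypothesis HF : elementary F.
Implicit Types x y z a b p q r s t : M.

Lemma el_inj x y : F x = F y -> x = y.
Proof. by move=> E; apply/(HF (FEq 0 1) (x .: cst y)). Qed.
Lemma el_mem x y : F x ∈ F y <-> x ∈ y.
Proof. exact: iff_sym (HF (FMem 0 1) (x .: cst y)). Qed.
Lemma el_emp : F emp = emp.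
Proof. by generalize (HF (Empty 0) (cst emp)); rewrite !sat_Empty => -[-> //]. Qed.
Lemma el_succ x : F (succ x) = succ (F x).
Proof. by generalize (HF (Succ 0 1) (x .: cst (succ x))); rewrite !sat_Succ /= => -[-> //]. Qed.
Lemma el_opair x y : F (opair x y) = opair (F x) (F y).
Proof.
by generalize (HF (OPair 0 1 2) (x .: y .: cst (opair x y))); rewrite !sat_OPair /= => -[-> //].
Qed.
Lemma el_pair x y : F (pair x y) = pair (F x) (F y).
Proof.
by generalize (HF (UPair 0 1 2) (x .: y .: cst (pair x y))); rewrite !sat_UPair /= => -[-> //].
Qed.
Lemma el_isnat x : isnat (F x) <-> isnat x.
Proof. generalize (HF (Nat 0) (cst x)); rewrite !sat_Nat; exact: iff_sym. Qed.
(** The operation is given uniformly in all models, together with a formula that defines it in each,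
    so that one statement serves both addition and multiplication. *)
Lemma el_op (op : forall (X : structure) (HX : ZF X), X -> X -> X)
  (P : nat -> nat -> nat -> fml) a b :
  (forall (X : structure) (HX : ZF X) (e : nat -> X) (i j k : nat), isnat (e i) ->
     sat e (P i j k) <-> isnat (e j) /\ e k = op X HX (e i) (e j)) ->
  isnat a -> isnat b -> F (op M HM a b) = op N HN (F a) (F b).
Proof.
move=> HP ha hb; have ha' : isnat (F a) by rewrite el_isnat.
generalize (HF (P 0 1 2) (a .: b .: cst (op M HM a b))).
by rewrite !HP //= => -[[] //].
Qed.
Lemma el_israt q : israt (F q) <-> israt q.
Proof. generalize (HF (Rat 0) (cst q)); rewrite !sat_Rat; exact: iff_sym. Qed.
Lemma el_radd p q r : israt p -> israt q -> israt r ->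
  radd (F p) (F q) (F r) <-> radd p q r.
Proof.
move=> hp hq hr; generalize (HF (RatAdd 0 1 2) (p .: q .: cst r)).
rewrite !sat_RatAdd //= ?el_israt // => h; exact: iff_sym h.
Qed.
Lemma el_rpos q : rpos (F q) <-> rpos q.
Proof. generalize (HF (RatPos 0) (cst q)); rewrite !sat_RatPos; exact: iff_sym. Qed.
Lemma el_isreal x : isreal (F x) <-> isreal x.
Proof. generalize (HF (Ded 0) (cst x)); rewrite !sat_Ded; exact: iff_sym. Qed.
Lemma el_isopen x : isopen (F x) <-> isopen x.
Proof. generalize (HF (Open 0) (cst x)); rewrite !sat_Open; exact: iff_sym. Qed.
Lemma el_isterm x : isterm (F x) <-> isterm x.
Proof. generalize (HF (Term 0) (cst x)); rewrite !sat_Term; exact: iff_sym. Qed.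
Lemma el_hat x : F (hat x) = hat (F x).
Proof. by generalize (HF (Hat 0 1) (x .: cst (hat x))); rewrite !sat_Hat /= => -[-> //]. Qed.
Lemma el_gen : F gen = gen.
Proof. by generalize (HF (Gen 0) (cst gen)); rewrite !sat_Gen => -[-> //]. Qed.
Lemma el_EQ r s t : EQ (F r) (F s) (F t) <-> EQ r s t.
Proof. generalize (HF (AtEq 0 1 2) (r .: s .: cst t)); rewrite !sat_AtEq; exact: iff_sym. Qed.
Lemma el_feq J s t : feq (F J) (F s) (F t) <-> feq J s t.
Proof. generalize (HF (ForcesEq 0 1 2) (J .: s .: cst t)); rewrite !sat_ForcesEq; exact: iff_sym. Qed.
Lemma el_fmem J s t : fmem (F J) (F s) (F t) <-> fmem J s t.
Proof. generalize (HF (ForcesMem 0 1 2) (J .: s .: cst t)); rewrite !sat_ForcesMem; exact: iff_sym. Qed.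
Lemma el_above x q : isreal x -> israt q -> above (F x) (qval (F q)) <-> above x (qval q).
Proof.
move=> hx hq; generalize (HF (LtRat 0 1) (x .: cst q)).
rewrite !sat_LtRat //= ?el_isreal ?el_israt // => h; exact: iff_sym h.
Qed.
Lemma el_omega : F omega = omega.
Proof.
have h : sat (M := M) (cst omega) (All (FIff (FMem 0 1) (Nat 0))) by move=> w; exact: in_omega.
move: (proj1 (HF _ _) h) => H.
by apply: ext => z; rewrite in_omega; exact: (H z).
Qed.
(** The graph is characterised by a formula [A] in the parameter [a] alone, and elementarity
    transfers the characterisation. *)
Lemma el_rec_graph (op : forall (X : structure) (HX : ZF X), X -> X -> X)
  (P : nat -> nat -> nat -> fml) (a : M) :
  (forall (X : structure) (HX : ZF X) (e : nat -> X) (i j k : nat), isnat (e i) ->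
     sat e (P i j k) <-> isnat (e j) /\ e k = op X HX (e i) (e j)) ->
  (forall (X : structure) (HX : ZF X) (x : X), Df (fun e => e 0 = op X HX x (e 1))) ->
  isnat a -> F (rec_graph (op M HM a)) = rec_graph (op N HN (F a)).
Proof.
move=> HP D ha; have ha' : isnat (F a) by apply/el_isnat.
pose (A := All (FIff (FMem 0 1)
  (exs 2 (FAnd (Nat 0) (FAnd (P 4 0 1) (OPair 0 1 2)))))).
have E (X : structure) (HX : ZF X) (g b : X) : isnat b ->
    sat (g .: cst b) A <-> g = rec_graph (op X HX b).
{ move=> hb; rewrite /A; ssat.
  have E1 (z : X) : (exists v n : X, sat (n .: v .: z .: g .: cst b) (Nat 0) /\
      sat (n .: v .: z .: g .: cst b) (P 4 0 1) /\
      sat (n .: v .: z .: g .: cst b) (OPair 0 1 2)) <-> z ∈ rec_graph (op X HX b).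
    rewrite (in_rec_graph _ _ (D _ _ b)); split=> [[v [n]]|[n [hn ->]]].
      by rewrite sat_Nat HP //= sat_OPair /= => -[hn [[_ ->] ->]]; exists n.
    by exists (op X HX b n), n; rewrite sat_Nat HP //= sat_OPair.
  split=> [h|Eg z]; last by rewrite -Eg in E1; exact: iff_sym (E1 z).
  by apply: ext => z; apply: (iff_trans (h z)). }
have := proj1 (HF A (rec_graph (op M HM a) .: cst a)) (proj2 (E M HM _ _ ha) (erefl _)).
move=> h; apply/(E N HN _ _ ha'); apply: (proj1 (sat_ext A _ _ _) h); by case.
Qed.
End Elementary.

Lemma elementary_comp {M N P : structure} (F : M -> N) (G : N -> P) :
  elementary F -> elementary G -> elementary (fun x => G (F x)).
Proof. by move=> HF HG A e; rewrite (HF A e) (HG A). Qed.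

#[export] Existing Instance Mod_ZF.

(** * Infinitesimal closeness in consecutive models *)

Section Sequence.
Variable M : model_sequence.
Open Scope q_scope.
Implicit Types n : nat.

Lemma emb_el n : elementary (@emb M n).
Proof. exact: emb_elementary. Qed.

(** Although [c] lives in the next model, [iota 1 c] is an element of [M n] and can serve as a
    parameter there. *)
Lemma tail_mem_definable n (c : M (S n)) : Df (fun e => emb (e 0) ∈ c).
Proof.
have [dom [rel [em [p [iota [i0 H]]]]]] := Mod_tail_definable M n.
have h0 : numeral 0 (emp (M := M n)) by exact: emp_spec.
have h1 : numeral 1 (succ (emp (M := M n))).
  by exists emp; split; [exact: emp_spec|apply/is_succP].
have [_ [_ [_ H0]]] := H 0 _ h0; have [_ [Hd [Hr _]]] := H 1 _ h1.
(* The variable [y] stands for [iota 1 (emb (e 0))]. The numerals [emp] and [succ emp] index the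
   present model and the next one. *)
apply: (Df_iff (fun e => exists y, sat (y .: succ emp .: p) dom /\
  sat (e 0 .: y .: emp .: p) em /\ sat (y .: iota 1 c .: succ emp .: p) rel)).
  { move=> e; split=> [[y [/Hd [x <-] [+ /Hr +]]]|h].
  - by rewrite -(i0 (e 0)) => /H0; rewrite i0 => ->.
  - exists (iota 1 (emb (e 0))); split; first by apply/Hd; exists (emb (e 0)).
    by split; [rewrite -{1}(i0 (e 0)); apply/H0|apply/Hr]. }
by apply: Df_ex; apply: Df_and; last apply: Df_and; apply: Df_sat; repeat apply: DfT_scons;
  intros; dfn.
Qed.

(** The hypothesis on the sequence only says that [c] is not the image of an integer. A least
    integer [m] with image not below [c] exists by definability. It is not 0, and if it is a
    successor then [c] lies above the image of its predecessor, hence equals the image of [m] or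
    lies above it; both are excluded. *)
Lemma nonstandard n : exists c : M (S n), isnat c /\ forall k : M n, isnat k -> emb k ∈ c.
Proof.
have [c [hc nc]] := Mod_nonstandard M n; rewrite sat_Nat in hc.
exists c; split=> // k hk; apply: NNPP => hkc.
have DN : Df (fun e : nat -> M n => ~ emb (e 0) ∈ c).
  by apply: Df_not; exact: tail_mem_definable.
have [|m [hm [hmc least]]] := nat_least (fun k : M n => ~ emb k ∈ c) DN.
  by exists k.
have nc' (x : M n) : isnat x -> emb x <> c by move=> hx; apply: nc; rewrite sat_Nat.
case: (nat_case m hm) => [E|[j [hj E]]]; subst m.
- have E := el_emp _ (emb_el n); case: (emp_mem_nat c hc) => h.
  + by apply: (nc' emp); [exact: isnat0|rewrite E].
  + by apply: hmc; rewrite E.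
- have hjc : emb j ∈ c.
    by apply: NNPP; apply: least; rewrite in_succ; right.
  have hj' : isnat (emb j) by apply/(el_isnat _ (emb_el n)).
  have Ej := el_succ _ (emb_el n) j.
  move: hjc; rewrite mem_nat // => -[i [hi Ec]].
  case: (nat_case i hi) => [Ei|[i' [hi' Ei]]].
  + by apply: (nc' (succ j)); [exact: isnatS|rewrite Ec Ei Ej naddS // nadd0].
  + apply: hmc; rewrite Ej mem_nat //; auto.
    by exists i'; split=> //; rewrite Ec Ei naddSl ?(naddS _ (succ i')); auto.
Qed.

Lemma immediate_close n (r : M n) (s : M (S n)) : isreal r -> isreal s ->
  immediate M r s <-> forall q : M n, rpos q -> close (emb r) s (qval (emb q)).
Proof.
move=> hr hs; have hfr : isreal (emb r) by apply/(el_isreal _ (emb_el n)).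
have hq (q : M n) : rpos q -> israt (emb q).
  by move=> [h _]; apply/(el_israt _ (emb_el n)).
split=> [[d [Hd H]] q hpq|H].
- rewrite sat_RealSub //= in Hd.
  have Hq : sat (d .: cst (emb q)) (AbsLtRat 0 1) by apply: H; rewrite sat_RatPos.
  by rewrite (sat_AbsLtRat _ _ _ (emb r) s) //= in Hq; exact: hq.
- have [d Hd] := diff_exists _ _ hfr hs; exists d.
  split; first by rewrite sat_RealSub.
  move=> q; rewrite sat_RatPos => hpq.
  by rewrite (sat_AbsLtRat _ _ _ (emb r) s) //=; [exact: hq|exact: H].
Qed.

Lemma rpos_diff {X : structure} {HX : ZF X} (p q : X) : israt p -> israt q -> rlt p q ->
  exists r, rpos r /\ radd p r q.
Proof.
move=> hp hq h; have [r [hr E]] := israt_exists (qval q - qval p).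
exists r; split; first split=> //.
- by rewrite /rlt qval_rzero; apply: qlt_ext (proj1 (qlt_pos _ _) h); [apply: qeq_refl|symmetry].
- rewrite /radd; setoid_rewrite E; exact: qadd_sub.
Qed.

Lemma rpos_half {X : structure} {HX : ZF X} (q : X) : rpos q ->
  exists p, rpos p /\ radd p p q.
Proof.
rewrite /rpos /rlt qval_rzero => -[hq h]; have [p [hp E]] := israt_exists (qval q * qhalf).
exists p; split; first split=> //.
- by apply: qlt_ext (qpos_mul _ _ h qhalf_pos); [apply: qeq_refl|symmetry].
- rewrite /radd; setoid_rewrite E; exact: qhalf_add.
Qed.

(** Infinitesimality is tested against rationals of [M n]; the distance between two rationals of
    [M n] is one of them. *)
Lemma immediate_rlt n (r : M n) (s : M (S n)) (p q : M n) : isreal r -> isreal s ->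
  immediate M r s -> israt p -> israt q -> rlt p q ->
  close (emb r) s (qval (emb q) - qval (emb p)).
Proof.
move=> hr hs /(immediate_close _ _ _ hr hs) H hp hq hpq.
have [e [he hpe]] := rpos_diff _ _ hp hq hpq; have he' : israt e by case: he.
have E : qval (emb p) + qval (emb e) == qval (emb q).
  by apply/(el_radd _ (emb_el n) p e q hp he' hq).
apply: close_ext (H e he); symmetry; setoid_rewrite <- E; exact: qadd_subl.
Qed.

(** The cut [r] has no largest element, and the distance from [q] to a larger rational in [r]
    absorbs the infinitesimal error. *)
Lemma immediate_mem n (r : M n) (s : M (S n)) (q : M n) : isreal r -> isreal s ->
  immediate M r s -> q ∈ r -> emb q ∈ s.
Proof.
move=> hr hs hi hq; have hfr : isreal (emb r) by apply/(el_isreal _ (emb_el n)).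
have hq' := proj1 hr _ hq; have [p [hp hqp]] := proj1 (proj2 (proj2 hr)) _ hq.
have hp' := proj1 hr _ hp.
rewrite -inval_mem //; first by apply/(el_israt _ (emb_el n)).
apply: (close_inval _ _ _ _ hfr hs (immediate_rlt _ _ _ _ _ hr hs hi hq' hp' hqp)).
rewrite inval_mem //; [by apply/(el_israt _ (emb_el n))|by apply/(el_mem _ (emb_el n))].
Qed.

Lemma immediate_above n (r : M n) (s : M (S n)) (q : M n) : isreal r -> isreal s ->
  immediate M r s -> israt q -> above r (qval q) -> above s (qval (emb q)).
Proof.
move=> hr hs hi hq [u [huq hu]]; have hfr : isreal (emb r) by apply/(el_isreal _ (emb_el n)).
have [p [hp E]] := israt_exists u.
have hpq : rlt p q by apply: qlt_ext huq; [symmetry|apply: qeq_refl].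
apply: (close_above _ _ _ _ hfr hs (immediate_rlt _ _ _ _ _ hr hs hi hp hq hpq)).
have hfp : israt (emb p) by apply/(el_israt _ (emb_el n)).
rewrite inval_mem // (el_mem _ (emb_el n)) -inval_mem // => h; apply: hu.
exact: inval_ext h.
Qed.

Lemma immediate_open n (r : M n) (s : M (S n)) (J : M n) : isreal r -> isreal s ->
  immediate M r s -> isopen J -> r ∈ J -> s ∈ emb J.
Proof.
move=> hr hs hi [_ hJ] hrJ; have [p [q [hp [hq [hpr [hqr H]]]]]] := hJ r hrJ.
have hfp : israt (emb p) by apply/(el_israt _ (emb_el n)).
have hfq : israt (emb q) by apply/(el_israt _ (emb_el n)).
(* [A] says that the interval from [p] to [q] is contained in [J]. Elementarity carries it to
   [emb J], and [s] lies in the image interval. *)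
pose (A := All (FImp (Ded 0) (FImp (FMem 1 0) (FImp (LtRat 0 2) (FMem 0 3))))).
have HA : sat (p .: q .: cst J) A.
  rewrite /A; ssat => y; rewrite sat_Ded /= => hy hpy; rewrite sat_LtRat //= => hyq.
  exact: H.
move: (proj1 (emb_el n A _) HA); rewrite /A; ssat => /(_ s).
rewrite sat_Ded sat_LtRat //=; apply=> //.
- exact: (immediate_mem _ _ _ _ hr hs hi hpr).
- exact: (immediate_above _ _ _ _ hr hs hi hq hqr).
Qed.

(** [close_nbhd] is applied in the next model with the radius [1 / (c + 1)] for an integer [c] above
    all integers of [M n]; every positive rational of [M n] exceeds twice this radius. *)
Lemma immediate_nbhd n (r : M n) : isreal r -> exists J : M (S n), isopen J /\ emb r ∈ J /\
  forall s, s ∈ J -> immediate M r s.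
Proof.
move=> hr; have hfr : isreal (emb r) by apply/(el_isreal _ (emb_el n)).
have [c [hc Hc]] := nonstandard n.
have [J [hJ [hrJ H]]] := close_nbhd _ (qinv (mkN c hc)) hfr (qinv_pos _).
exists J; split=> //; split=> // s hs; have hsr := proj1 hJ s hs.
apply/(immediate_close _ _ _ hr hsr) => q hq; apply: H => //.
(* [close_nbhd] bounds distances by twice the radius, hence the passage to half of [q]. *)
have [p [hp hpq]] := rpos_half _ hq.
have [hp' hq'] : israt p /\ israt q by case: hp; case: hq.
have E := proj2 (el_radd _ (emb_el n) _ _ _ hp' hp' hq') hpq.
have hfp : q0 < qval (emb p).
  by rewrite -qval_rzero; apply: (proj2 (proj2 (el_rpos _ (emb_el n) p) hp)).
have h : qinv (mkN c hc) < qval (emb p).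
  apply: qinv_below_den => //; apply/N_lt_mem => /=.
  (* The denominator of [emb p] is the image of the denominator of [p], an integer of [M n], and is
     therefore below [c]. *)
  have -> : sval (qd (qval (emb p))) = emb (sval (qd (qval p))).
    have Ep := repE _ (proj2 (el_israt _ (emb_el n) p) hp').
    move: (f_equal emb (repE _ hp')); rewrite !(el_opair _ (emb_el n)) {1}Ep.
    rewrite /qc /= !(naddS _ emp) ?nadd0 //.
    by rewrite (el_succ _ (emb_el n)) => /opair_inj [_ /opair_inj [_ /succ_inj]].
  by apply: Hc; exact: (proj2_sig (qd (qval p))).
apply: qlt_ext (qlt_add _ _ _ _ h h); [exact: qeq_refl|exact: E].
Qed.
End Sequence.

Set Implicit Arguments.
Unset Strict Implicit.
(** * The Kripke model *)

Section Transitions.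
Context {M : model_sequence}.

Lemma is_realE n (r : M n) : is_real M r <-> isreal r.
Proof. by rewrite /is_real sat_Ded. Qed.
Lemma is_termE n (t : M n) : is_term M t <-> isterm t.
Proof. by rewrite /is_term sat_Term. Qed.

Lemma step_real n (r : M n) (s : M (S n)) k : step M r s k -> isreal s /\ immediate M r s.
Proof. by case=> [|g] /is_realE. Qed.
Lemma step_cases n (r : M n) (s : M (S n)) k : step M r s k ->
  (forall t, isterm t -> k t = emb t) \/ (forall t, isterm t -> k t = settle s (emb t)).
Proof.
case=> [_ _|g _ _ H]; [by left|right=> t /is_termE /H].
by rewrite sat_Settle.
Qed.

(* On names [hat x] a transition function [h] acts as an elementary embedding [F]. *)
Record good n (r : M n) m (s : M m) (h F : M n -> M m) : Prop := {
  good_transition : transition M r m s h;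
  good_real : isreal s;
  good_el : elementary F;
  good_term : forall t, isterm t -> isterm (h t);
  good_hat : forall x, h (hat x) = hat (F x);
  good_EQ : forall t u, isterm t -> isterm u -> EQ r t u -> EQ s (h t) (h u);
  good_MEM : forall t u, isterm t -> isterm u -> MEM r t u -> MEM s (h t) (h u);
  good_gen : h gen = gen \/ exists x, isreal x /\ h gen = hat x /\
    forall q, israt q -> above r (qval q) -> above x (qval (F q));
  good_above : forall q, israt q -> above r (qval q) -> above s (qval (F q)) }.

Lemma good_id n (r : M n) : isreal r -> good r r (fun t => t) (fun t => t).
Proof.
move=> hr; constructor=> //; first exact: transition_id.
by left.
Qed.

Lemma good_isnat n (r : M n) m (s : M m) h F x : good r s h F -> isnat x -> isnat (F x).
Proof. by move=> G hx; apply/(el_isnat F (good_el G)). Qed.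

(** An open set forcing a relation at [s] has an image that contains every immediate successor, so
    [emb] preserves equality and membership. For the settling function, the clauses on settled names
    turn forced relations into literal ones. It takes [gen] to [hat s']; later steps act on that
    name as on any other [hat x]. *)
Lemma good_step n (r : M n) m (s : M m) (h F : M n -> M m) (s' : M (S m)) k :
  good r s h F -> step M s s' k ->
  good r s' (fun t => k (h t)) (fun t => emb (F t)).
Proof.
move=> G K; have [hs' hi] := step_real K.
have [tr hs el term hhat hEQ hMEM hgen habove] := G.
have emb_EQ t u : EQ s t u -> EQ s' (emb t) (emb u).
  move=> [J [hJ [hsJ hf]]]; exists (emb J).
  split; first by apply/(el_isopen _ (emb_el M m)).
  split; first exact: immediate_open hi hJ hsJ.
  by apply/(el_feq _ (emb_el M m)).
have emb_MEM t u : MEM s t u -> MEM s' (emb t) (emb u).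
  move=> [J [hJ [hsJ hf]]]; exists (emb J).
  split; first by apply/(el_isopen _ (emb_el M m)).
  split; first exact: immediate_open hi hJ hsJ.
  by apply/(el_fmem _ (emb_el M m)).
have khat x : k (hat x) = hat (emb x).
  have ht : isterm (hat x) by exact: isterm_hat.
  case: (step_cases K) => ->  //; rewrite (el_hat _ (emb_el M m)) //.
  by rewrite settle_hat.
constructor=> //.
- exact: transition_step tr K.
- by apply: elementary_comp el _; exact: emb_el.
- move=> t /term ht; case: (step_cases K) => -> //.
  + by apply/(el_isterm _ (emb_el M m)).
  + exact: isterm_settle.
- by move=> x; rewrite hhat khat.
- move=> t u ht hu /(hEQ _ _ ht hu) E.
  have ht' := term _ ht; have hu' := term _ hu.
  case: (step_cases K) => Ek; rewrite !Ek //; first exact: emb_EQ.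
  by rewrite (EQ_settle _ _ _ (emb_EQ _ _ E)); apply: EQ_refl.
- move=> t u ht hu /(hMEM _ _ ht hu) E.
  have ht' := term _ ht; have hu' := term _ hu.
  case: (step_cases K) => Ek; rewrite !Ek //; first exact: emb_MEM.
  apply: MEM_pair (MEM_settle _ _ _ (emb_MEM _ _ E)) _ _ => //; first exact: isopen_RR.
  by rewrite in_RR.
- case: hgen => [->|[x [hx [-> hax]]]]; last first.
    right; exists (emb x); rewrite khat; split; first by apply/(el_isreal _ (emb_el M m)).
    split=> // q hq /(hax _ hq) h1; apply/(el_above _ (emb_el M m)) => //.
    by apply/(el_israt _ el).
  have ht : isterm (gen (M := M m)) by exact: isterm_gen.
  case: (step_cases K) => -> //; rewrite (el_gen _ (emb_el M m)); first by left.
  right; exists s'; rewrite settle_gen //; do 2 (split=> //).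
  move=> q hq /(habove _ hq); apply: immediate_above hi _ => //.
  by apply/(el_israt _ el).
- move=> q hq /(habove _ hq); apply: immediate_above hi _ => //.
  by apply/(el_israt _ el).
Qed.

Lemma transition_good n (r : M n) m (s : M m) h : isreal r -> transition M r m s h ->
  exists F, good r s h F.
Proof.
move=> hr; elim=> [|m' s0 h0 s' k tr [F G] K].
- by exists (fun t => t); exact: good_id.
- by exists (fun t => emb (F t)); apply: good_step G K.
Qed.

Lemma transition_comp n (r : M n) m (s : M m) h m' (s' : M m') h' :
  transition M r m s h -> transition M s m' s' h' ->
  transition M r m' s' (fun t => h' (h t)).
Proof.
move=> tr; elim=> [//|m1 s1 h1 s2 k tr1 IH K].
exact: (transition_step M r m1 s1 (fun t => h1 (h t)) s2 k IH K).
Qed.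

Lemma step_emb n (r : M n) s : isreal s -> immediate M r s -> step M r s emb.
Proof. by move=> hs; apply: step_f; apply/is_realE. Qed.
Lemma step_settle n (r : M n) s : isreal s -> immediate M r s ->
  step M r s (fun t => settle s (emb t)).
Proof.
move=> hs hi; apply: step_g => //; first by apply/is_realE.
by move=> t _; rewrite sat_Settle.
Qed.
Lemma transition1 n (r : M n) s k : step M r s k -> transition M r (S n) s k.
Proof. by move=> K; apply: (transition_step M r n r (fun t => t) s k (transition_id M r)). Qed.

(* If [EQ r t u] failed at [r], then by elementarity [agree] would fail at a real
   [s] infinitesimally close to [r]; there [emb] tests the members of the names
   and the settling transition function tests [t^s = u^s]. *)
Lemma EQ_ext n (r t u : M n) : isreal r -> isterm t -> isterm u ->
  (forall m s h, transition M r m s h ->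
     forall w, isterm w -> MEM s w (h t) <-> MEM s w (h u)) -> EQ r t u.
Proof.
move=> hr ht hu H.
have [J [hJ [hrJ HJ]]] := immediate_nbhd M n r hr.
apply/(el_EQ _ (emb_el M n)); apply/EQ_iff; exists J; do 2 (split=> //).
move=> s hsJ; have hs := proj1 hJ s hsJ; have hi := HJ s hsJ.
have ht' : isterm (emb t) by apply/(el_isterm _ (emb_el M n)).
have hu' : isterm (emb u) by apply/(el_isterm _ (emb_el M n)).
have Hf := H _ s emb (transition1 (step_emb hs hi)).
have Hg := H _ s _ (transition1 (step_settle hs hi)).
split; last split.
- move=> w j hw hj hsj; apply/Hf; first exact: isterm_mem hw.
  exact: MEM_pair hw hj hsj.
- move=> w j hw hj hsj; apply/Hf; first exact: isterm_mem hw.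
  exact: MEM_pair hw hj hsj.
- have hR : isopen (RR (M := M (S n))) by exact: isopen_RR.
  have sR : s ∈ RR by rewrite in_RR.
  apply: ext => z; split=> hz; move: (hz); rewrite in_settle => -[w [j [hw [ha Ez]]]]; subst z.
  (* The settled member is tested as a name of its own. Since [settle] fixes settled names,
     membership in the settled [u] gives back the very pair that is sought. *)
  + have : MEM s (settle s w) (settle s (emb t)) by apply: MEM_pair hz _ _.
    move=> /(proj1 (Hg _ (isterm_settle _ _))) /MEM_settle.
    by rewrite !settle_settle.
  + have : MEM s (settle s w) (settle s (emb u)) by apply: MEM_pair hz _ _.
    move=> /(proj2 (Hg _ (isterm_settle _ _))) /MEM_settle.
    by rewrite !settle_settle.
Qed.
End Transitions.
#[global] Opaque EQ MEM.

Arguments ksat : simpl never.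

(** * Rules for satisfaction at nodes *)

Section KripkeLogic.
Context {M : model_sequence}.
Implicit Types n m : nat.

Definition terms n (e : nat -> M n) : Prop := forall i, isterm (e i).

Lemma terms_scons n (t : M n) (e : nat -> M n) : isterm t -> terms e -> terms (t .: e).
Proof. by move=> ht he [|i] /=. Qed.
Lemma terms_hat n x (e : nat -> M n) : terms e -> terms (hat x .: e).
Proof. by apply: terms_scons; exact: isterm_hat. Qed.
Lemma terms_good n (r : M n) m (s : M m) h F e : good r s h F -> terms e ->
  terms (fun i => h (e i)).
Proof. by move=> G he i; apply: (good_term G). Qed.

Lemma ksat_mem n (r : M n) e i j : ksat M (FMem i j) r e <-> MEM r (e i) (e j).
Proof. by rewrite /ksat sat_AtMem. Qed.
Lemma ksat_eq n (r : M n) e i j : ksat M (FEq i j) r e <-> EQ r (e i) (e j).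
Proof. by rewrite /ksat sat_AtEq. Qed.
Lemma ksat_bot n (r : M n) e : ~ ksat M FBot r e.
Proof. by []. Qed.
Lemma ksat_and n (r : M n) e A B : ksat M (FAnd A B) r e <-> ksat M A r e /\ ksat M B r e.
Proof. by []. Qed.
Lemma ksat_or n (r : M n) e A B : ksat M (FOr A B) r e <-> ksat M A r e \/ ksat M B r e.
Proof. by []. Qed.
Lemma ksat_imp n (r : M n) e A B : ksat M (FImp A B) r e <->
  forall m (s : M m) h, transition M r m s h ->
    ksat M A s (fun i => h (e i)) -> ksat M B s (fun i => h (e i)).
Proof. by []. Qed.
Lemma ksat_all n (r : M n) e A : ksat M (All A) r e <->
  forall m (s : M m) h, transition M r m s h ->
    forall t, isterm t -> ksat M A s (t .: fun i => h (e i)).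
Proof.
by split=> H m s h tr t ht; apply: (H m s h tr t); apply/is_termE.
Qed.
Lemma ksat_ex n (r : M n) e A : ksat M (Ex A) r e <->
  exists t, isterm t /\ ksat M A r (t .: e).
Proof.
by split=> -[t [ht H]]; exists t; split=> //; apply/is_termE.
Qed.

(** Transition functions preserve equality of names, so satisfaction on representatives is well
    defined on the quotient by [=_M]. *)
Lemma ksat_congr A n (r : M n) e e' : isreal r -> terms e -> terms e' ->
  (forall i, EQ r (e i) (e' i)) -> ksat M A r e -> ksat M A r e'.
Proof.
elim: A n r e e' => [i j|i j||A IA B IB|A IA B IB|A IA B IB|A IA|A IA] n r e e' hr he he' E.
- rewrite !ksat_mem => h; exact: MEM_extl (E i) (MEM_extr _ _ _ _ (E j) h).
- rewrite !ksat_eq => h; apply: EQ_trans (E j); apply: EQ_trans h; exact: EQ_sym.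
- by [].
- by rewrite !ksat_and => -[/(IA _ _ _ _ hr he he' E) ? /(IB _ _ _ _ hr he he' E) ?].
- rewrite !ksat_or => -[/(IA _ _ _ _ hr he he' E) ?|/(IB _ _ _ _ hr he he' E) ?]; tauto.
- rewrite !ksat_imp => H m s h tr hA; have [F G] := transition_good hr tr.
  have hs := good_real G.
  have th := terms_good G he; have th' := terms_good G he'.
  have E' i : EQ s (h (e i)) (h (e' i)) by apply: (good_EQ G).
  apply: (IB m s _ _ hs th th' E'); apply: (H m s h tr).
  by apply: (IA m s _ _ hs th' th) hA => i; exact: EQ_sym.
- rewrite !ksat_all => H m s h tr t ht; have [F G] := transition_good hr tr.
  have hs := good_real G.
  have th := terms_good G he; have th' := terms_good G he'.
  apply: (IA m s _ _ hs (terms_scons ht th) (terms_scons ht th')) (H m s h tr t ht).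
  case=> [|i] /=; first exact: EQ_refl.
  by apply: (good_EQ G).
- rewrite !ksat_ex => -[t [ht H]]; exists t; split=> //.
  apply: (IA n r _ _ hr (terms_scons ht he) (terms_scons ht he')) H.
  by case=> [|i] /=; [exact: EQ_refl|].
Qed.
Lemma ksat_ext A n (r : M n) e e' : isreal r -> terms e -> (forall i, e i = e' i) ->
  ksat M A r e -> ksat M A r e'.
Proof.
move=> hr he E; apply: ksat_congr => //.
- by move=> i; rewrite -E.
- by move=> i; rewrite E; exact: EQ_refl.
Qed.

Lemma ksat_mono A n (r : M n) m (s : M m) h e : isreal r -> terms e ->
  transition M r m s h -> ksat M A r e -> ksat M A s (fun i => h (e i)).
Proof.
elim: A n r m s h e => [i j|i j||A IA B IB|A IA B IB|A IA B IB|A IA|A IA] n r m s h e hr he tr;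
  have [F G] := transition_good hr tr.
- by rewrite !ksat_mem; apply: (good_MEM G).
- by rewrite !ksat_eq; apply: (good_EQ G).
- by [].
- by rewrite !ksat_and => -[/(IA _ _ _ _ _ _ hr he tr) ? /(IB _ _ _ _ _ _ hr he tr) ?].
- rewrite !ksat_or => -[/(IA _ _ _ _ _ _ hr he tr) ?|/(IB _ _ _ _ _ _ hr he tr) ?]; tauto.
- rewrite !ksat_imp => H m' s' h' tr'.
  exact: (H m' s' (fun t => h' (h t)) (transition_comp tr tr')).
- rewrite !ksat_all => H m' s' h' tr'.
  exact: (H m' s' (fun t => h' (h t)) (transition_comp tr tr')).
- rewrite !ksat_ex => -[t [ht H]]; exists (h t).
  split; first exact: (good_term G).
  apply: ksat_ext (IA _ _ _ _ _ _ hr (terms_scons ht he) tr H).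
  + exact: (good_real G).
  + apply: (terms_good G); exact: terms_scons.
  + by case.
Qed.

Lemma ksat_mp n (r : M n) e A B : ksat M (FImp A B) r e -> ksat M A r e -> ksat M B r e.
Proof. by rewrite ksat_imp => /(_ n r (fun t => t) (transition_id M r)). Qed.
Lemma ksat_inst n (r : M n) e A t : ksat M (All A) r e -> isterm t -> ksat M A r (t .: e).
Proof. by rewrite ksat_all => /(_ n r (fun t => t) (transition_id M r) t). Qed.

(** Each quantifier brings a transition of its own. Their composite is again [good], so a whole
    block is handled by one transition, with the new values in the first [k] places of [e']. *)
Lemma ksat_alls k A n (r : M n) e : isreal r -> terms e ->
  (forall m (s : M m) h F (e' : nat -> M m), good r s h F -> terms e' ->
     (forall i, e' (k + i) = h (e i)) -> ksat M A s e') ->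
  ksat M (alls k A) r e.
Proof.
elim: k n r e => [|k IH] n r e hr he H /=.
  exact: (H n r _ _ e (good_id hr) he).
rewrite ksat_all => m s h tr t ht; have [F G] := transition_good hr tr.
apply: IH; first exact: (good_real G).
  by apply: terms_scons => //; exact: (terms_good G he).
move=> m' s' h' F' e' G' he' E.
have tr' := transition_comp tr (good_transition G').
have [F'' G''] := transition_good hr tr'.
apply: (H m' s' _ F'' e' G'' he') => i.
by rewrite Nat.add_succ_comm E.
Qed.

Lemma ksat_exs k A n (r : M n) e : isreal r -> terms e ->
  ksat M (exs k A) r e <->
  exists e', terms e' /\ (forall i, e' (k + i) = e i) /\ ksat M A r e'.
Proof.
elim: k n r e => [|k IH] n r e hr he /=.
  split=> [h|[e' [he' [E h]]]]; first by exists e.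
  exact: ksat_ext h.
rewrite ksat_ex; split=> [[t [ht]]|[e' [he' [E h]]]].
- rewrite IH //; first exact: terms_scons.
  move=> [e' [he' [E h]]]; exists e'; split=> //; split=> // i.
  by move: (E (S i)); rewrite Nat.add_succ_r.
- exists (e' k); split=> //; rewrite IH //; first exact: terms_scons.
  exists e'; split=> //; split=> // -[|i] /=; first by rewrite Nat.add_0_r.
  by rewrite Nat.add_succ_r E.
Qed.

Fixpoint fimps (l : list fml) (B : fml) : fml :=
  match l with nil => B | cons A l => FImp A (fimps l B) end.
Fixpoint ksats (l : list fml) n (r : M n) (e : nat -> M n) : Prop :=
  match l with nil => True | cons A l => ksat M A r e /\ ksats l r e end.

(** A premise established at an intermediate node persists to the last one, so all premises may be
    assumed at a single node. *)
Lemma ksat_fimps l B n (r : M n) e : isreal r -> terms e ->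
  (forall m (s : M m) h F, good r s h F -> ksats l s (fun i => h (e i)) ->
     ksat M B s (fun i => h (e i))) -> ksat M (fimps l B) r e.
Proof.
elim: l n r e => [|A l IH] n r e hr he H /=.
  exact: (H n r _ _ (good_id hr)).
rewrite ksat_imp => m s h tr hA; have [F G] := transition_good hr tr.
apply: IH; first exact: (good_real G).
  exact: (terms_good G he).
move=> m' s' h' F' G' hl; have tr' := good_transition G'.
have [F'' G''] := transition_good hr (transition_comp tr tr').
apply: (H m' s' (fun t => h' (h t)) F'' G''); split=> //.
apply: (ksat_mono _ _ tr' hA).
- exact: (good_real G).
- exact: (terms_good G he).
Qed.

Lemma ksat_alls_fimps k l B n (r : M n) e : isreal r -> terms e ->
  (forall m (s : M m) h F (e' : nat -> M m), good r s h F -> terms e' ->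
     (forall i, e' (k + i) = h (e i)) -> ksats l s e' -> ksat M B s e') ->
  ksat M (alls k (fimps l B)) r e.
Proof.
move=> hr he H; apply: ksat_alls => // m s h F e' G he' E.
apply: ksat_fimps => //; first exact: (good_real G).
move=> m' s' h' F' G'.
have tr' := transition_comp (good_transition G)
  (good_transition G').
have [F'' G''] := transition_good hr tr'.
apply: (H m' s' _ F'' _ G''); first exact: (terms_good G' he').
by move=> i; rewrite E.
Qed.

Lemma ksat_iff_elim n (r : M n) e A B t : ksat M (All (FIff A B)) r e -> isterm t ->
  ksat M A r (t .: e) <-> ksat M B r (t .: e).
Proof.
move=> H ht; have := ksat_inst H ht; rewrite /FIff ksat_and => -[h1 h2].
by split; apply: ksat_mp.
Qed.
Lemma ksat_iff_intro n (r : M n) e A B : isreal r -> terms e ->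
  (forall m (s : M m) h F t, good r s h F -> isterm t ->
     ksat M A s (t .: fun i => h (e i)) <-> ksat M B s (t .: fun i => h (e i))) ->
  ksat M (All (FIff A B)) r e.
Proof.
move=> hr he H; apply: (ksat_alls (k := 1)) => // m s h F e' G he' E.
have hs := good_real G.
rewrite /FIff ksat_and; split; rewrite ksat_imp => m' s' h' tr'.
all: have tr := transition_comp (good_transition G) tr'.
all: have [F' G'] := transition_good hr tr.
all: have [F'' G''] := transition_good hs tr'.
all: have ht := terms_good G'' he'.
all: have hs' := good_real G'.
all: have he2 := terms_scons (ht 0) (terms_good G' he).
all: have E2 i : h' (e' i) = (h' (e' 0) .: fun i => h' (h (e i))) i
  by case: i => [|i] //=; rewrite -E.
all: move=> /(ksat_ext hs' ht E2) /(H _ _ _ F' _ G' (ht 0)) h2.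
all: by apply: ksat_ext h2.
Qed.

(* An inductive wrapper, so that conversion never unfolds it *)
Variant ck n (r t x : M n) : Prop := Ck (_ : EQ r t (hat x)).

Lemma ckE n (r t x : M n) : ck r t x <-> EQ r t (hat x).
Proof. by split=> [[]|h]; [|exact: Ck]. Qed.
Lemma ck_good n (r : M n) m (s : M m) h F t x : good r s h F -> isterm t -> ck r t x ->
  ck s (h t) (F x).
Proof.
move=> G ht [E]; apply: Ck; rewrite -(good_hat G).
by apply: (good_EQ G) => //; exact: isterm_hat.
Qed.
Lemma ck_hat n (r x : M n) : isreal r -> ck r (hat x) x.
Proof. by move=> hr; apply: Ck; exact: EQ_refl. Qed.
Lemma ck_fun n (r t x y : M n) : isreal r -> ck r t x -> ck r t y -> x = y.
Proof.
move=> hr [hx] [hy]; apply: (proj1 (EQ_hat r x y hr)).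
exact: EQ_trans (EQ_sym _ _ _ hx) hy.
Qed.
Lemma ck_mem n (r t u x : M n) : isreal r -> ck r u x ->
  MEM r t u <-> exists y, y ∈ x /\ ck r t y.
Proof.
move=> hr [hu].
split=> [/(MEM_extr _ _ _ _ hu)|[y [hy [h]]]].
- by rewrite MEM_hat // => -[y [hy h]]; exists y; split=> //; exact: Ck.
- by apply: (MEM_extr _ _ _ _ (EQ_sym _ _ _ hu)); apply/(MEM_hat r t x hr); exists y.
Qed.
Lemma ck_meml n (r t u y : M n) : ck r t y -> MEM r t u <-> MEM r (hat y) u.
Proof.
by move=> [h]; split; [exact: MEM_extl h|exact: (MEM_extl _ _ _ _ (EQ_sym _ _ _ h))].
Qed.
Lemma ck_mem2 n (r t u x y : M n) : isreal r -> ck r t y -> ck r u x ->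
  MEM r t u <-> y ∈ x.
Proof.
move=> hr ht hu; rewrite (ck_mem _ hr hu).
split=> [[z [hz h]]|h]; last by exists y.
by rewrite (ck_fun hr ht h).
Qed.
Lemma ck_eq n (r t u x : M n) : ck r u x -> EQ r t u <-> ck r t x.
Proof.
move=> [h]; split=> [h'|[h']]; first by apply: Ck; exact: EQ_trans h' h.
exact: EQ_trans h' (EQ_sym _ _ _ h).
Qed.

(** Extensionality in the form used for absoluteness: a name whose members are prescribed by [B]
    denotes [X] as soon as, at all later nodes, [B] describes exactly the members of the image of
    [X]. The passage from members to equality is [EQ_ext]. *)
Lemma ksat_char n (r : M n) e y B X : isreal r -> terms e ->
  (forall m (s : M m) h F t, good r s h F -> isterm t ->
     ksat M B s (t .: fun i => h (e i)) <-> exists z, z ∈ F X /\ ck s t z) ->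
  ksat M (All (FIff (FMem 0 (S y)) B)) r e <-> ck r (e y) X.
Proof.
move=> hr he H; split=> h.
- apply: Ck; apply: EQ_ext => //; first exact: isterm_hat.
  move=> m s h' tr w hw; have [F G] := transition_good hr tr.
  have hs := good_real G.
  rewrite (good_hat G) (ck_mem _ hs (ck_hat _ hs)) -(H _ _ _ _ _ G hw).
  have := ksat_iff_elim (ksat_mono hr he tr h) hw.
  by rewrite ksat_mem.
- apply: ksat_iff_intro => // m s h' F t G ht.
  have hs := good_real G.
  rewrite (H _ _ _ _ _ G ht) ksat_mem /=.
  exact: ck_mem (ck_good G (he y) h).
Qed.
End KripkeLogic.
#[global] Opaque ksat.
Arguments ksat_fimps {M} l B {n r e}.
Arguments ksat_alls_fimps {M} k l B {n r e}.

(** * Absoluteness of arithmetic *)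

Section Absoluteness.
Context {M : model_sequence}.
Implicit Types n m : nat.

Lemma ksat_Empty n (r : M n) e x : isreal r -> terms e ->
  ksat M (Empty x) r e <-> ck r (e x) emp.
Proof.
move=> hr he; split=> h.
- apply/(ksat_char x hr he).
    move=> m s h' F t G ht; rewrite (el_emp F (good_el G)).
    by split=> [/ksat_bot|[z [/in_emp]]].
  apply: ksat_iff_intro => // m s h' F t G ht; split=> [hA|/ksat_bot //].
  have hm := ksat_mono hr he (good_transition G) h.
  exact: ksat_mp (@ksat_inst _ _ _ _ _ t hm ht) hA.
- apply: (ksat_alls_fimps 1 (FMem 0 (S x) :: nil) FBot) => //.
  move=> m s h' F e' G he' E [+ _]; rewrite ksat_mem (E x).
  have hs := good_real G.
  rewrite (ck_mem _ hs (ck_good G (he x) h)).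
  by rewrite (el_emp F (good_el G)) => -[z [/in_emp]].
Qed.

Lemma ksat_UPair n (r : M n) e x y p a b : isreal r -> terms e ->
  ck r (e x) a -> ck r (e y) b ->
  ksat M (UPair x y p) r e <-> ck r (e p) (pair a b).
Proof.
move=> hr he ha hb; apply: ksat_char => // m s h F t G ht.
have hs := good_real G.
rewrite ksat_or !ksat_eq /= (ck_eq _ (ck_good G (he x) ha)).
rewrite (ck_eq _ (ck_good G (he y) hb)).
rewrite (el_pair F (good_el G)).
split=> [[k|k]|[z [+ k]]]; last by rewrite in_pair => -[<-|<-]; [left|right].
- by exists (F a); rewrite in_pair; split; [left|].
- by exists (F b); rewrite in_pair; split; [right|].
Qed.
Lemma ksat_Succ n (r : M n) e x y a : isreal r -> terms e ->
  ck r (e x) a -> ksat M (Succ x y) r e <-> ck r (e y) (succ a).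
Proof.
move=> hr he ha; apply: ksat_char => // m s h F t G ht.
have hs := good_real G.
have ha' := ck_good G (he x) ha.
rewrite ksat_or ksat_mem ksat_eq /= (ck_eq _ ha') (ck_mem _ hs ha').
rewrite (el_succ F (good_el G)).
split=> [[[z [hz k]]|k]|[z [+ k]]].
- by exists z; rewrite in_succ; split; [left|].
- by exists (F a); rewrite in_succ; split; [right|].
- by rewrite in_succ => -[hz|<-]; [left; exists z|right].
Qed.
Lemma ksat_UPair_mem n (r : M n) e x y p : isreal r -> terms e ->
  ksat M (UPair x y p) r e -> MEM r (e x) (e p) /\ MEM r (e y) (e p).
Proof.
move=> hr he h; split.
- have := ksat_iff_elim h (he x); rewrite ksat_mem ksat_or !ksat_eq /= => ->.
  by left; exact: EQ_refl.
- have := ksat_iff_elim h (he y); rewrite ksat_mem ksat_or !ksat_eq /= => ->.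
  by right; exact: EQ_refl.
Qed.

Lemma ksat_OPair n (r : M n) e x y p a b : isreal r -> terms e ->
  ck r (e x) a -> ck r (e y) b ->
  ksat M (OPair x y p) r e <-> ck r (e p) (opair a b).
Proof.
move=> hr he ha hb; rewrite /OPair ksat_exs //.
split=> [[e' [he' [E]]]|h].
- have ha' : ck r (e' (2 + x)) a by rewrite E.
  have hb' : ck r (e' (2 + y)) b by rewrite E.
  rewrite !ksat_and (ksat_UPair _ hr he' ha' ha') (ksat_UPair _ hr he' ha' hb') => -[h1 [h2]].
  by rewrite (ksat_UPair _ hr he' h1 h2) E.
- set e' := hat (pair a a) .: hat (pair a b) .: e.
  have he' : terms e' by do 2 apply: terms_hat.
  exists e'; split=> //; split=> //.
  have ha' : ck r (e' (2 + x)) a by [].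
  have hb' : ck r (e' (2 + y)) b by [].
  rewrite !ksat_and (ksat_UPair _ hr he' ha' ha') (ksat_UPair _ hr he' ha' hb').
  have h1 : ck r (e' 0) (pair a a) by exact: ck_hat.
  have h2 : ck r (e' 1) (pair a b) by exact: ck_hat.
  by do 2 (split=> //); rewrite (ksat_UPair _ hr he' h1 h2).
Qed.
(** The components of a pair are members of its members. In a name of a ground-model set, all of
    these are equal to names [hat a]. *)
Lemma ksat_OPair_inv n (r : M n) e x y p c : isreal r -> terms e ->
  ck r (e p) c -> ksat M (OPair x y p) r e ->
  exists a b, c = opair a b /\ ck r (e x) a /\ ck r (e y) b.
Proof.
move=> hr he hc h; have := h; rewrite {1}/OPair ksat_exs // => -[e' [he' [E]]].
rewrite !ksat_and => -[/(ksat_UPair_mem hr he') [m1 _]].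
move=> [/(ksat_UPair_mem hr he') [_ m2]].
move=> /(ksat_UPair_mem hr he') [m3 m4].
move: m1 m2 m3 m4; rewrite !E => m1 m2.
move=> /(proj1 (ck_mem _ hr hc)) [v [hv kv]].
move=> /(proj1 (ck_mem _ hr hc)) [w [hw kw]].
move: m1 => /(proj1 (ck_mem _ hr kv)) [a [_ ka]].
move: m2 => /(proj1 (ck_mem _ hr kw)) [b [_ kb]].
exists a, b; split=> //; apply: ck_fun hc _ => //.
by apply/(ksat_OPair p hr he ka kb).
Qed.

Lemma ksat_PairIn n (r : M n) e x y P X : isreal r -> terms e -> ck r (e P) X ->
  ksat M (PairIn x y P) r e <->
  exists a b, opair a b ∈ X /\ ck r (e x) a /\ ck r (e y) b.
Proof.
move=> hr he hX; rewrite /PairIn (ksat_exs 1) //.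
split=> [[e' [he' [E]]]|[a [b [hab [ha hb]]]]].
- rewrite ksat_and ksat_mem (E P) (ck_mem _ hr hX) => -[h1 [z [hz kz]]].
  have [a [b [Ez [ha hb]]]] := ksat_OPair_inv hr he' kz h1; subst z.
  by exists a, b; rewrite -(E x) -(E y).
- have he' : terms (hat (opair a b) .: e) by exact: terms_hat.
  exists (hat (opair a b) .: e); split=> //; split=> //.
  rewrite ksat_and (ksat_OPair _ (a := a) (b := b)) // ksat_mem /=.
  split; first exact: ck_hat.
  by rewrite (ck_mem2 hr (ck_hat _ hr) hX).
Qed.
(** Here [P] is an arbitrary name, as needed for the closed sets over which sums and products
    quantify; in exchange, the components denote ground-model sets. *)
Lemma ksat_PairIn_names n (r : M n) e x y P a b : isreal r -> terms e ->
  ck r (e x) a -> ck r (e y) b ->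
  ksat M (PairIn x y P) r e <-> MEM r (hat (opair a b)) (e P).
Proof.
move=> hr he ha hb; rewrite /PairIn (ksat_exs 1) //.
split=> [[e' [he' [E]]]|h].
- rewrite ksat_and ksat_mem (E P) (ksat_OPair _ (a := a) (b := b)) //.
  + by rewrite (E x).
  + by rewrite (E y).
  + by move=> [k]; rewrite (ck_meml _ k).
- have he' : terms (hat (opair a b) .: e) by exact: terms_hat.
  exists (hat (opair a b) .: e); split=> //; split=> //.
  rewrite ksat_and (ksat_OPair _ (a := a) (b := b)) // ksat_mem /=.
  by split=> //; exact: ck_hat.
Qed.
End Absoluteness.

Section AbsoluteArithmetic.
Context {M : model_sequence}.
Implicit Types n m : nat.

Lemma Df_MEM_hat n (r P : M n) (t : (nat -> M n) -> M n) : DfT t ->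
  Df (fun e => MEM r (hat (t e)) P).
Proof. by move=> ht; apply: Df_MEM; [dfn|exact: DfT_hat|dfn]. Qed.

(** From left to right, [hat omega] is one of the inductive sets. From right to left, an inductive
    set may be an arbitrary name, so the induction takes place in the model of the node, on the
    definable predicate [MEM s (hat k) (e' 0)]; it reaches all integers of that model. *)
Lemma ksat_Nat n (r : M n) e x : isreal r -> terms e ->
  ksat M (Nat x) r e <-> exists k, isnat k /\ ck r (e x) k.
Proof.
move=> hr he; split=> [h|[k [hk hx]]].
- have ht : isterm (hat (omega : M n)) by exact: isterm_hat.
  have he1 := terms_scons ht he.
  enough (hI : ksat M (Inductive_set 0) r (hat omega .: e)).
  { have := ksat_mp (ksat_inst h ht) hI.
    rewrite ksat_mem /= (ck_mem _ hr (ck_hat _ hr)) => -[k [+ hx]].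
    by rewrite in_omega => hk; exists k. }
  rewrite /Inductive_set ksat_and; split.
  + apply: (ksat_alls_fimps 1 (Empty 0 :: nil) (FMem 0 1)) => //.
    move=> m s h' F e' G he' E [+ _]; have hs := good_real G.
    rewrite ksat_Empty // ksat_mem (E 0) /= (good_hat G) => h0.
    rewrite (ck_mem2 hs h0 (ck_hat _ hs)).
    by rewrite (el_omega F (good_el G)) in_omega; exact: isnat0.
  + apply: (ksat_alls_fimps 2 (FMem 0 2 :: Succ 0 1 :: nil) (FMem 1 2)) => //.
    move=> m s h' F e' G he' E [+ [+ _]]; have hs := good_real G.
    rewrite !ksat_mem (E 0) /= (good_hat G).
    rewrite (el_omega F (good_el G)).
    move=> /(proj1 (ck_mem _ hs (ck_hat _ hs))) [k [+ hk]].
    rewrite in_omega => kn /(proj1 (@ksat_Succ M m s e' 0 1 k hs he' hk)) hk'.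
    rewrite (ck_mem2 hs hk' (ck_hat _ hs)) in_omega.
    exact: isnatS.
- apply: (ksat_alls_fimps 1 (Inductive_set 0 :: nil) (FMem (S x) 0)) => //.
  move=> m s h' F e' G he' E [+ _]; have hs := good_real G.
  have hFx := ck_good G (he x) hx.
  rewrite ksat_mem (E x) (ck_meml _ hFx) /Inductive_set ksat_and => -[h0 hS].
  have hFk : isnat (F k) by apply: good_isnat G _.
  move: (F k) hFk; apply: (nat_ind (fun k => MEM s (hat k) (e' 0))).
  + by apply: Df_MEM_hat; dfn.
  + have ht : isterm (hat (emp : M m)) by exact: isterm_hat.
    have := ksat_mp (ksat_inst h0 ht).
    rewrite ksat_Empty // ?ksat_mem; first exact: terms_scons.
    by apply; exact: ck_hat.
  + move=> j hj hm.
    have h1 : isterm (hat j) by exact: isterm_hat.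
    have h2 : isterm (hat (succ j)) by exact: isterm_hat.
    have := ksat_mp (ksat_inst (ksat_inst hS h2) h1).
    rewrite !ksat_mem /= => /(_ hm) h3; have := ksat_mp h3.
    rewrite (@ksat_Succ _ _ _ _ _ _ j) // ?ksat_mem.
    * by do 2 apply: terms_scons => //.
    * exact: ck_hat.
    * by apply; exact: ck_hat.
Qed.

Section Recursion.
Variable op : forall X : structure, ZF X -> X -> X -> X.
Variable P : nat -> nat -> nat -> fml.
Hypothesis sat_P : forall (X : structure) (HX : ZF X) (e : nat -> X) (i j k : nat),
  isnat (e i) -> sat e (P i j k) <-> isnat (e j) /\ e k = op HX (e i) (e j).
Hypothesis Df_op : forall (X : structure) (HX : ZF X) (x : X),
  Df (fun e => e 0 = op HX x (e 1)).
Notation opn := (@op (M _) _).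

(* [T] and [i] describe the step and the start of the recursion for [op x], which
   defines [P]. *)
Lemma ksat_rec (T : fml) (i : nat) n (r : M n) e a b c x : isreal r -> terms e ->
  (forall m (s : M m) (e' : nat -> M m) y, ck s (e' (2 + a)) y -> ck s (e' 0) emp ->
     ck s (e' i) (opn y emp)) ->
  (forall m (s : M m) e' y k, isreal s -> terms e' -> isnat y -> isnat k ->
     ck s (e' (5 + a)) y -> ck s (e' 1) (opn y k) ->
     ksat M T s e' <-> ck s (e' 3) (opn y (succ k))) ->
  isnat x -> ck r (e a) x ->
  ksat M (All (FImp (All (FImp (Empty 0) (PairIn 0 i 1)))
    (FImp (alls 4 (FImp (PairIn 0 1 4) (FImp (Succ 0 2) (FImp T (PairIn 2 3 4)))))
    (PairIn (S b) (S c) 0)))) r e <->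
  exists k, isnat k /\ ck r (e b) k /\ ck r (e c) (opn x k).
Proof.
move=> hr he H0 HS nx hx; split=> [h|[k [hk [hb hc]]]].
- set g := rec_graph (opn x).
  have ht : isterm (hat g) by exact: isterm_hat.
  have he1 := terms_scons ht he.
  have hg1 : ck r ((hat g .: e) 0) g by exact: ck_hat.
  (* A transition turns the name of the graph for [x] into the name of the graph for [F x], because
     the graph is definable from [x]. *)
  have tr m (s : M m) h' F (e' : nat -> M m) p q : good r s h' F ->
      (forall j, e' (p + j) = h' ((hat g .: e) j)) -> q = p + 0 ->
      ck s (e' q) (rec_graph (opn (F x))).
    move=> G E ->; rewrite (E 0) -(el_rec_graph F (good_el G) (@op) P x sat_P Df_op nx).
    exact: (ck_good G ht hg1).
  assert (hA : ksat M (All (FImp (Empty 0) (PairIn 0 i 1))) r (hat g .: e)).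
  { apply: (ksat_alls_fimps 1 (Empty 0 :: nil)) => //.
    move=> m s h' F e' G he' E [+ _]; have hs := good_real G.
    have hg := tr m s h' F e' 1 1 G E (erefl _).
    have ha' : ck s (e' (2 + a)) (F x) by rewrite (E (S a)); exact: (ck_good G (he a) hx).
    rewrite (ksat_Empty _ hs he') => h0; rewrite (ksat_PairIn _ _ hs he' hg).
    exists emp, (opn (F x) emp); split; last by split=> //; exact: H0.
    by rewrite (in_rec_graph _ _ (Df_op _ _)); exists emp; auto. }
  assert (hB : ksat M (alls 4 (FImp (PairIn 0 1 4) (FImp (Succ 0 2) (FImp T
    (PairIn 2 3 4))))) r (hat g .: e)).
  { apply: (ksat_alls_fimps 4 (PairIn 0 1 4 :: Succ 0 2 :: T :: nil)) => //.
    move=> m s h' F e' G he' E [+ [+ [+ _]]]; have hs := good_real G.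
    have hg := tr m s h' F e' 4 4 G E (erefl _).
    have nx' : isnat (F x) by apply: good_isnat G _.
    have ha' : ck s (e' (5 + a)) (F x) by rewrite (E (S a)); exact: (ck_good G (he a) hx).
    rewrite !(ksat_PairIn _ _ hs he' hg) => -[u [v [+ [hu hv]]]].
    rewrite (in_rec_graph _ _ (Df_op _ _)) => -[k [hk /opair_inj [Eu Ev]]]; subst u v.
    rewrite (ksat_Succ _ hs he' hu) => h1 /(proj1 (HS _ _ _ _ _ hs he' nx' hk ha' hv)) h2.
    exists (succ k), (opn (F x) (succ k)); split=> //.
    by rewrite (in_rec_graph _ _ (Df_op _ _)); exists (succ k); auto. }
  have := ksat_mp (ksat_mp (ksat_inst h ht) hA) hB.
  rewrite (ksat_PairIn _ _ hr he1 hg1) => -[u [v [+ [hu hv]]]].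
  rewrite (in_rec_graph _ _ (Df_op _ _)) => -[k [hk /opair_inj [Eu Ev]]]; subst u v.
  by exists k.
- apply: (ksat_alls_fimps 1 (All (FImp (Empty 0) (PairIn 0 i 1)) ::
    alls 4 (FImp (PairIn 0 1 4) (FImp (Succ 0 2) (FImp T (PairIn 2 3 4)))) ::
    nil)) => //.
  move=> m s h' F e' G he' E [hA [hB _]]; have hs := good_real G.
  have el := good_el G.
  have nx' : isnat (F x) by apply: good_isnat G _.
  have hFk : isnat (F k) by apply: good_isnat G _.
  have ha' : ck s (e' (1 + a)) (F x) by rewrite (E a); exact: (ck_good G (he a) hx).
  have hb' : ck s (e' (S b)) (F k) by rewrite (E b); exact: (ck_good G (he b) hb).
  have hc' : ck s (e' (S c)) (opn (F x) (F k)).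
    by rewrite (E c) -(el_op F el (@op) P _ _ sat_P) //; exact: (ck_good G (he c) hc).
  rewrite (ksat_PairIn_names _ hs he' hb' hc').
  move: (F k) hFk {hb' hc'}.
  (* The closed set is an arbitrary name; definability of [MEM] permits induction over all integers
     of [M m]. *)
  apply: (nat_ind (fun k => MEM s (hat (opair k (opn (F x) k))) (e' 0))).
  + apply: Df_MEM_hat; apply: DfT_opair; first dfn.
    by apply: (DfT_fun1 (opn (F x))); [exact: Df_op|dfn].
  + have t0 : isterm (hat (emp : M m)) by exact: isterm_hat.
    have he2 := terms_scons t0 he'.
    have k0 : ck s ((hat emp .: e') 0) emp by exact: ck_hat.
    have k1 : ck s ((hat emp .: e') i) (opn (F x) emp) by exact: H0.
    have := ksat_mp (ksat_inst hA t0).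
    rewrite (ksat_Empty _ hs he2) (ksat_PairIn_names _ hs he2 k0 k1).
    exact.
  + move=> j hj IH; set v := opn (F x) j in IH; set w := opn (F x) (succ j).
    set e2 := hat j .: hat v .: hat (succ j) .: hat w .: e'.
    have he2 : terms e2 by do 4 apply: terms_hat.
    have k0 : ck s (e2 0) j by exact: ck_hat.
    have k1 : ck s (e2 1) v by exact: ck_hat.
    have k2 : ck s (e2 2) (succ j) by exact: ck_hat.
    have k3 : ck s (e2 3) w by exact: ck_hat.
    have t y : isterm (hat (y : M m)) by exact: isterm_hat.
    pose proof (ksat_inst (ksat_inst (ksat_inst (ksat_inst hB (t w)) (t (succ j))) (t v))
      (t j)) as h1.
    pose proof (ksat_mp (ksat_mp (ksat_mp h1
      (proj2 (@ksat_PairIn_names M m s e2 0 1 4 j v hs he2 k0 k1) IH))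
      (proj2 (@ksat_Succ M m s e2 0 2 j hs he2 k0) k2))
      (proj2 (HS m s e2 _ _ hs he2 nx' hj ha' k1) k3)) as h2.
    exact: (proj1 (@ksat_PairIn_names M m s e2 2 3 4 _ _ hs he2 k2 k3) h2).
Qed.
End Recursion.

Lemma ksat_Plus n (r : M n) e a b c a0 : isreal r -> terms e -> isnat a0 ->
  ck r (e a) a0 ->
  ksat M (Plus a b c) r e <->
  exists k, isnat k /\ ck r (e b) k /\ ck r (e c) (nadd a0 k).
Proof.
move=> hr he; apply: (ksat_rec (op := @nadd) (P := Plus)) => //.
- exact: @sat_Plus.
- by move=> X HX x; apply: Df_eq; dfn.
- by move=> m s e' y; rewrite nadd0.
- by move=> m s e' y k hs he' _ hk _ h1; rewrite naddS //; exact: ksat_Succ.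
Qed.
Lemma ksat_Times n (r : M n) e a b c a0 : isreal r -> terms e -> isnat a0 ->
  ck r (e a) a0 ->
  ksat M (Times a b c) r e <->
  exists k, isnat k /\ ck r (e b) k /\ ck r (e c) (nmul a0 k).
Proof.
move=> hr he; apply: (ksat_rec (op := @nmul) (P := Times)) => //.
- exact: @sat_Times.
- by move=> X HX x; apply: Df_eq; dfn.
- by move=> m s e' y _; rewrite nmul0.
- move=> m s e' y k hs he' ny nk hy h1; rewrite nmulS //.
  rewrite (ksat_Plus _ _ hs he' (isnat_nmul _ _ ny nk) h1).
  split=> [[j [_ [hj]]]|h]; last by exists y.
  by rewrite (ck_fun hs hj hy).
Qed.
End AbsoluteArithmetic.

Section AbsoluteRationals.
Context {M : model_sequence}.
Implicit Types n m : nat.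

Lemma avars_impl (P Q : nat -> Prop) t : (forall i, P i -> Q i) -> avars P t -> avars Q t.
Proof. by move=> H; elim: t => [i|s IHs t IHt|s IHs t IHt] //=; [exact: H|tauto|tauto]. Qed.

(* The variables of an expression denote names of the natural numbers [v i]. *)
Definition nat_env n (r : M n) (k : nat) (e v : nat -> M n) (t : aexp) : Prop :=
  avars (fun i => isnat (v i) /\ ck r (e (k + i)) (v i)) t.

Lemma nat_env_isnat n (r : M n) k e v t : nat_env r k e v t -> isnat (aval v t).
Proof. by move=> h; apply: isnat_aval; apply: avars_impl h => i []. Qed.
Lemma nat_env_shift n (r : M n) k k' e e' v t :
  (forall i, e' (k' + i) = e (k + i)) -> nat_env r k e v t -> nat_env r k' e' v t.
Proof. by move=> E; apply: avars_impl => i; rewrite E. Qed.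

(** Shared by sums and products: the hypothesis on [P] is what [ksat_Plus] and [ksat_Times] provide
    when the first argument denotes an integer. *)
Lemma ksat_Val_op (P : fml) n (op : M n -> M n -> M n) (r : M n) e k z v s t :
  isreal r -> terms e ->
  (forall e' y, terms e' -> nat_env r (2 + k) e' v s ->
     ksat M (Val (2 + k) s y) r e' <-> ck r (e' y) (aval v s)) ->
  (forall e' y, terms e' -> nat_env r (2 + k) e' v t ->
     ksat M (Val (2 + k) t y) r e' <-> ck r (e' y) (aval v t)) ->
  (forall e' x, terms e' -> isnat x -> ck r (e' 0) x -> ksat M P r e' <->
     exists y, isnat y /\ ck r (e' 1) y /\ ck r (e' (2 + z)) (op x y)) ->
  nat_env r k e v s -> nat_env r k e v t ->
  ksat M (exs 2 (FAnd (Val (2 + k) s 0) (FAnd (Val (2 + k) t 1) P))) r e <->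
  ck r (e z) (op (aval v s) (aval v t)).
Proof.
move=> hr he IHs IHt HP hs ht; rewrite (ksat_exs 2) //.
have ns := nat_env_isnat hs.
have nt := nat_env_isnat ht.
have E2 (e' : nat -> M n) : (forall i, e' (2 + i) = e i) ->
    nat_env r (2 + k) e' v s /\ nat_env r (2 + k) e' v t.
  by move=> E; split; [apply: nat_env_shift hs|apply: nat_env_shift ht] => i; exact: (E (k + i)).
split=> [[e' [he' [E]]]|h].
- have [hs' ht'] := E2 e' E.
  rewrite !ksat_and (IHs _ _ he' hs') (IHt _ _ he' ht') => -[h1 [h2]].
  rewrite (HP _ _ he' ns h1) => -[j [_ [hj]]].
  by rewrite (ck_fun hr hj h2) (E z).
- set e' := hat (aval v s) .: hat (aval v t) .: e.
  have he' : terms e' by do 2 apply: terms_hat.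
  have h1 : ck r (e' 0) (aval v s) by exact: ck_hat.
  have h2 : ck r (e' 1) (aval v t) by exact: ck_hat.
  have [hs' ht'] := E2 e' (fun i => erefl _).
  exists e'; split=> //; split=> //.
  rewrite !ksat_and (IHs _ _ he' hs') (IHt _ _ he' ht') (HP _ _ he' ns h1).
  by split=> //; split=> //; exists (aval v t).
Qed.
Lemma ksat_Val t n (r : M n) e k z v : isreal r -> terms e -> nat_env r k e v t ->
  ksat M (Val k t z) r e <-> ck r (e z) (aval v t).
Proof.
elim: t n r e k z v => [i|s IHs t IHt|s IHs t IHt] n r e k z v hr he; cbn [Val aval].
- move=> [hi hk]; rewrite ksat_eq -(ck_eq _ hk).
  by split; exact: EQ_sym.
- move=> [hs ht]; apply: ksat_Val_op => // *;
    by [apply: IHs|apply: IHt|apply: ksat_Plus].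
- move=> [hs ht]; apply: ksat_Val_op => // *;
    by [apply: IHs|apply: IHt|apply: ksat_Times].
Qed.

Lemma ksat_AEq n (r : M n) e s t v : isreal r -> terms e ->
  nat_env r 0 e v s -> nat_env r 0 e v t ->
  ksat M (AEq s t) r e <-> aval v s = aval v t.
Proof.
move=> hr he hs ht; rewrite /AEq (ksat_exs 1) //.
split=> [[e' [he' [E]]]|h].
- have hs' : nat_env r 1 e' v s by exact: nat_env_shift hs.
  have ht' : nat_env r 1 e' v t by exact: nat_env_shift ht.
  rewrite ksat_and (ksat_Val _ hr he' hs') (ksat_Val _ hr he' ht').
  by move=> [h1 h2]; exact: ck_fun hr h1 h2.
- set e' := hat (aval v s) .: e.
  have he' : terms e' by exact: terms_hat.
  have hs' : nat_env r 1 e' v s by exact: nat_env_shift hs.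
  have ht' : nat_env r 1 e' v t by exact: nat_env_shift ht.
  exists e'; split=> //; split=> //.
  rewrite ksat_and (ksat_Val _ hr he' hs') (ksat_Val _ hr he' ht').
  by rewrite -h; split; exact: ck_hat.
Qed.
Lemma ksat_ALt n (r : M n) e s t v : isreal r -> terms e ->
  nat_env r 0 e v s -> nat_env r 0 e v t ->
  ksat M (ALt s t) r e <-> aval v s ∈ aval v t.
Proof.
move=> hr he hs ht; rewrite /ALt (ksat_exs 2) //.
split=> [[e' [he' [E]]]|h].
- have hs' : nat_env r 2 e' v s by exact: nat_env_shift hs.
  have ht' : nat_env r 2 e' v t by exact: nat_env_shift ht.
  rewrite !ksat_and (ksat_Val _ hr he' hs') (ksat_Val _ hr he' ht').
  by move=> [h1 [h2]]; rewrite ksat_mem (ck_mem2 hr h1 h2).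
- set e' := hat (aval v s) .: hat (aval v t) .: e.
  have he' : terms e' by do 2 apply: terms_hat.
  have h1 : ck r (e' 0) (aval v s) by exact: ck_hat.
  have h2 : ck r (e' 1) (aval v t) by exact: ck_hat.
  have hs' : nat_env r 2 e' v s by exact: nat_env_shift hs.
  have ht' : nat_env r 2 e' v t by exact: nat_env_shift ht.
  exists e'; split=> //; split=> //.
  rewrite !ksat_and (ksat_Val _ hr he' hs') (ksat_Val _ hr he' ht').
  by do 2 (split=> //); rewrite ksat_mem (ck_mem2 hr h1 h2).
Qed.

Lemma ksat_Frac n (r : M n) e a b c q a0 b0 c0 : isreal r -> terms e ->
  ck r (e a) a0 -> ck r (e b) b0 -> ck r (e c) c0 ->
  ksat M (Frac a b c q) r e <-> ck r (e q) (opair a0 (opair b0 c0)).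
Proof.
move=> hr he ha hb hc; rewrite /Frac (ksat_exs 1) //.
split=> [[e' [he' [E]]]|h].
- have ha' : ck r (e' (S a)) a0 by rewrite (E a).
  have hb' : ck r (e' (S b)) b0 by rewrite (E b).
  have hc' : ck r (e' (S c)) c0 by rewrite (E c).
  rewrite ksat_and (ksat_OPair _ hr he' hb' hc') => -[h1].
  by rewrite (ksat_OPair _ hr he' ha' h1) (E q).
- set e' := hat (opair b0 c0) .: e.
  have he' : terms e' by exact: terms_hat.
  have ha' : ck r (e' (S a)) a0 by [].
  have hb' : ck r (e' (S b)) b0 by [].
  have hc' : ck r (e' (S c)) c0 by [].
  have h1 : ck r (e' 0) (opair b0 c0) by exact: ck_hat.
  exists e'; split=> //; split=> //.
  rewrite ksat_and (ksat_OPair _ hr he' hb' hc').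
  by rewrite (ksat_OPair _ hr he' ha' h1).
Qed.
Lemma ksat_Frac_inv n (r : M n) e a b c q q0 : isreal r -> terms e ->
  ck r (e q) q0 -> ksat M (Frac a b c q) r e ->
  exists a0 b0 c0, q0 = opair a0 (opair b0 c0) /\
    ck r (e a) a0 /\ ck r (e b) b0 /\ ck r (e c) c0.
Proof.
move=> hr he hq; rewrite /Frac (ksat_exs 1) // => -[e' [he' [E]]].
have hq' : ck r (e' (S q)) q0 by rewrite (E q).
rewrite ksat_and => -[h1 /(ksat_OPair_inv hr he' hq') [a0 [d0 [-> [ha hd]]]]].
move: h1 => /(ksat_OPair_inv hr he' hd) [b0 [c0 [-> [hb hc]]]].
exists a0, b0, c0; split=> //; move: ha hb hc; rewrite (E a) (E b) (E c).
by [].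
Qed.

Lemma ksat_RatLt n (r : M n) e p q p0 q0 : isreal r -> terms e ->
  israt p0 -> israt q0 -> ck r (e p) p0 -> ck r (e q) q0 ->
  ksat M (RatLt p q) r e <-> rlt p0 q0.
Proof.
move=> hr he hp0 hq0 hp hq; rewrite /RatLt (ksat_exs 6) //.
split=> [[e' [he' [E]]]|h].
- have hp' : ck r (e' (6 + p)) p0 by rewrite E.
  have hq' : ck r (e' (6 + q)) q0 by rewrite E.
  rewrite !ksat_and => -[/(ksat_Frac_inv hr he' hp') [a [b [c [Ep [ha [hb hc]]]]]]].
  move=> [/(ksat_Frac_inv hr he' hq') [a' [b' [c' [Eq [ha' [hb' hc']]]]]]].
  have [na [nb nc]] := rep_isnat _ _ _ _ hp0 Ep.
  have [na' [nb' nc']] := rep_isnat _ _ _ _ hq0 Eq.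
  rewrite (rlt_rep _ _ _ _ _ _ _ _ hp0 hq0 Ep Eq).
  by rewrite (ksat_ALt (v := a .: b .: c .: a' .: b' .: cst c')).
- have [a [b [c Ep]]] := rat_opair _ hp0; have [a' [b' [c' Eq]]] := rat_opair _ hq0.
  have [na [nb nc]] := rep_isnat _ _ _ _ hp0 Ep.
  have [na' [nb' nc']] := rep_isnat _ _ _ _ hq0 Eq.
  set e' := hat a .: hat b .: hat c .: hat a' .: hat b' .: hat c' .: e.
  have he' : terms e' by do 6 apply: terms_hat.
  have k0 : ck r (e' 0) a by exact: ck_hat.
  have k1 : ck r (e' 1) b by exact: ck_hat.
  have k2 : ck r (e' 2) c by exact: ck_hat.
  have k3 : ck r (e' 3) a' by exact: ck_hat.
  have k4 : ck r (e' 4) b' by exact: ck_hat.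
  have k5 : ck r (e' 5) c' by exact: ck_hat.
  exists e'; split=> //; split=> //.
  rewrite !ksat_and (ksat_Frac _ hr he' k0 k1 k2) -Ep.
  rewrite (ksat_Frac _ hr he' k3 k4 k5) -Eq.
  split; first exact: hp.
  split; first exact: hq.
  rewrite (ksat_ALt (v := a .: b .: c .: a' .: b' .: cst c')) //.
  exact/(rlt_rep _ _ _ _ _ _ _ _ hp0 hq0 Ep Eq).
Qed.
End AbsoluteRationals.

Section KripkeRationals.
Context {M : model_sequence}.
Implicit Types n m : nat.

(** Negation looks at all later nodes; there the name denotes [F c], and the injectivity of [F]
    keeps it distinct from the empty set. *)
Lemma ksat_not_Empty n (r : M n) e x c : isreal r -> terms e -> ck r (e x) c ->
  ksat M (FNot (Empty x)) r e <-> c <> emp.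
Proof.
move=> hr he hc; split=> [h E|h].
- by apply: ksat_bot; apply: ksat_mp h _; rewrite ksat_Empty // -E.
- apply: (ksat_fimps (Empty x :: nil) FBot) => // m s h' F G [h0 _]; exfalso.
  have hs := good_real G; have el := good_el G.
  move: h0; rewrite (ksat_Empty _ hs (terms_good G he)) => h0.
  apply: h; apply: (el_inj F el); rewrite (el_emp F el).
  exact: ck_fun hs (ck_good G (he x) hc) h0.
Qed.

Definition Coprime : fml := alls 3 (FImp (Nat 0) (FImp (Nat 1) (FImp (Nat 2)
  (FImp (AEq (AMul (AVar 0) (AVar 1)) (AAdd (AVar 3) (AVar 4)))
  (FImp (AEq (AMul (AVar 0) (AVar 2)) (AVar 5))
  (Ex (FAnd (Empty 0) (Succ 0 1)))))))).

(** A universal formula speaks of the later models as well, so coprimality is required of all images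
    of [a], [b], [c]. *)
Lemma ksat_Coprime n (r : M n) e a b c : isreal r -> terms e ->
  isnat a -> isnat b -> isnat c ->
  ck r (e 0) a -> ck r (e 1) b -> ck r (e 2) c ->
  ksat M Coprime r e <->
  forall m (s : M m) h F, good r s h F -> coprime_pair (nadd (F a) (F b)) (F c).
Proof.
move=> hr he na nb nc ha hb hc; split=> [H m s h F G k j d nd nj nk E1 E2|H].
- have hs := good_real G; have el := good_el G.
  have na' : isnat (F a) by apply: good_isnat G _.
  have nb' : isnat (F b) by apply: good_isnat G _.
  have nc' : isnat (F c) by apply: good_isnat G _.
  have hes := terms_good G he.
  have t x : isterm (hat (x : M m)) by exact: isterm_hat.
  set e' := hat d .: hat j .: hat k .: (fun i => h (e i)).
  have he' : terms e' by do 3 apply: terms_hat.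
  have kd : ck s (e' 0) d by exact: ck_hat.
  have kj : ck s (e' 1) j by exact: ck_hat.
  have kk : ck s (e' 2) k by exact: ck_hat.
  have ka : ck s (e' 3) (F a) by exact: (ck_good G (he 0) ha).
  have kb : ck s (e' 4) (F b) by exact: (ck_good G (he 1) hb).
  have kc : ck s (e' 5) (F c) by exact: (ck_good G (he 2) hc).
  pose proof (ksat_mono hr he (good_transition G) H) as H1.
  pose proof (ksat_inst (ksat_inst (ksat_inst H1 (t k))
    (t j)) (t d)) as H2.
  have N0' : ksat M (Nat 0) s e' by rewrite ksat_Nat //; exists d.
  have N1' : ksat M (Nat 1) s e' by rewrite ksat_Nat //; exists j.
  have N2' : ksat M (Nat 2) s e' by rewrite ksat_Nat //; exists k.
  have A1 : ksat M (AEq (AMul (AVar 0) (AVar 1)) (AAdd (AVar 3) (AVar 4))) s e'.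
    by rewrite (ksat_AEq (v := d .: j .: k .: F a .: F b .: cst (F c))).
  have A2 : ksat M (AEq (AMul (AVar 0) (AVar 2)) (AVar 5)) s e'.
    by rewrite (ksat_AEq (v := d .: j .: k .: F a .: F b .: cst (F c))).
  pose proof (ksat_mp (ksat_mp (ksat_mp
    (ksat_mp (ksat_mp H2 N0') N1') N2') A1) A2) as H3.
  move: H3; rewrite (ksat_exs 1) // => -[e2 [he2 [E]]].
  rewrite ksat_and (ksat_Empty _ hs he2) => -[h0].
  rewrite (ksat_Succ _ hs he2 h0) (E 0) => h1.
  exact: ck_fun hs kd h1.
- apply: (ksat_alls_fimps 3 (Nat 0 :: Nat 1 :: Nat 2 ::
    AEq (AMul (AVar 0) (AVar 1)) (AAdd (AVar 3) (AVar 4)) ::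
    AEq (AMul (AVar 0) (AVar 2)) (AVar 5) :: nil)) => //.
  move=> m s h' F e' G he' E; have hs := good_real G.
  have el := good_el G.
  have na' : isnat (F a) by apply: good_isnat G _.
  have nb' : isnat (F b) by apply: good_isnat G _.
  have nc' : isnat (F c) by apply: good_isnat G _.
  have ka : ck s (e' 3) (F a).
    by rewrite (E 0); exact: (ck_good G (he 0) ha).
  have kb : ck s (e' 4) (F b).
    by rewrite (E 1); exact: (ck_good G (he 1) hb).
  have kc : ck s (e' 5) (F c).
    by rewrite (E 2); exact: (ck_good G (he 2) hc).
  cbn [ksats]; rewrite !(ksat_Nat _ hs he').
  move=> [[d [nd kd]] [[j [nj kj]] [[k [nk kk]] [A1 [A2 _]]]]].
  rewrite (ksat_AEq (v := d .: j .: k .: F a .: F b .: cst (F c))) // in A1.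
  rewrite (ksat_AEq (v := d .: j .: k .: F a .: F b .: cst (F c))) // in A2.
  have Ed : d = succ emp by exact: (H m s h' F G k j d nd nj nk A1 A2).
  have he2 : terms (hat emp .: e') by exact: terms_hat.
  rewrite (ksat_exs 1) //; exists (hat emp .: e'); split=> //; split=> //.
  have h0 : ck s ((hat emp .: e') 0) emp by exact: ck_hat.
  rewrite ksat_and (ksat_Empty _ hs he2); split; first exact: h0.
  by rewrite (@ksat_Succ M m s _ 0 1 emp hs he2 h0) -Ed.
Qed.

Lemma ksat_Rat n (r : M n) e q : isreal r -> terms e ->
  ksat M (Rat q) r e <-> exists q0, israt q0 /\ ck r (e q) q0.
Proof.
move=> hr he; rewrite /Rat -/Coprime (ksat_exs 3) //.
split=> [[e' [he' [E]]]|[q0 [hq0 hq]]].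
- rewrite !ksat_and ksat_or !(ksat_Nat _ hr he') !(ksat_Empty _ hr he').
  move=> [[a [na ka]] [[b [nb kb]] [[c [nc kc]] [hF [hc [hab hC]]]]]].
  move: hF; rewrite (ksat_Frac _ hr he' ka kb kc) (E q) => hq.
  exists (opair a (opair b c)); split=> //; apply/israt_rep; exists c, b, a.
  do 4 (split=> //); split; first exact/(ksat_not_Empty hr he' kc).
  split.
    by case: hab => h; [left; exact: ck_fun hr ka h|right; exact: ck_fun hr kb h].
  by have := proj1 (ksat_Coprime hr he' na nb nc ka kb kc) hC _ _ _ _
    (good_id hr).
- have [c [b [a [na [nb [nc [Eq [c0 [ab cop]]]]]]]]] := proj1 (israt_rep q0) hq0.
  set e' := hat a .: hat b .: hat c .: e.
  have he' : terms e' by do 3 apply: terms_hat.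
  have ka : ck r (e' 0) a by exact: ck_hat.
  have kb : ck r (e' 1) b by exact: ck_hat.
  have kc : ck r (e' 2) c by exact: ck_hat.
  exists e'; split=> //; split=> //.
  rewrite !ksat_and ksat_or !(ksat_Nat _ hr he') !(ksat_Empty _ hr he').
  split; first by exists a.
  split; first by exists b.
  split; first by exists c.
  rewrite (ksat_Frac _ hr he' ka kb kc) -Eq.
  split; first exact: hq.
  split; first exact/(ksat_not_Empty hr he' kc).
  split; first by case: ab => E0; [left; rewrite -E0|right; rewrite -E0].
  apply/(ksat_Coprime hr he' na nb nc ka kb kc) => m s h F G.
  have el := good_el G.
  (* Coprimality at a later node is obtained from the elementarity of [F] for the formula [Rat]: the
     image of the code is again the code of a rational. *)
  have /israt_rep [c' [b' [a' [_ [_ [_ [Eq' [_ [_ cop']]]]]]]]] : israt (F q0).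
    by apply/(el_israt F el).
  move: Eq'; rewrite Eq !(el_opair F el) => /opair_inj [-> /opair_inj [-> ->]].
  exact: cop'.
Qed.
End KripkeRationals.

(** * The generic name as a Dedekind real *)

Section KripkeReals.
Context {M : model_sequence}.
Implicit Types n m : nat.

(* At the node [r] the name [S] denotes the cut [x]: transition functions turn
   [gen] into names of this kind only. *)
Definition cut_name n (r S x : M n) : Prop :=
  isreal x /\ ((S = gen /\ x = r) \/ S = hat x).

Lemma cut_name_mem n (r S x t : M n) : isreal r -> cut_name r S x ->
  MEM r t S <-> exists q, q ∈ x /\ ck r t q.
Proof.
move=> hr [_ [[-> ->]|->]]; last exact: ck_mem _ hr (ck_hat _ hr).
rewrite MEM_gen //.
by split=> -[q [hq h]]; exists q; split=> //; move: h; rewrite ckE.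
Qed.
(** The cut denoted at the later node need not be [F x]: as long as [gen] is unsettled, the cut
    follows the current node, which moves by infinitesimals. Strict upper bounds survive this. *)
Lemma cut_name_good n (r : M n) m (s : M m) h F S x : good r s h F -> cut_name r S x ->
  exists x', cut_name s (h S) x' /\
    forall q, israt q -> above x (qval q) -> above x' (qval (F q)).
Proof.
move=> G; have hs := good_real G; have el := good_el G.
move=> [hx [[-> ->]|->]].
- case: (good_gen G) => [->|[x' [hx' [-> H]]]].
  + by exists s; split; [split=> //; left|exact: (good_above G)].
  + by exists x'; split=> //; split=> //; right.
- exists (F x); split.
    by split; [apply/(el_isreal F el)|right; exact: (good_hat G)].
  by move=> q hq ?; apply/(el_above F el).
Qed.

(** Plain non-membership of [q] in the present cut would not refute membership at later nodes; being
    strictly above it does, since this persists. *)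
Lemma ksat_notin n (r : M n) e i j X q : isreal r -> terms e -> cut_name r (e j) X ->
  israt q -> ck r (e i) q -> above X (qval q) -> ksat M (FNot (FMem i j)) r e.
Proof.
move=> hr he hX hq kq hXq.
apply: (ksat_fimps (FMem i j :: nil) FBot) => // m s h F G [+ _].
have hs := good_real G; have el := good_el G.
have [X' [hX' H]] := cut_name_good G hX.
rewrite ksat_mem (cut_name_mem _ hs hX') => -[q' [hq' kq']]; exfalso.
have E := ck_fun hs kq' (ck_good G (he i) kq); subst q'.
have [u [hu hXu]] := H q hq hXq; apply: hXu.
apply: (inval_lt X' (proj1 hX') _ _ hu); apply/inval_mem => //; first exact: (proj1 hX').
by apply/(el_israt F el).
Qed.

Lemma ksat_Ded n (r : M n) e x X : isreal r -> terms e -> cut_name r (e x) X ->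
  ksat M (Ded x) r e.
Proof.
(* The conjuncts are treated in this order: openness, locatedness, the two halves of boundedness,
   and finally that all members are rationals. *)
move=> hr he hX; rewrite /Ded !ksat_and; split; last split; first last; [split|split|].
- apply: (ksat_alls_fimps 1 (FMem 0 (S x) :: nil)) => //.
  move=> m s h F e' G he' E [+ _]; have hs := good_real G.
  have [X' [hX' _]] := cut_name_good G hX; rewrite -(E x) in hX'.
  have [h1 [_ [h3 _]]] := proj1 hX'.
  rewrite ksat_mem (cut_name_mem _ hs hX') => -[q [hq kq]].
  have [p [hp hqp]] := h3 q hq.
  set e2 := hat p .: e'.
  have he2 : terms e2 by exact: terms_hat.
  have kp : ck s (e2 0) p by exact: ck_hat.
  rewrite (ksat_exs 1) //; exists e2; split=> //; split=> //.
  rewrite ksat_and ksat_mem; split; first by apply/(cut_name_mem (x := X')) => //; exists p.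
  by rewrite (ksat_RatLt hs he2 (h1 _ hq) (h1 _ hp)).
- apply: (ksat_alls_fimps 2 (Rat 0 :: Rat 1 :: RatLt 0 1 :: nil)) => //.
  move=> m s h F e' G he' E [+ [+ [+ _]]]; have hs := good_real G.
  have [X' [hX' _]] := cut_name_good G hX; rewrite -(E x) in hX'.
  rewrite !(ksat_Rat _ hs he') => -[p [hp kp]] [q [hq kq]].
  rewrite (ksat_RatLt hs he' hp hq kp kq) => hpq; rewrite ksat_or.
  (* The disjunction is decided in the ground model. If [p] is not in the cut, it witnesses that the
     larger [q] is strictly above it. *)
  case: (classic (p ∈ X')) => hpX; [left|right].
  + by rewrite ksat_mem (cut_name_mem _ hs hX'); exists p.
  + apply: (ksat_notin (X := X') (q := q)) => //; exists (qval p); split=> //.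
    by rewrite inval_mem //; exact: (proj1 hX').
- have [h1 [[[q [hq hqX]] _] _]] := proj1 hX.
  set e2 := hat q .: e.
  have he2 : terms e2 by exact: terms_hat.
  have kq : ck r (e2 0) q by exact: ck_hat.
  rewrite (ksat_exs 1) //; exists e2; split=> //; split=> //.
  rewrite ksat_and ksat_mem (ksat_Rat _ hr he2); split; first by exists q.
  by apply/(cut_name_mem (x := X)) => //; exists q.
- have [q [hq hqX]] := above_rat X (proj1 hX).
  set e2 := hat q .: e.
  have he2 : terms e2 by exact: terms_hat.
  have kq : ck r (e2 0) q by exact: ck_hat.
  rewrite (ksat_exs 1) //; exists e2; split=> //; split=> //.
  rewrite ksat_and (ksat_Rat _ hr he2); split; first by exists q.
  exact: (ksat_notin (X := X) (q := q)).
- apply: (ksat_alls_fimps 1 (FMem 0 (S x) :: nil)) => //.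
  move=> m s h F e' G he' E [+ _]; have hs := good_real G.
  have [X' [hX' _]] := cut_name_good G hX; rewrite -(E x) in hX'.
  rewrite ksat_mem (cut_name_mem _ hs hX') => -[q [hq kq]].
  rewrite (ksat_Rat _ hs he'); exists q; split=> //.
  exact: (proj1 (proj1 hX')).
Qed.

(* The members of a settled name are settled, so an open set forcing [gen] equal
   to one of them would contain a single real. *)
Lemma gen_notin_settled n (s z : M n) : isreal s -> ~ MEM s gen (settle s z).
Proof.
move=> hs /MEM_iff [t [j [+ [_ [_ /EQ_iff [J [hJ [hsJ H]]]]]]]].
rewrite in_settle => -[u [j' [_ [_ /opair_inj [Et _]]]]]; subst t.
have E y : y ∈ J -> hat y = settle s u.
  move=> hy; have hry := proj1 hJ y hy; have [_ [_]] := H y hy.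
  by rewrite settle_gen // settle_settle.
have [y [hy hys]] := isopen_other J s hJ hsJ.
by apply: hys; apply: hat_inj; rewrite !E.
Qed.
End KripkeReals.

Theorem theorem3p17 (M : model_sequence) :
  kripke_valid M (FNot (Ex (All (FIff (FMem 0 1) (Ded 0))))).
Proof.
move=> n r /is_realE hr e he; rewrite ksat_imp => m s h tr.
have {}he : terms e by move=> i; apply/is_termE.
have [F G] := transition_good hr tr.
have hs := good_real G.
have hes := terms_good G he.
rewrite ksat_ex => -[z [hz H]]; exfalso.
have [J [hJ [hsJ HJ]]] := immediate_nbhd M m s hs.
(* The infinitely close real is [emb s] itself, which lies in its own neighbourhood. *)
have hs' : isreal (emb s) by exact: (proj1 hJ).
have tr' := transition1 (step_settle hs' (HJ _ hsJ)).
have hze := terms_scons hz hes.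
pose proof (ksat_mono hs hze tr' H) as H'.
have tgen : isterm (gen (M := M (S m))) by exact: isterm_gen.
pose proof (ksat_iff_elim H' tgen) as [_ H2].
apply: (gen_notin_settled (z := emb z) hs').
move: H2; rewrite ksat_mem; apply.
have [F' G'] := transition_good hs tr'.
apply: (ksat_Ded _ (X := emb s)) => //.
- by apply: terms_scons => //; exact: (terms_good G' hze).
- by split=> //; left.
Qed.
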